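(* Let $0<d<k$ be integers and let $\epsilon>0$. Then for Lebesgue almost all linear maps $L:\mathbb{R}^d\to\mathbb{R}^{k-d}$, for the corresponding cubical cut and project sets, and for every admissible internal space $F_\pi$ (with associated projection $\pi$), there is a constant $C>0$ that only depends on $L$, $\epsilon$ and $\pi$ such that the following holds for every regular $s\in\mathbb{R}^k$, with $Y=Y_s$. Fix a bounded convex set $\Omega\subseteq E$ containing a neighbourhood of the origin of $E$. Let $r>0$ and let $y'\in Y$. (Type II) For the type II patch class $\mathcal{P}_{\mathrm{II}}=\mathcal{P}_{\mathrm{II}}(y',r\Omega)$, for all $y\in Y$ and all $R\ge 1$, \[ |\xi_{\mathcal{P}_{\mathrm{II}}}(y,R)-\xi_{\mathcal{P}_{\mathrm{II}}}|\le C\cdot\frac{(\log R)^{k+\epsilon}}{R^d}. \] (Type I) Furthermore, for $r$ large enough, for the type I patch class $\mathcal{P}_{\mathrm{I}}=\mathcal{P}_{\mathrm{I}}(y',r\Omega)$, for all $y\in Y$ and all $R\ge 1$, \[ |\xi_{\mathcal{P}_{\mathrm{I}}}(y,R)-\xi_{\mathcal{P}_{\mathrm{I}}}|\le C\cdot\frac{(\log R)^{k+\epsilon}\,r^{(d-1)(k-d-1)}}{R^d}. \]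
   Context: Cut and project setting. Let $0<d<k$ be integers. A linear map $L:\mathbb{R}^d\to\mathbb{R}^{k-d}$ is identified with its matrix $(\alpha_{ij})\in\mathbb{R}^{d(k-d)}$, $L(x)_i=\sum_{j=1}^d\alpha_{ij}x_j$, and ''almost all $L$'' refers to Lebesgue measure on $\mathbb{R}^{d(k-d)}$. The physical space is $E=\{(x,L(x)) : x\in\mathbb{R}^d\}\subset\mathbb{R}^k$. Standing assumption: $E$ is totally irrational, i.e. $E+\mathbb{Z}^k$ is dense in $\mathbb{R}^k$. An admissible internal space is a linear subspace $F_\pi\subset\mathbb{R}^k$ complementary to $E$ such that the projection $\pi:\mathbb{R}^k\to E$ along $F_\pi$ is injective on $\mathbb{Z}^k$; $\pi^*$ denotes the projection onto $F_\pi$ along $E$. The reference space is $F_\rho=\{0\}^d\times\mathbb{R}^{k-d}$, and $\rho:\mathbb{R}^k\to E$ is the projection onto $E$ along $F_\rho$. The cubical window is $\mathcal{W}_\pi=\pi^*(\{0\}^d\times[0,1]^{k-d})$ and the slice is $\mathcal{S}=\mathcal{W}_\pi+E$. For $s\in\mathbb{R}^k$ the cubical cut and project set is $Y_s=\pi(\mathcal{S}\cap(\mathbb{Z}^k+s))$. The point $s$ (and $Y_s$) is regular if $\partial\mathcal{S}\cap(\mathbb{Z}^k+s)=\emptyset$. For $y\in Y=Y_s$, $\tilde y$ denotes the unique element of $\mathbb{Z}^k+s$ with $\pi(\tilde y)=y$. Patches of type I and II. For $\Omega\subseteq E$, $r>0$ and $y\in Y$, \[ P_{\mathrm I}(y,r\Omega)=\{y'\in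 Y : y'-y\in r\Omega\},\qquad P_{\mathrm{II}}(y,r\Omega)=\{y'\in Y : \tilde y'-\tilde y\in\rho^{-1}(r\Omega)\}. \] For each type $*\in\{\mathrm I,\mathrm{II}\}$, two patches $P_*(y_1,r\Omega)$ and $P_*(y_2,r\Omega)$ are equivalent if $P_*(y_1,r\Omega)-y_1=P_*(y_2,r\Omega)-y_2$, and $\mathcal{P}_*(y,r\Omega)$ denotes the equivalence class of $P_*(y,r\Omega)$. Frequencies. Let $C(R)=\mathbb{Z}^k\cap([-R,R]^d\times\mathbb{R}^{k-d})$. For an equivalence class $\mathcal P$ of patches of type $*$ (for given $r,\Omega$), $y\in Y$ and $R>0$, \[ \xi_{\mathcal P}(y,R)=\frac{\#\{y'\in Y : \mathcal{P}_*(y',r\Omega)=\mathcal{P},\ \tilde y'-\tilde y\in C(R)\}}{\#\{y'\in Y : \tilde y'-\tilde y\in C(R)\}}, \] and $\xi_{\mathcal P}=\lim_{R\to\infty}\xi_{\mathcal P}(y,R)$ (this limit exists and does not depend on $s$ or $y$).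
   Formalization: log R is read as max(1, ln R): with log = ln the bound at R = 1 would force ξ_P(y,1) = ξ_P, which fails e.g. for d = 1, k = 2 (rational versus irrational); for R ≥ 2 the bound with ln follows after changing C. *)

(* Defs.v *)
From HB Require Import structures.
From mathcomp Require Import all_boot all_order all_algebra.
From mathcomp Require Import finmap.
From mathcomp Require Import all_classical all_reals all_analysis.

Set Implicit Arguments.
Unset Strict Implicit.
Unset Printing Implicit Defensive.

Import Order.TTheory GRing.Theory Num.Theory.
Import numFieldNormedType.Exports.

Local Open Scope classical_set_scope.
Local Open Scope ring_scope.

(* A set of m x n real matrices is Lebesgue-null when, for every e > 0, it is
   covered by countably many closed boxes of total volume at most e, i.e. when
   its Lebesgue outer measure in R^(m n) is zero. *)
Definition lebesgue_null (R : realType) (m n : nat) (A : set 'M[R]_(m, n)) :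
    Prop :=
  forall e : R, 0 < e ->
  exists a b : nat -> 'M[R]_(m, n),
    [/\ forall l i j, a l i j <= b l i j,
        A `<=` \bigcup_l [set M | forall i j, a l i j <= M i j <= b l i j]
      & (\sum_(0 <= l <oo) (\prod_i \prod_j (b l i j - a l i j))%:E
          <= e%:E)%E].

Definition lebesgue_ae (R : realType) (m n : nat) (P : 'M[R]_(m, n) -> Prop) :
    Prop :=
  lebesgue_null [set M | ~ P M].

(* The convention log x = max(1, ln x). With log = ln the factor (log x)^c
   vanishes at x = 1, and an O((log x)^c / x^d) bound valid for all x >= 1
   would force an exact equality there. *)
Definition log1 (R : realType) (x : R) : R := Num.max 1 (ln x).

Variant patch_type := type_I | type_II.

Section CutAndProject.
Context {R : realType} {d m : nat}.

(* k = d + m, and R^k = R^d x R^m is the space of column vectors col_mx x z. *)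
Local Notation Rk := 'cV[R]_(d + m).

Definition Zk : set Rk := [set v | forall i, v i 0 \is a Num.int].

Definition physical_space (L : 'M[R]_(m, d)) : {vspace Rk} :=
  limg (linfun (fun x : 'cV[R]_d => col_mx x (L *m x))).

Definition reference_space : {vspace Rk} :=
  limg (linfun (fun z : 'cV[R]_m => col_mx (0 : 'cV[R]_d) z)).

Definition totally_irrational (E : {vspace Rk}) : Prop :=
  dense [set x + z | x in [set x : Rk | x \in E] & z in Zk].

(* daddv_pi U V is the projection onto U along V. *)
Definition admissible (E F : {vspace Rk}) : Prop :=
  [/\ (E :&: F)%VS = 0%VS, (E + F)%VS = fullv & set_inj Zk (daddv_pi E F)].

(* The sets Omega used to cut out patches. *)
Definition patch_region (E : {vspace Rk}) (Omega : set Rk) : Prop :=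
  [/\ Omega `<=` [set x : Rk | x \in E], bounded_set Omega,
      @convex_set R Rk Omega
    & within [set x : Rk | x \in E] (nbhs (0 : Rk)) Omega].

Definition boundary (A : set Rk) : set Rk := closure A `\` interior A.

Section Patches.
(* L gives the physical space and F is the internal space F_pi. *)
Variables (L : 'M[R]_(m, d)) (F : {vspace Rk}).

Local Notation E := (physical_space L).

Definition proj_pi : Rk -> Rk := daddv_pi E F.
Definition proj_star : Rk -> Rk := daddv_pi F E.
Definition rho : Rk -> Rk := daddv_pi E reference_space.

Definition window : set Rk :=
  [set proj_star (col_mx (0 : 'cV[R]_d) z)
     | z in [set z : 'cV[R]_m | forall i, 0 <= z i 0 <= 1]].

Definition slice : set Rk := [set w + x | w in window & x in [set x : Rk | x \in E]].

Definition lattice_translate (s : Rk) : set Rk := [set z + s | z in Zk].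

Definition cut_and_project (s : Rk) : set Rk :=
  [set proj_pi v | v in slice `&` lattice_translate s].

Definition regular (s : Rk) : Prop :=
  boundary slice `&` lattice_translate s = set0.

(* The point of Z^k + s that projects to y; it is unique when F is admissible,
   and the default value 0 is only taken when there is no such point. *)
Definition lift_pt (s y : Rk) : Rk :=
  xget 0 [set v | lattice_translate s v /\ proj_pi v = y].

Definition patch (t : patch_type) (s y : Rk) (rOmega : set Rk) : set Rk :=
  match t with
  | type_I => [set y' | cut_and_project s y' /\ rOmega (y' - y)]
  | type_II => [set y' | cut_and_project s y' /\
                         rOmega (rho (lift_pt s y' - lift_pt s y))]
  end.

(* Two patches are equivalent iff their translates to the origin coincide, so a
   class is represented by that common translate. This also makes sense of one
   class occurring in cut and project sets with different parameters s. *)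
Definition patch_class (t : patch_type) (s y : Rk) (rOmega : set Rk) : set Rk :=
  [set y' - y | y' in patch t s y rOmega].

Definition lattice_box (rad : R) : set Rk :=
  Zk `&` [set v | forall i : 'I_d, - rad <= v (lshift m i) 0 <= rad].

(* The quantity xi_P(y, rad); both counted sets are finite whenever F is
   admissible. *)
Definition patch_freq (t : patch_type) (s : Rk) (rOmega P : set Rk) (y : Rk)
    (rad : R) : R :=
  #|` fset_set [set y' | [/\ cut_and_project s y',
                             patch_class t s y' rOmega = P
                           & lattice_box rad (lift_pt s y' - lift_pt s y)]]|%:R
  / #|` fset_set [set y' | cut_and_project s y' /\
                           lattice_box rad (lift_pt s y' - lift_pt s y)]|%:R.

(* xi is the limit frequency of the class P: the limit of xi_P(y, rad), the same
   for all regular s and all y in Y_s. *)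
Definition is_frequency (t : patch_type) (rOmega P : set Rk) (xi : R) : Prop :=
  forall s y, regular s -> cut_and_project s y ->
    patch_freq t s rOmega P y rad @[rad --> +oo] --> xi.

(* xi_P exists and |xi_P(y, rad) - xi_P| <= bound rad for y in Y_s, rad >= 1. *)
Definition frequency_rate (t : patch_type) (s : Rk) (rOmega P : set Rk)
    (bound : R -> R) : Prop :=
  exists2 xi : R, is_frequency t rOmega P xi &
    forall y rad, cut_and_project s y -> 1 <= rad ->
      `|patch_freq t s rOmega P y rad - xi| <= bound rad.

End Patches.

Definition dilate (r : R) (Omega : set Rk) : set Rk := [set r *: w | w in Omega].

End CutAndProject.

(* Main.v *)
Require Import Defs.
From HB Require Import structures.
From mathcomp Require Import all_boot all_order all_algebra.
From mathcomp Require Import complex finmap.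
From mathcomp Require Import all_classical all_reals all_analysis.
From mathcomp Require Import ring lra zify.

(* Modulo the physical space E, the lifts of the points of Y form an orbit
   w_p = frac (w_0 - L p), p in Z^d, in the cube [0,1)^m with m = k - d, and the
   class of a patch is decided by the region of the cube in which w_p lies.  For
   type II this acceptance region is a box.  For type I it is a union of boxes:
   one box when m = 1 (the region is an interval), boundedly many when d = 1
   (by convexity only boundedly many p are close to the boundary of r Omega), and
   otherwise polylogarithmically many in r, because a gap between the values
   frac (L p) with p well inside r Omega contains few values of p near its
   boundary; a power r ^ ((d - 1)(m - 1)) with positive exponent absorbs them.

   It remains to bound the discrepancy of the orbit in boxes by (log N)^(k + eps)
   for almost all L.  Fejer majorants reduce this to the sums
   F_N(L) = sum_h (1 / r(h)) prod_j min (N, 1 / dist ((h L)_j, Z)) over nonzero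
   frequencies h, up to a power of N.  Averaging over the grid of matrices with
   entries in (1/p) Z, p a large prime, where h L is equidistributed, shows that
   F_N has mean O((log N)^k).  Since F_N is monotone in N, the Borel-Cantelli
   argument is only needed along N = 2 ^ 2 ^ u, where it costs a factor
   (log N)^eps. *)

Set Implicit Arguments.
Unset Strict Implicit.
Unset Printing Implicit Defensive.

Import Order.TTheory GRing.Theory Num.Theory.
Import numFieldNormedType.Exports.

Local Open Scope classical_set_scope.
Local Open Scope ring_scope.

(** * Trigonometric sums *)

(** Null sets are defined by box coverings, so every average stays finite: a unit cube of matrices
    splits into p ^ (m d) cells, a widened summand at a grid point dominates the original one on its
    whole cell, and Markov's inequality on the grid yields at once a covering of the bad matrices by
    cells. The exponent k arises as m + d: harmonic weights over frequencies below a power of N cost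
    one logarithm for each of the m coordinates, dyadic layers one for each of the d columns. The
    discrepancy bound holds for all shifts w_0 simultaneously, so the constant depends on neither s
    nor y; Omega enters only through the threshold on r, and F enters the constant only when d = 1,
    through the bounded number of boxes. *)

Lemma sin_le_id (R : realType) (t : R) : 0 <= t -> sin t <= t.
Proof.
rewrite le_eqVlt => /predU1P[<-|t0]; first by rewrite sin0.
have [|c _] := @MVT R (@sin R) (@cos R) 0 t t0.
  by apply: continuous_subspaceT => w; exact: continuous_sin.
by rewrite sin0 !subr0 => ->; have := cos_le1 c; nra.
Qed.

Lemma sin_ge_half (R : realType) (z : R) : 0 <= z <= 1 -> z / 2 <= sin z.
Proof.
move=> /andP[]; rewrite le_eqVlt => /predU1P[<-|z0 z1].
  by rewrite sin0 mul0r.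
have [|c] := @MVT R (@sin R) (@cos R) 0 z z0.
  by apply: continuous_subspaceT => w; exact: continuous_sin.
rewrite in_itv /= => /andP[c0 cz]; rewrite sin0 !subr0 => ->.
rewrite mulrC ler_wpM2r ?(ltW z0) //.
have s1 : sin (c / 2) <= c / 2 by apply: sin_le_id; lra.
have s0 : 0 <= sin (c / 2).
  by apply: sin_ge0_pi; have := @pi_ge2 R; lra.
have := cos_mulr2n (c / 2); have := sin2cos2 (c / 2).
have -> : (c / 2) *+ 2 = c by rewrite -mulr_natr; field.
by move=> h1 h2; nra.
Qed.

(** Weaker than the sharp bound [2 * x], but free of concavity: up to [pi * x = 1] the half-slope
    bound and [pi >= 2] suffice; beyond, [sin] has already passed 1/2 and is still increasing. *)
Lemma sinpi_ge (R : realType) (x : R) : 0 <= x <= 1 / 2 -> x <= sin (pi * x).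
Proof.
move=> /andP[x0 x12]; have pi2 := @pi_ge2 R.
have [y1|y1] := leP (pi * x) 1.
  have := @sin_ge_half R (pi * x); rewrite y1 mulr_ge0 ?pi_ge0 //.
  by move=> /(_ isT); nra.
have s1 : 1 / 2 <= sin 1 :> R by apply: sin_ge_half; rewrite ler01 lexx.
have : sin 1 < sin (pi * x).
  by rewrite ltr_sin // in_itv /=; apply/andP; split; nra.
lra.
Qed.

Section Expi.
Context {R : realType}.
Implicit Types (x y : R) (n : nat).

Definition expi (x : R) : R[i] := Complex (cos (pi *+ 2 * x)) (sin (pi *+ 2 * x)).

Lemma expi0 : expi 0 = 1.
Proof. by rewrite /expi mulr0 cos0 sin0. Qed.

Lemma expiD x y : expi (x + y) = expi x * expi y.
Proof.
rewrite /expi mulrDr cosD sinD; apply/eqP; rewrite eq_complex /=.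
by rewrite eqxx /= addrC.
Qed.

Lemma expi_norm x : `|expi x| = 1.
Proof. by rewrite normc_def /= cos2Dsin2 sqrtr1. Qed.

Lemma expi_neq0 x : expi x != 0.
Proof. by rewrite -normr_eq0 expi_norm oner_eq0. Qed.

Lemma expiN x : expi (- x) = (expi x)^-1.
Proof.
apply: (mulfI (expi_neq0 x)).
by rewrite -expiD subrr expi0 mulfV ?expi_neq0.
Qed.

Lemma expi_conj x : ((expi x)^*)%C = expi (- x).
Proof. by rewrite /expi mulrN cosN sinN. Qed.

Lemma expiMn x n : expi (n%:R * x) = expi x ^+ n.
Proof.
elim: n => [|n ih]; first by rewrite mul0r expi0 expr0.
by rewrite exprS -ih -expiD -{2}[x]mul1r -mulrDl -natr1 addrC.
Qed.

Lemma expi1 : expi 1 = 1.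
Proof. by rewrite /expi mulr1 cos2pi sin2pi. Qed.

Lemma expi_int (z : int) : expi z%:~R = 1.
Proof.
have nat_case n : expi n%:R = 1 by rewrite -[n%:R]mulr1 expiMn expi1 expr1n.
by case: z => n; rewrite ?NegzE ?mulrNz ?expiN nat_case ?invr1.
Qed.

Lemma expi_periodic x (z : int) : expi (x + z%:~R) = expi x.
Proof. by rewrite expiD expi_int mulr1. Qed.

Lemma expi_sum (I : Type) (r : seq I) (P : pred I) (F : I -> R) :
  expi (\sum_(i <- r | P i) F i) = \prod_(i <- r | P i) expi (F i).
Proof. by apply: (big_morph expi expiD expi0). Qed.

(** The left factor equals [2 * |sin (pi * x)|], and [x] may be reduced to its nearest integer. Here
    and below, [t] stands for any lower bound on the distance of [x] to the integers. *)
Lemma expi_sub1 x (t : R) : (forall z : int, t <= `|x - z%:~R|) ->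
  (2 * t)%:C%C <= `|expi x - 1|.
Proof.
move=> far.
pose z := Num.floor (x + 1 / 2); pose y := x - z%:~R.
have /andP[y1 y2] : - (1 / 2) <= y <= 1 / 2.
  by have := floor_itv (x + 1 / 2); rewrite -/z /y intrD; lra.
have -> : expi x = expi y by rewrite -(expi_periodic y z) /y subrK.
have ty : t <= `|y| by exact: far.
have sy : `|y| <= `|sin (pi * y)|.
  have [y0|y0] := leP 0 y.
    by rewrite ger0_norm //; apply: le_trans (ler_norm _); apply: sinpi_ge; lra.
  rewrite ltr0_norm // -normrN -sinN -mulrN; apply: le_trans (ler_norm _).
  by apply: sinpi_ge; lra.
rewrite normc_def lecR /=.
have -> : pi *+ 2 * y = (pi * y) *+ 2 by rewrite mulrnAl.
rewrite oppr0 addr0.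
have -> : (cos (pi * y *+ 2) - 1) ^+ 2 + sin (pi * y *+ 2) ^+ 2 =
  (2 * sin (pi * y)) ^+ 2.
  rewrite cos_mulr2n sin_mulr2n; have := cos2Dsin2 (pi * y).
  set c := cos _; set s := sin _ => h.
  have -> : c ^+ 2 = 1 - s ^+ 2 by rewrite -h; ring.
  have -> : ((c * s) *+ 2) ^+ 2 = 4 * s ^+ 2 * c ^+ 2 by ring.
  have -> : c ^+ 2 = 1 - s ^+ 2 by rewrite -h; ring.
  ring.
by rewrite sqrtr_sqr normrM ger0_norm //; lra.
Qed.

Lemma expi_geo x n (t : R) : 0 < t -> (forall z : int, t <= `|x - z%:~R|) ->
  `|\sum_(i < n) expi (i%:R * x)| <= (t^-1)%:C%C.
Proof.
move=> t0 far; have e1 := expi_sub1 far.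
have e0 : 0 < (2 * t)%:C%C by rewrite ltcR mulr_gt0.
rewrite -(ler_pM2l e0); apply: le_trans (ler_wpM2r (normr_ge0 _) e1) _.
rewrite -normrM; under eq_bigr do rewrite expiMn.
rewrite -subrX1 -expiMn; apply: le_trans (ler_normB _ _) _.
rewrite expi_norm normr1 -rmorphM /= -mulrA mulfV ?gt_eqF // mulr1.
by rewrite lecE /= addr0 eqxx /= -mulr2n lexx.
Qed.

End Expi.

(** * The Fejer kernel and majorants of intervals *)

Lemma ler_sum_inj (R : numDomainType) (I J : finType) (P : pred I) (g : I -> J)
    (F : J -> R) : {in P &, injective g} -> (forall j, 0 <= F j) ->
  \sum_(i | P i) F (g i) <= \sum_j F j.
Proof.
move=> gI F0; rewrite -(big_imset _ gI) [leRHS](bigID [in g @: P]) /= lerDl.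
by apply: sumr_ge0.
Qed.

Section Fejer.
Context {R : realType}.
Implicit Types (x y a b : R) (H : nat).

(** The square of the exponential sum is never collected by frequency: terms stay indexed by pairs,
    so frequency [h] occurs [H - |h|] times and the triangular Fejer weights remain implicit. *)
Definition freq H (ab : 'I_H * 'I_H) : int := (ab.1 : nat)%:Z - (ab.2 : nat)%:Z.

Lemma freq_eq0 H (ab : 'I_H * 'I_H) : (freq ab == 0) = (ab.1 == ab.2).
Proof. by rewrite /freq subr_eq0. Qed.

Lemma freq_lt H (ab : 'I_H * 'I_H) : `|freq ab| < H%:Z.
Proof. rewrite /freq; have := ltn_ord ab.1; have := ltn_ord ab.2; lia. Qed.

Definition expsum H x : R[i] := \sum_(a < H) expi (a%:R * x).

Definition fejer H x : R :=
  (complex.Re (expsum H x) ^+ 2 + complex.Im (expsum H x) ^+ 2) / H%:R.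

Lemma fejer_ge0 H x : 0 <= fejer H x.
Proof. by rewrite divr_ge0 ?addr_ge0 ?sqr_ge0. Qed.

Lemma fejer_norm H x : (fejer H x)%:C%C = `|expsum H x| ^+ 2 * (H%:R^-1)%:C%C.
Proof. by rewrite /fejer rmorphM /= add_Re2_Im2. Qed.

Lemma fejer_le H x (t : R) : 0 < t -> (forall z : int, t <= `|x - z%:~R|) ->
  fejer H x <= (t ^+ 2 * H%:R)^-1.
Proof.
move=> t0 /(expi_geo H t0); rewrite -/(expsum H x) => le_t.
rewrite -lecR fejer_norm invfM rmorphM /= ler_wpM2r ?ler0c ?invr_ge0 //.
rewrite -exprVn rmorphXn /=; apply: lerXn2r le_t; rewrite nnegrE ?normr_ge0 //.
by rewrite ler0c invr_ge0 ltW.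
Qed.

Lemma fejerE H x : (fejer H x)%:C%C =
  (H%:R^-1)%:C%C * \sum_(ab : 'I_H * 'I_H) expi ((freq ab)%:~R * x).
Proof.
rewrite fejer_norm mulrC; congr (_ * _).
have conjE : ((expsum H x)^*)%C = \sum_(b < H) expi (- (b%:R * x)).
  by rewrite /expsum rmorph_sum; apply: eq_bigr => b _; exact: expi_conj.
rewrite normcE sqr_sqrtc conjE mulr_suml.
rewrite -(pair_bigA _ (fun a b : 'I_H => expi ((freq (a, b))%:~R * x))) /=.
apply: eq_bigr => a _; rewrite mulr_sumr; apply: eq_bigr => b _.
by rewrite -expiD /freq intrD mulrNz mulrDl mulNr.
Qed.

Lemma dist_frac (h : int) (Q : nat) : (2 * `|h| <= Q)%N -> (0 < Q)%N ->
  forall z : int, `|h|%:~R / Q%:R <= `|h%:~R / Q%:R - z%:~R| :> R.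
Proof.
move=> hQ Q0 z; have QR : 0 < Q%:R :> R by rewrite ltr0n.
rewrite ler_pdivrMr //.
have -> : `|h%:~R / Q%:R - z%:~R| * Q%:R = `|(h - z * Q%:Z)|%:~R :> R.
  rewrite -{2}[Q%:R](ger0_norm (ltW QR)) -normrM mulrBl mulfVK ?gt_eqF //.
  by rewrite intr_norm intrD mulrNz intrM.
by rewrite ler_int; have [->|z0] := eqVneq z 0; [rewrite mul0r subr0 | nia].
Qed.

(** Orthogonality of roots of unity; [2 * |h| <= Q] puts [h / Q] within 1/2 of 0, so for nonzero [h]
    the ratio of the geometric sum is not 1. *)
Lemma expi_root_sum (h : int) (Q : nat) : (2 * `|h| <= Q)%N -> (0 < Q)%N ->
  \sum_(i < Q) expi (i%:R * (h%:~R / Q%:R : R)) = if h == 0 then Q%:R else 0.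
Proof.
move=> hQ Q0; have [->|h0] := eqVneq h 0.
  by under eq_bigr do rewrite mul0r mulr0 expi0; rewrite sumr_const card_ord.
have QR : 0 < Q%:R :> R by rewrite ltr0n.
set x := h%:~R / Q%:R; have x1 : expi x - 1 != 0.
  rewrite -normr_gt0; apply: lt_le_trans (expi_sub1 (dist_frac hQ Q0)).
  by rewrite ltcR mulr_gt0 // divr_gt0 // ltr0z normr_gt0.
apply: (mulfI x1); under eq_bigr do rewrite expiMn.
by rewrite -subrX1 -expiMn /x mulrC mulfVK ?gt_eqF // expi_int subrr mulr0.
Qed.

(** Sampling at [Q] equally spaced points computes the mean of a trigonometric polynomial of degree
    below [Q] exactly. This replaces the integral of the kernel, which is 1. *)
Lemma fejer_shift H Q x (j0 : int) : (0 < H)%N -> (2 * H <= Q)%N ->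
  \sum_(i < Q) fejer H (x - (j0%:~R + i%:R) / Q%:R) = Q%:R.
Proof.
move=> H0 HQ; have Q0 : (0 < Q)%N by lia.
apply: (@complexI R); rewrite rmorph_sum /=.
under eq_bigr do rewrite fejerE.
rewrite -mulr_sumr exchange_big /=.
have inner (ab : 'I_H * 'I_H) :
    \sum_(i < Q) expi ((freq ab)%:~R * (x - (j0%:~R + i%:R) / Q%:R)) =
    if ab.1 == ab.2 then Q%:R else 0 :> R[i].
  pose h := - freq ab; have hQ : (2 * `|h| <= Q)%N by have := freq_lt ab; lia.
  transitivity (expi ((freq ab)%:~R * (x - j0%:~R / Q%:R)) *
      \sum_(i < Q) expi (i%:R * (h%:~R / Q%:R))).
    rewrite mulr_sumr; apply: eq_bigr => i _; rewrite -expiD; congr expi.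
    by rewrite /h mulrNz; field; rewrite pnatr_eq0 -lt0n.
  rewrite expi_root_sum // /h oppr_eq0 freq_eq0; case: ifPn => [/eqP e|_].
    by rewrite /freq e subrr mul0r expi0 mul1r.
  by rewrite mulr0.
under eq_bigr do rewrite inner.
rewrite -(pair_bigA _ (fun a b : 'I_H => if a == b then Q%:R else 0 : R[i])) /=.
have row_sum (a : 'I_H) : \sum_(b < H) (if a == b then Q%:R else 0 : R[i]) = Q%:R.
  rewrite (bigD1 a) //= eqxx big1 ?addr0 // => b /negPf.
  by rewrite eq_sym => ->.
under eq_bigr do rewrite row_sum.
rewrite sumr_const card_ord -[Q%:R in LHS]mulr1 -mulrnAr.
rewrite mulrCA fmorphV rmorph_nat mulVf ?pnatr_eq0 -?lt0n //.
by rewrite mulr1 rmorph_nat.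
Qed.

End Fejer.

Section Majorant.
Context {R : realType}.

Lemma ceil_bounds (x : R) : (Num.ceil x)%:~R - 1 < x <= (Num.ceil x)%:~R.
Proof. by have := ceil_itv x; rewrite intrD mulrNz. Qed.

Lemma floor_bounds (x : R) : (Num.floor x)%:~R <= x < (Num.floor x)%:~R + 1.
Proof. by have := floor_itv x; rewrite intrD. Qed.

Lemma inord_shift (j0 j1 k : int) (n : nat) : n%:Z = j1 - j0 ->
  j0 <= k <= j1 -> j0 + ((inord `|k - j0| : 'I_n.+1) : nat)%:Z = k.
Proof. by move=> nE k01; rewrite inordK; lia. Qed.

Lemma freq_half H (p : 'I_H * 'I_H) : (2 * `|- freq p| <= 2 * H)%N.
Proof. by have := freq_lt p; lia. Qed.

(* The majorant is [1 / G] plus the average of Fejer kernels centred at the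
   points of the grid [Z / Q] within [1 / G] of the interval; outside distance
   [1 / G] the kernel of order [H = G ^ 3] is at most [1 / G]. *)
Lemma interval_majorant (a b : R) (G H : nat) :
  (0 < G)%N -> H = (G ^ 3)%N -> a <= b ->
  exists (c : 'I_H * 'I_H -> R[i]) (mu : R),
  [/\ 0 <= mu <= b - a + 4 / G%:R,
      forall x, exists2 T : R,
        \sum_ab c ab * expi ((freq ab)%:~R * x) = T%:C%C &
        0 <= T /\ (a <= x <= b -> 1 <= T),
      forall ab, freq ab = 0 -> c ab = (mu / H%:R)%:C%C
    & forall ab, freq ab != 0 -> `|c ab| <= ((H%:R * `|freq ab|%:~R)^-1)%:C%C].
Proof.
(* Twice the order: all frequencies then satisfy the hypothesis of [expi_root_sum]. *)
move=> G0 HE ab; pose Q := (2 * H)%N.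
have H0 : (0 < H)%N by rewrite HE expn_gt0 G0.
have Q0 : (0 < Q)%N by rewrite muln_gt0.
have GR : 0 < G%:R :> R by rewrite ltr0n.
have HR : 0 < H%:R :> R by rewrite ltr0n.
have QR : 0 < Q%:R :> R by rewrite ltr0n.
have HQ : (2 * H <= Q)%N by [].
have G1 : 1 <= G%:R :> R by rewrite ler1n.
have HG : H%:R = G%:R ^+ 3 :> R by rewrite HE natrX.
have QH : Q%:R = 2 * H%:R :> R by rewrite natrM.
pose dl : R := G%:R^-1.
have dl0 : 0 < dl by rewrite invr_gt0.
have Gdl : G%:R * dl = 1 by rewrite mulfV ?gt_eqF.
have Qdl : 2 <= Q%:R * dl.
  have -> : Q%:R * dl = 2 * G%:R ^+ 2.
    transitivity (2 * G%:R ^+ 2 * (G%:R * dl)); last by rewrite Gdl mulr1.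
    by rewrite QH HG; ring.
  by nra.
pose j0 := Num.ceil (Q%:R * (a - dl)).
pose j1 := Num.floor (Q%:R * (b + dl)).
have j0P : j0%:~R - 1 < Q%:R * (a - dl) <= j0%:~R := ceil_bounds _.
have j1P : j1%:~R <= Q%:R * (b + dl) < j1%:~R + 1 := floor_bounds _.
have j01 : j0 <= j1.
  rewrite -ltzD1 -(ltr_int R).
  by have := j0P; have := j1P; rewrite intrD; nra.
pose n := `|j1 - j0|%N.
have nE : n%:Z = j1 - j0 by rewrite /n gez0_abs ?subr_ge0.
have nR : n%:R = j1%:~R - j0%:~R :> R by rewrite -mulrNz -intrD -nE.
pose pt (j : int) : R := j%:~R / Q%:R.
pose K (x : R) := fejer H x.
(* The constant [dl] compensates for the kernel mass at grid points farther than [dl] from [x]. The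
   mean [mu] is shared by the [H] pairs of frequency zero. *)
pose mu : R := dl + n.+1%:R / Q%:R.
pose c (p : 'I_H * 'I_H) : R[i] := (if freq p == 0 then (dl / H%:R)%:C%C else 0) +
  ((Q%:R * H%:R)^-1)%:C%C *
    \sum_(i < n.+1) expi (- (freq p)%:~R * pt (j0 + Posz i)).
have K0 x : 0 <= K x by exact: fejer_ge0.
exists c, mu; split.
- rewrite addr_ge0 ?divr_ge0 ?(ltW dl0) //=.
  suff : n.+1%:R / Q%:R <= b - a + 3 * dl by rewrite /mu -/dl; lra.
  rewrite ler_pdivrMr // -natr1 nR; have := j0P; have := j1P; nra.
- move=> x; exists (dl + Q%:R^-1 * \sum_(i < n.+1) K (x - pt (j0 + Posz i))).
    rewrite rmorphD /= rmorphM /= rmorph_sum /=.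
    under [in RHS]eq_bigr do rewrite fejerE.
    rewrite -mulr_sumr mulrA -rmorphM /= -invfM.
    rewrite exchange_big /= mulr_sumr.
    under eq_bigr do rewrite /c mulrDl.
    rewrite big_split /=; congr (_ + _).
      rewrite -(pair_bigA _ (fun a b : 'I_H =>
        (if freq (a, b) == 0 then (dl / H%:R)%:C%C else 0) *
          expi ((freq (a, b))%:~R * x))) /=.
      have row (u : 'I_H) : \sum_(v < H) (if freq (u, v) == 0
           then (dl / H%:R)%:C%C else 0) * expi ((freq (u, v))%:~R * x) =
         (dl / H%:R)%:C%C.
        rewrite (bigD1 u) //= freq_eq0 eqxx /freq subrr mul0r expi0 mulr1.
        rewrite big1 ?addr0 // => v; rewrite eq_sym subr_eq0 => /negPf uv.
        by rewrite [_ == _](_ : _ = false) ?mul0r //; move: uv; rewrite -val_eqE.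
      under eq_bigr do rewrite row.
      rewrite sumr_const card_ord -rmorphMn /= -mulr_natr.
      by rewrite mulfVK ?gt_eqF.
    apply: eq_bigr => p _; rewrite -mulrA; congr (_ * _).
    rewrite mulr_suml; apply: eq_bigr => i _; rewrite -expiD; congr expi.
    ring.
  split; first by rewrite addr_ge0 ?(ltW dl0) ?mulr_ge0 ?invr_ge0 ?sumr_ge0.
  move=> /andP[ax xb].
  (* Enumerate one full period of the grid centred at [x], so that the distance of [y i] to the
     integers is just [|y i|]. *)
  pose k0 := Num.ceil (Q%:R * (x - 1 / 2)).
  have k0P : k0%:~R - 1 < Q%:R * (x - 1 / 2) <= k0%:~R := ceil_bounds _.
  pose y (i : 'I_Q) : R := x - (k0%:~R + i%:R) / Q%:R.
  have yE i : Q%:R * y i = Q%:R * x - k0%:~R - i%:R.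
    by rewrite /y; field; rewrite gt_eqF.
  have y12 i : `|y i| <= 1 / 2.
    rewrite ler_norml -(ler_pM2l QR) -(ler_pM2l QR (y i)) yE.
    have iQ : (i : nat)%:R + 1 <= Q%:R :> R by rewrite natr1 ler_nat ltn_ord.
    have i0 : 0 <= (i : nat)%:R :> R by [].
    move: k0P => /andP[h1 h2]; apply/andP; split; nra.
  have full : \sum_i K (y i) = Q%:R by apply: fejer_shift.
  have far : \sum_(i | ~~ (`|y i| <= dl)) K (y i) <= Q%:R * dl.
    apply: le_trans (_ : \sum_(i : 'I_Q | ~~ (`|y i| <= dl)) dl <= _).
      apply: ler_sum => i; rewrite -ltNge => dy.
      have -> : dl = (dl ^+ 2 * H%:R)^-1.
        rewrite HG; have -> : dl ^+ 2 * G%:R ^+ 3 = (G%:R * dl) ^+ 2 * G%:R by ring.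
        by rewrite Gdl expr1n mul1r.
      apply: fejer_le => // z; have [->|z0] := eqVneq z 0.
        by rewrite mulr0z subr0 ltW.
      have z1 : 1 <= `|z%:~R| :> R by rewrite -intr_norm ler1z -gtz0_ge1 normr_gt0.
      have := ler_normB (y i) (y i - z%:~R); rewrite subKr.
      have := y12 i; have : dl < 1 / 2 by apply: lt_le_trans (y12 i).
      lra.
    rewrite sumr_const -[leLHS]mulr_natl; apply: ler_wpM2r; first exact: ltW.
    by rewrite ler_nat -[leqRHS]card_ord max_card.
  (* A grid point within [dl] of [x] lies in [[a - dl, b + dl]], hence is one of the centres used by
     the majorant. *)
  have near : \sum_(i | `|y i| <= dl) K (y i) <=
      \sum_(i < n.+1) K (x - pt (j0 + Posz i)).
    have inJ (i : 'I_Q) : `|y i| <= dl -> j0 <= k0 + Posz i <= j1.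
      rewrite ler_norml -(ler_pM2l QR) -(ler_pM2l QR (y i)) yE => /andP[l1 l2].
      rewrite -[_ <= j1]ltzD1 -ltzD1 -!(ltr_int R) !intrD.
      move: j0P j1P k0P => /andP[u1 u2] /andP[v1 v2] _.
      apply/andP; split; nra.
    pose g (i : 'I_Q) : 'I_n.+1 := inord (absz (k0 + Posz i - j0)%R).
    have gE (i : 'I_Q) : `|y i| <= dl ->
        j0 + Posz (g i) = k0 + Posz i.
      by move=> /inJ; exact: inord_shift.
    have -> : \sum_(i | `|y i| <= dl) K (y i) =
       \sum_(i | `|y i| <= dl) K (x - pt (j0 + Posz (g i))).
      by apply: eq_bigr => i hi; rewrite gE // /pt intrD.
    apply: (ler_sum_inj (F := fun i : 'I_n.+1 => K (x - pt (j0 + Posz i)))).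
      move=> i i' hi hi' gg; apply/val_inj.
      by have := gE _ hi; have := gE _ hi'; rewrite gg => -> /addrI [].
    by [].
  rewrite -(ler_pM2l QR) mulr1 mulrDr mulrA mulfV ?gt_eqF // mul1r.
  rewrite -[leLHS]full (bigID (fun i => `|y i| <= dl)) /= addrC.
  exact: lerD.
- move=> p p0; rewrite /c p0 eqxx; under eq_bigr do rewrite oppr0 mul0r expi0.
  rewrite sumr_const card_ord -(rmorph_nat (real_complex R)) -rmorphM -rmorphD /=.
  congr (_%:C%C); rewrite /mu; field; rewrite !gt_eqF //.
- move=> p /negPf p0; rewrite /c p0 add0r normrM.
  have -> : `|((Q%:R * H%:R)^-1)%:C%C| = ((Q%:R * H%:R)^-1)%:C%C :> R[i].
    by rewrite ger0_norm // ler0c invr_ge0 mulr_ge0 ?ltW.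
  pose t : R := `|- freq p|%:~R / Q%:R.
  have t0 : 0 < t by rewrite divr_gt0 // ltr0z normr_gt0 oppr_eq0 p0.
  have -> : \sum_(i < n.+1) expi (- (freq p)%:~R * pt (j0 + Posz i)) =
     expi (- (freq p)%:~R * pt j0) *
     \sum_(i < n.+1) expi (i%:R * ((- freq p)%:~R / Q%:R)) :> R[i].
    rewrite mulr_sumr; apply: eq_bigr => i _; rewrite -expiD; congr expi.
    by rewrite /pt intrD mulrNz; field; rewrite gt_eqF.
  rewrite normrM expi_norm mul1r.
  have hQ : (2 * `|- freq p| <= Q)%N by exact: freq_half.
  have ge0 : 0 <= ((Q%:R * H%:R)^-1)%:C%C :> R[i].
    by rewrite ler0c invr_ge0 mulr_ge0 ?ltW.
  apply: le_trans (ler_wpM2l ge0 (expi_geo n.+1 t0 (dist_frac hQ Q0))) _.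
  rewrite -rmorphM /= lecR /t normrN.
  have hn : `|freq p|%:~R != 0 :> R by rewrite intr_eq0 normr_eq0 p0.
  rewrite le_eqVlt; apply/orP; left; apply/eqP; field.
  by rewrite hn !gt_eqF.
Qed.

End Majorant.

(** * Counting orbit points in boxes *)

Section Counting.
Context {R : realType}.

Lemma normc_real (x : R) : `|x%:C%C| = (`|x|)%:C%C.
Proof. by rewrite normc_def /= expr0n addr0 sqrtr_sqr. Qed.

Definition near_int (t x : R) : bool := `[< exists z : int, `|x - z%:~R| <= t >].

(* A dyadic upper bound for [min (3 * 2 ^ T) (1 / dist x Z)]. *)
Definition layer (T : nat) (x : R) : R :=
  \sum_(t < T.+1) 2 ^+ t.+2 * (near_int ((2 ^+ t)^-1) x)%:R.

Lemma layer_ge0 T x : 0 <= layer T x.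
Proof. by apply: sumr_ge0 => t _; rewrite mulr_ge0 ?exprn_ge0. Qed.

Lemma layer_term T x (t : 'I_T.+1) : near_int ((2 ^+ t)^-1) x ->
  2 ^+ t.+2 <= layer T x.
Proof.
move=> h; rewrite /layer (bigD1 t) //= h mulr1 lerDl.
by apply: sumr_ge0 => i _; rewrite mulr_ge0 ?exprn_ge0.
Qed.

Definition centred (N : nat) (i : 'I_N.*2.+1) : int := Posz i - Posz N.

(** If [x] is near an integer at radius [2 ^- t] but not at [2 ^- t.+1], the geometric sum is at
    most [2 ^ t.+1]. If it is near at the finest radius, the trivial bound [3 * 2 ^ T <= 2 ^ T.+2]
    applies. *)
Lemma kernel_le (N T : nat) (x : R) : (N.*2.+1 <= 3 * 2 ^ T)%N ->
  `|\sum_(i < N.*2.+1) expi (- x * (centred i)%:~R)| <= (layer T x)%:C%C.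
Proof.
move=> NT.
have near1 : near_int ((2 ^+ 0)^-1) x.
  apply/asboolP; exists (Num.floor x); rewrite expr0 invr1.
  by have := floor_bounds x; rewrite ler_norml; lra.
have [|] := boolP (near_int ((2 ^+ T)^-1) x) => [nT|farT].
  apply: le_trans (ler_norm_sum _ _ _) _.
  under eq_bigr do rewrite expi_norm.
  rewrite sumr_const card_ord -(rmorph_nat (real_complex R)) lecR.
  apply: le_trans (_ : 2 ^+ T.+2 <= _); last exact: (layer_term (t := ord_max)).
  rewrite -natrX ler_nat; apply: leq_trans NT _.
  by rewrite !expnS mulnA leq_mul2r orbT.
have ex_far : exists t, ~~ near_int ((2 ^+ t)^-1) x by exists T.
case: (ex_minnP ex_far) => -[|t]; first by rewrite near1.
move=> far_t min_t; have tT : (t < T.+1)%N by have := min_t _ farT; lia.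
have near_t : near_int ((2 ^+ t)^-1) x.
  by apply: contraT => /min_t; rewrite ltnn.
have far z : (2 ^+ t.+1)^-1 <= `|- x - z%:~R|.
  move/asboolPn: far_t => /forallNP/(_ (- z)) /negP; rewrite -ltNge => /ltW.
  by rewrite mulrNz opprK -normrN opprD.
have -> : \sum_(i < N.*2.+1) expi (- x * (centred i)%:~R) =
    expi (x * N%:R) * \sum_(i < N.*2.+1) expi (i%:R * - x).
  rewrite mulr_sumr; apply: eq_bigr => i _; rewrite -expiD; congr expi.
  by rewrite /centred intrD mulrNz; ring.
rewrite normrM expi_norm mul1r.
apply: le_trans (expi_geo _ _ far) _; first by rewrite invr_gt0 exprn_gt0.
rewrite lecR invrK; apply: le_trans (layer_term (t := Ordinal tT) near_t) => /=.
by rewrite ler_eXn2l // ltr1n.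
Qed.

Context {m d : nat}.

(** Up to a factor 5, the bound of [interval_majorant] on a Fourier coefficient; [maxn 1] treats
    frequency zero uniformly. *)
Definition wt (H : nat) (ab : 'I_H * 'I_H) : R :=
  (H%:R * (maxn 1 `|freq ab|)%:R)^-1.

Lemma wt_ge0 H (ab : 'I_H * 'I_H) : 0 <= wt ab.
Proof. by rewrite invr_ge0 mulr_ge0. Qed.

(* The error term of an Erdos-Turan-Koksma inequality. *)
Definition koksma (T H : nat) (L : 'M[R]_(m, d)) : R :=
  \sum_(f : {ffun 'I_m -> 'I_H * 'I_H} | [exists i, freq (f i) != 0])
    (\prod_i wt (f i)) *
    \prod_j layer T (\sum_i (freq (f i))%:~R * L i j).

Definition frac (x : R) : R := x - (Num.floor x)%:~R.

Definition orbit (L : 'M[R]_(m, d)) (sg : 'I_m -> R) N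
    (p : {ffun 'I_d -> 'I_N.*2.+1}) (i : 'I_m) : R :=
  sg i - \sum_j L i j * (centred (p j))%:~R.

Definition hits (L : 'M[R]_(m, d)) (sg : 'I_m -> R) N (A : 'I_m -> set R) : R :=
  \sum_(p : {ffun 'I_d -> 'I_N.*2.+1})
    [forall i, frac (orbit L sg p i) \in A i]%:R.

Lemma orbit_exp_sum (L : 'M[R]_(m, d)) (sg : 'I_m -> R) N (h : 'I_m -> int) :
  \sum_(p : {ffun 'I_d -> 'I_N.*2.+1}) \prod_i expi ((h i)%:~R * orbit L sg p i) =
  expi (\sum_i (h i)%:~R * sg i) *
  \prod_j \sum_(k < N.*2.+1) expi (- (\sum_i (h i)%:~R * L i j) * (centred k)%:~R).
Proof.
rewrite bigA_distr_bigA /= mulr_sumr; apply: eq_bigr => p _.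
rewrite -!expi_sum -expiD; congr expi; rewrite /orbit.
transitivity (\sum_i ((h i)%:~R * sg i -
    \sum_j (h i)%:~R * (L i j * (centred (p j))%:~R))).
  by apply: eq_bigr => i _; rewrite mulrBr mulr_sumr.
rewrite sumrB exchange_big /=; congr (_ + _); rewrite -sumrN.
apply: eq_bigr => j _; rewrite mulNr mulr_suml; congr (- _).
by apply: eq_bigr => i _; rewrite mulrA.
Qed.

(** The indicator of the box is at most the product of the one-dimensional majorants. In its
    expansion the all-zero frequencies give the main term; for the others the sum over [p] factors
    into [d] geometric sums. *)
Lemma hits_upper (L : 'M[R]_(m, d)) (sg : 'I_m -> R) (N T G : nat)
    (A : 'I_m -> set R) (a b : 'I_m -> R) :
  (0 < G)%N -> (N.*2.+1 <= 3 * 2 ^ T)%N ->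
  (forall i, [/\ 0 <= a i, a i <= b i & b i <= 1]) ->
  (forall i x, A i x -> a i <= x <= b i) ->
  hits L sg N A <=
    N.*2.+1%:R ^+ d * \prod_i (b i - a i + 4 / G%:R) + 5 ^+ m * koksma T (G ^ 3) L.
Proof.
move=> G0 NT ab AI; set H := (G ^ 3)%N.
have H0 : (0 < H)%N by rewrite expn_gt0 G0.
have HR : 0 < H%:R :> R by rewrite ltr0n.
have ab1 i : a i <= b i by have [] := ab i.
have [c /choice [mu major]] :=
  choice (fun i => interval_majorant G0 (erefl H) (ab1 i)).
have mu_bd i : 0 <= mu i <= b i - a i + 4 / G%:R by have [] := major i.
have c0 i p : freq p = 0 -> c i p = (mu i / H%:R)%:C%C by have [_ _ h _] := major i; exact: h.
have c1 i p : freq p != 0 -> `|c i p| <= ((H%:R * `|freq p|%:~R)^-1)%:C%C.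
  by have [_ _ _ h] := major i; exact: h.
have exS i : exists S : R -> R, forall x,
    \sum_ab c i ab * expi ((freq ab)%:~R * x) = (S x)%:C%C /\
    (0 <= S x /\ (a i <= x <= b i -> 1 <= S x)).
  have exs x : exists s : R, \sum_ab c i ab * expi ((freq ab)%:~R * x) = s%:C%C /\
      (0 <= s /\ (a i <= x <= b i -> 1 <= s)).
    by have [_ /(_ x) [s h1 h2] _ _] := major i; exists s.
  by have [s hs] := choice exs; exists s.
have [S major_S] := choice exS.
(* All frequencies are integers, so the majorants do not see the integer part removed by [frac]. *)
have S_per i x : S i (frac x) = S i x.
  apply: (@complexI R); rewrite -(major_S _ _).1 -(major_S _ _).1.
  apply: eq_bigr => p _; congr (_ * _).
  by rewrite /frac mulrBr -intrM -mulrNz expi_periodic.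
pose tot := \sum_(p : {ffun 'I_d -> 'I_N.*2.+1}) \prod_i S i (orbit L sg p i).
have hits_tot : hits L sg N A <= tot.
  apply: ler_sum => p _; case: forallP => [hit|_]; last first.
    by apply: prodr_ge0 => i _; have [_ []] := major_S i (orbit L sg p i).
  rewrite -[leLHS]/1; elim/big_ind : _ => [//|x y x1 y1|i _]; first by nra.
  rewrite -S_per; have [_ [_]] := major_S i (frac (orbit L sg p i)); apply.
  by apply: AI; have := hit i; rewrite in_setE.
pose coef (f : {ffun 'I_m -> 'I_H * 'I_H}) : R[i] := \prod_i c i (f i).
pose osc (f : {ffun 'I_m -> 'I_H * 'I_H}) : R[i] :=
  \sum_(p : {ffun 'I_d -> 'I_N.*2.+1})
    \prod_i expi ((freq (f i))%:~R * orbit L sg p i).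
have totE : tot%:C%C = \sum_f coef f * osc f.
  rewrite rmorph_sum /=; under eq_bigr do rewrite rmorph_prod /=.
  transitivity (\sum_(p : {ffun 'I_d -> 'I_N.*2.+1})
      \sum_(f : {ffun 'I_m -> 'I_H * 'I_H})
        \prod_i (c i (f i) * expi ((freq (f i))%:~R * orbit L sg p i))).
    apply: eq_bigr => p _.
    rewrite -(bigA_distr_bigA (fun i ab => c i ab * expi ((freq ab)%:~R * orbit L sg p i))).
    by apply: eq_bigr => i _; rewrite -(major_S _ _).1.
  rewrite exchange_big; apply: eq_bigr => f _; rewrite mulr_sumr.
  by apply: eq_bigr => p _; rewrite big_split.
pose nz (f : {ffun 'I_m -> 'I_H * 'I_H}) := [exists i, freq (f i) != 0].
have main : \sum_(f | ~~ nz f) coef f * osc f =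
    (N.*2.+1%:R ^+ d * \prod_i mu i)%:C%C.
  (* In each coordinate the [H] pairs of frequency zero, each with coefficient [mu i / H], add up to
     [mu i]. *)
  pose c' i (ab : 'I_H * 'I_H) : R := if freq ab == 0 then mu i / H%:R else 0.
  have -> : \prod_i mu i = \sum_(f : {ffun 'I_m -> 'I_H * 'I_H}) \prod_i c' i (f i).
    rewrite -(bigA_distr_bigA c'); apply: eq_bigr => i _.
    rewrite -(pair_bigA _ (fun u v => c' i (u, v))) /=.
    transitivity (\sum_(u < H) mu i / H%:R).
      by rewrite sumr_const card_ord -[RHS]mulr_natr mulfVK ?gt_eqF.
    apply: eq_bigr => u _; rewrite (bigD1 u) //= /c' freq_eq0 eqxx.
    by rewrite big1 ?addr0 // => v /negPf; rewrite freq_eq0 /= eq_sym => ->.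
  rewrite [X in _ * X](bigID nz) /= [X in _ * (X + _)]big1 ?add0r; last first.
    by move=> f /existsP[i /negPf hi]; rewrite (bigD1 i) //= /c' hi mul0r.
  rewrite rmorphM rmorph_sum mulr_sumr; apply: eq_bigr => f.
  rewrite negb_exists => /forallP f0.
  have fi i : freq (f i) = 0 by apply/eqP; rewrite -[_ == _]negbK f0.
  rewrite mulrC; congr (_ * _).
    rewrite /osc; under eq_bigr do under eq_bigr do rewrite fi mul0r expi0.
    under eq_bigr do rewrite big1_eq.
    by rewrite sumr_const card_ffun !card_ord rmorphXn /= rmorph_nat natrX.
  rewrite rmorph_prod; apply: eq_bigr => i _.
  by rewrite c0 // /c' fi eqxx.
(* The 5 comes from frequency zero, where [mu i <= 1 + 4 / G <= 5]. *)
have coef_le f : `|coef f| <= (5 ^+ m * \prod_i wt (f i))%:C%C.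
  have -> : 5 ^+ m * \prod_i wt (f i) = \prod_i (5 * wt (f i)).
    by rewrite big_split /= prodr_const card_ord.
  rewrite normr_prod rmorph_prod; apply: ler_prod => i _; rewrite normr_ge0 /=.
  have [fi|fi] := eqVneq (freq (f i)) 0.
    rewrite c0 // normc_real lecR /wt fi absz0 mulr1.
    rewrite ger0_norm ?divr_ge0 ?(ltW HR) //; last by case/andP: (mu_bd i).
    rewrite ler_pM2r ?invr_gt0 //; have := mu_bd i; have [? ? ?] := ab i.
    have : 4 / G%:R <= 4 :> R by rewrite ler_pdivrMr ?ltr0n // ler_peMr // ler1n.
    lra.
  apply: le_trans (c1 _ _ fi) _; rewrite lecR /wt.
  have -> : maxn 1 `|freq (f i)| = `|freq (f i)|%N by lia.
  have -> : `|freq (f i)|%:~R = `|freq (f i)|%N%:R :> R by rewrite -abszE.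
  by rewrite ler_peMl ?ler1n // invr_ge0 mulr_ge0.
have osc_le f : `|osc f| <=
    (\prod_j layer T (\sum_i (freq (f i))%:~R * L i j))%:C%C.
  rewrite /osc orbit_exp_sum normrM expi_norm mul1r normr_prod rmorph_prod.
  by apply: ler_prod => j _; rewrite normr_ge0 kernel_le.
have err : `|\sum_(f | nz f) coef f * osc f| <= (5 ^+ m * koksma T H L)%:C%C.
  apply: le_trans (ler_norm_sum _ _ _) _.
  rewrite /koksma mulr_sumr rmorph_sum; apply: ler_sum => f _.
  by rewrite normrM mulrA rmorphM; apply: ler_pM.
have main_le : N.*2.+1%:R ^+ d * \prod_i mu i <=
    N.*2.+1%:R ^+ d * \prod_i (b i - a i + 4 / G%:R).
  by apply: ler_wpM2l; rewrite ?exprn_ge0 //; apply: ler_prod => i _; exact: mu_bd.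
apply: le_trans hits_tot _; apply: le_trans (lerD main_le (lexx _)).
rewrite -lerBlDl; apply: le_trans (ler_norm _) _.
by rewrite -lecR -normc_real rmorphB /= totE (bigID nz) /= main addrK.
Qed.

End Counting.

(** * Averages over a finite grid of matrices *)

Section Averaging.
Context {R : realType}.

(* [layer] with the radii doubled, so that its value at a grid point bounds
   [layer] on the whole surrounding cell. *)
Definition wide_layer (T : nat) (x : R) : R :=
  \sum_(t < T.+1) 2 ^+ t.+2 * (near_int (2 / 2 ^+ t) x)%:R.

Lemma wide_layer_ge0 T x : 0 <= wide_layer T x.
Proof. by apply: sumr_ge0 => t _; rewrite mulr_ge0 ?exprn_ge0. Qed.

Lemma near_int_perturb (t s x y : R) (z : int) :
  `|x - y - z%:~R| <= s -> near_int t x -> near_int (t + s) y.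
Proof.
move=> xy /asboolP[u xu]; apply/asboolP; exists (u - z).
have -> : y - (u - z)%:~R = (x - u%:~R) - (x - y - z%:~R).
  by rewrite intrD mulrNz; ring.
by apply: le_trans (ler_normB _ _) _; rewrite lerD.
Qed.

Lemma near_int_periodic (t x : R) (z : int) :
  near_int t (x + z%:~R) = near_int t x.
Proof.
by apply/idP/idP => h; rewrite -[t]addr0; apply: (near_int_perturb (z := _) _ h);
  [rewrite [X in `|X|](_ : _ = 0) ?normr0 //; instantiate (1 := z); ring
  |rewrite [X in `|X|](_ : _ = 0) ?normr0 //; instantiate (1 := - z); rewrite mulrNz; ring].
Qed.

Lemma wide_layer_periodic T x (z : int) :
  wide_layer T (x + z%:~R) = wide_layer T x.
Proof. by apply: eq_bigr => t _; rewrite near_int_periodic. Qed.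

Lemma layer_wide T x y (z : int) : `|x - y - z%:~R| <= (2 ^+ T)^-1 ->
  layer T x <= wide_layer T y.
Proof.
move=> xy; apply: ler_sum => t _; apply: ler_wpM2l; first exact: exprn_ge0.
have [nx|_] := boolP (near_int _ x); last by [].
suff -> : near_int (2 / 2 ^+ t) y by [].
rewrite mulr_natl mulr2n; apply: near_int_perturb nx.
apply: le_trans xy _; rewrite lef_pV2 ?posrE ?exprn_gt0 //.
by rewrite ler_eXn2l ?ltr1n // -ltnS.
Qed.

(** A fraction [b / p] in [[0, 1)] is within [t < 1 / 2] of an integer only near 0 or near 1, which
    leaves [b <= n] or [p - b <= n] with [n] the integer part of [t * p]. For larger [t] the bound
    exceeds [p]. *)
Lemma near_count (p : nat) (t : R) : (0 < p)%N -> 0 <= t ->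
  \sum_(b < p) (near_int t (b%:R / p%:R))%:R <= 2 * (t * p%:R + 1).
Proof.
move=> p0 t0; have pR : 0 < p%:R :> R by rewrite ltr0n.
have [t12|t12] := leP (1 / 2) t.
  apply: le_trans (_ : \sum_(b < p) 1 <= _).
    by apply: ler_sum => b _; rewrite lern1 leq_b1.
  by rewrite sumr_const card_ord -[leLHS]/(p%:R); nra.
pose n := Num.trunc (t * p%:R).
have nP : n%:R <= t * p%:R < n.+1%:R.
  by apply: trunc_itv; rewrite mulr_ge0 // ltW.
have side (g : 'I_p -> 'I_n.+1) (P : pred 'I_p) : {in P &, injective g} ->
    \sum_(b | P b) (1 : R) <= n.+1%:R.
  move=> /(ler_sum_inj (F := fun=> 1 : R)) /(_ (fun=> ler01)).
  by rewrite [X in _ <= X -> _]sumr_const card_ord.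
have low : \sum_(b < p | (b <= n)%N) (1 : R) <= n.+1%:R.
  apply: (side (fun b => inord b)) => b b' hb hb' /(congr1 val) /=.
  by rewrite !inordK // => /val_inj.
have high : \sum_(b < p | (p - b <= n)%N) (1 : R) <= n.+1%:R.
  apply: (side (fun b => inord (p - b))) => b b' hb hb' /(congr1 val) /=.
  rewrite !inordK // => e; apply: val_inj => /=.
  by have := ltn_ord b; have := ltn_ord b'; lia.
have nR : n.+1%:R <= t * p%:R + 1 by rewrite -natr1; lra.
apply: le_trans (_ : n.+1%:R + n.+1%:R <= _); last by lra.
apply: le_trans (lerD low high); rewrite [X in X + _]big_mkcond.
rewrite [X in _ + X]big_mkcond -big_split; apply: ler_sum => b _ /=.
have [/asboolP[z hz]|_] := boolP (near_int _ _); last first.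
  by case: ifP; case: ifP; rewrite ?addr0 ?addr_ge0.
have bp : (b : nat)%:R + 1 <= p%:R :> R by rewrite natr1 ler_nat ltn_ord.
have b0 : 0 <= (b : nat)%:R :> R by [].
have {}hz : `|(b : nat)%:R - z%:~R * p%:R| <= t * p%:R.
  have -> : (b : nat)%:R - z%:~R * p%:R = ((b : nat)%:R / p%:R - z%:~R) * p%:R :> R.
    by field; rewrite gt_eqF.
  by rewrite normrM (gtr0_norm pR) ler_pM2r.
suff : (b <= n)%N || (p - b <= n)%N.
  by case/orP => ->; rewrite ?lerDl ?lerDr; case: ifP.
move: hz; rewrite ler_norml => /andP[hz1 hz2]; move/andP: nP => [_ nP].
have [z1|z1|z1] := ltgtP z 1.
- apply/orP; left; rewrite -ltnS -(ltr_nat R).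
  have : z%:~R * p%:R <= 0 :> R by rewrite pmulr_lle0 // lerz0 -ltzD1.
  lra.
- have : 2 * p%:R <= z%:~R * p%:R :> R.
    by rewrite ler_pM2r // (ler_int _ 2) (lezD1 1).
  have : t * p%:R <= 1 / 2 * p%:R by rewrite ler_pM2r // ltW.
  lra.
- apply/orP; right; rewrite -ltnS -(ltr_nat R) natrB ?(ltnW (ltn_ord _)) //.
  move: hz1 hz2; rewrite z1 mul1r; lra.
Qed.

(** A layer has weight [2 ^ t.+2] but density of order [2 ^- t], so all [T.+1] layers contribute
    equally, at most [16 p + 8 * 2 ^ t <= 24 p] each. *)
Lemma wide_layer_mean (p T : nat) : (2 ^ T <= p)%N ->
  \sum_(b < p) wide_layer T (b%:R / p%:R) <= (24 * T.+1 * p)%:R.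
Proof.
move=> Tp; have p0 : (0 < p)%N by apply: leq_trans Tp; rewrite expn_gt0.
rewrite exchange_big /=.
apply: le_trans (_ : \sum_(t < T.+1) (24 * p)%:R <= _).
  apply: ler_sum => t _; rewrite -mulr_sumr.
  have tp : 2 ^+ t <= p%:R :> R.
    rewrite -natrX ler_nat; apply: leq_trans Tp.
    by rewrite leq_exp2l // -ltnS.
  have t0 : 0 < 2 ^+ t :> R by rewrite exprn_gt0.
  have le := @near_count p (2 / 2 ^+ t) p0 (divr_ge0 (ler0n _ 2) (ltW t0)).
  apply: le_trans (ler_wpM2l _ le) _; first exact: exprn_ge0.
  have -> : 2 ^+ t.+2 * (2 * (2 / 2 ^+ t * p%:R + 1)) =
      16 * p%:R + 8 * 2 ^+ t :> R.
    by rewrite !exprS; field; rewrite gt_eqF.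
  by rewrite natrM; lra.
by rewrite sumr_const card_ord -mulrnA mulnAC.
Qed.

Definition gridpt (p : nat) (a : 'F_p) : R := (a : nat)%:R / p%:R.

(** Lets an integer linear form at a grid point be evaluated in the field ['F_p]. *)
Lemma periodic_Fp (p : nat) (g : R -> R) (N : int) : prime p ->
  (forall x (z : int), g (x + z%:~R) = g x) ->
  g (N%:~R / p%:R) = g (gridpt (N%:~R : 'F_p)).
Proof.
move=> pp gper; have p0 : p%:R != 0 :> R by rewrite pnatr_eq0 -lt0n prime_gt0.
have [n nE] : exists n : nat, (N %% p)%Z = n.
  have : (0 <= (N %% p)%Z) by rewrite modz_ge0 // -lt0n prime_gt0.
  by case: (N %% p)%Z => // n _; exists n.
have np : (n < p)%N.
  by rewrite -ltz_nat -nE ltz_pmod // ltz_nat prime_gt0.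
have NE : N = (N %/ p)%Z * p%:Z + n%:Z by rewrite -nE -divz_eq.
have -> : gridpt (N%:~R : 'F_p) = n%:R / p%:R.
  rewrite /gridpt NE intrD intrM.
  have -> : (p%:Z)%:~R = 0 :> 'F_p by apply/eqP; rewrite -(dvdn_pcharf (pchar_Fp pp)).
  by rewrite mulr0 add0r val_Fp_nat // modn_small.
rewrite -[RHS](gper _ (N %/ p)%Z); congr g.
by rewrite {1}NE intrD intrM; field.
Qed.

(** Since [h i0] is invertible modulo [p], a translation of [a] along [v] shifts the linear form by
    any prescribed [t]. Averaging over [t] reduces the sum to the one-variable mean. *)
Lemma linear_mean (p T m : nat) (h : 'I_m -> int) (i0 : 'I_m) : prime p ->
  (2 ^ T <= p)%N -> (0 < `|h i0| < p)%N ->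
  \sum_(a : {ffun 'I_m -> 'F_p})
    wide_layer T (\sum_i (h i)%:~R * gridpt (a i)) <= (p ^ m * (24 * T.+1))%:R.
Proof.
move=> pp Tp hp; have p0 : 0 < p%:R :> R by rewrite ltr0n prime_gt0.
pose phi (a : {ffun 'I_m -> 'F_p}) : 'F_p := \sum_i (h i)%:~R * a i.
pose gF (b : 'F_p) := wide_layer T (gridpt b).
have argE (a : {ffun 'I_m -> 'F_p}) : wide_layer T (\sum_i (h i)%:~R * gridpt (a i)) = gF (phi a).
  pose N : int := \sum_i h i * Posz (a i : nat).
  transitivity (wide_layer T (N%:~R / p%:R)).
    congr wide_layer; rewrite /N rmorph_sum mulr_suml; apply: eq_bigr => i _.
    by rewrite rmorphM /= /gridpt mulrA.
  rewrite (periodic_Fp _ pp (wide_layer_periodic T)) /gF; congr (wide_layer T (gridpt _)).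
  rewrite /N /phi rmorph_sum; apply: eq_bigr => i _.
  by rewrite rmorphM /=; congr (_ * _); rewrite -pmulrn natr_Zp.
under eq_bigr do rewrite argE.
have hF : (h i0)%:~R != 0 :> 'F_p.
  have -> : ((h i0)%:~R == 0 :> 'F_p) = (p %| `|h i0|)%N.
    rewrite (dvdn_pcharf (pchar_Fp pp)).
    by case: (h i0) => n //; rewrite NegzE mulrNz oppr_eq0.
  by rewrite gtnNdvd //; case/andP: hp.
pose v : {ffun 'I_m -> 'F_p} := [ffun i => if i == i0 then ((h i0)%:~R)^-1 else 0].
have phiD (a : {ffun 'I_m -> 'F_p}) (t : 'F_p) : phi (a + [ffun i => t * v i]) = phi a + t.
  rewrite /phi; under eq_bigr do rewrite /v !ffunE mulrDr.
  rewrite big_split /=; congr (_ + _).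
  rewrite (bigD1 i0) //= eqxx big1 => [|i /negPf ->]; last by rewrite !mulr0.
  by rewrite addr0 mulrCA divff // mulr1.
have shift (t : 'F_p) : \sum_(a : {ffun 'I_m -> 'F_p}) gF (phi a) = \sum_a gF (phi a + t).
  rewrite (reindex_inj (addIr [ffun i => t * v i])) /=.
  by apply: eq_bigr => a _; rewrite phiD.
have cardF : #|'F_p| = p by rewrite card_Fp.
rewrite -(ler_pM2l p0).
have -> : p%:R * \sum_(a : {ffun 'I_m -> 'F_p}) gF (phi a) =
    \sum_(t : 'F_p) \sum_(a : {ffun 'I_m -> 'F_p}) gF (phi a + t).
  under [RHS]eq_bigr do rewrite -shift.
  by rewrite sumr_const cardF mulr_natl.
rewrite exchange_big /=.
have inner (a : {ffun 'I_m -> 'F_p}) : \sum_t gF (phi a + t) = \sum_t gF t.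
  by rewrite [RHS](reindex_inj (addrI (phi a))).
under eq_bigr do rewrite inner.
rewrite sumr_const card_ffun cardF card_ord.
have -> : \sum_(t : 'F_p) gF t = \sum_(b < p) wide_layer T (b%:R / p%:R).
  transitivity (\sum_(0 <= b < (Zp_trunc (pdiv p)).+2) wide_layer T (b%:R / p%:R)).
    by rewrite big_mkord.
  by rewrite Fp_cast // big_mkord.
rewrite -[leLHS]mulr_natl.
apply: le_trans (ler_wpM2l _ (wide_layer_mean Tp)) _; first exact: ler0n.
by rewrite -!natrM ler_nat [leqLHS]mulnA [leqLHS]mulnC leqnn.
Qed.

(** Each dyadic block of the harmonic sum is at most 1. *)
Lemma harmonic_le (S : nat) :
  \sum_(k < 2 ^ S) ((maxn 1 k)%:R : R)^-1 <= S.+1%:R.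
Proof.
rewrite -(big_mkord xpredT (fun k => ((maxn 1 k)%:R : R)^-1)).
elim: S => [|S ih]; first by rewrite expn0 big_nat1 invr1.
rewrite (@big_cat_nat _ _ _ (2 ^ S)) //=; last by rewrite leq_exp2l.
rewrite -[S.+2%:R]natr1 lerD //.
apply: le_trans (_ : \sum_(2 ^ S <= k < 2 ^ S.+1) ((2 ^ S)%:R)^-1 <= _).
  rewrite big_nat_cond [leRHS]big_nat_cond; apply: ler_sum => k.
  rewrite andbT => /andP[k1 _].
  have S0 : (0 < 2 ^ S)%N by rewrite expn_gt0.
  by rewrite lef_pV2 ?posrE ?ltr0n ?ler_nat; lia.
rewrite big_const_nat iter_addr_0 expnS mul2n -addnn addnK -[leLHS]mulr_natr.
by rewrite mulVf // pnatr_eq0 expn_eq0.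
Qed.

(** For fixed [a], the differences [a - b] and [b - a] are injective on their ranges, giving two
    harmonic sums per row; the factor [1 / H] averages over rows. *)
Lemma wt_sum_le (S : nat) :
  \sum_(ab : 'I_(2 ^ S) * 'I_(2 ^ S)) wt ab <= (2 * S.+1)%:R :> R.
Proof.
set H := (2 ^ S)%N; have HR : 0 < H%:R :> R by rewrite ltr0n expn_gt0.
rewrite -(pair_bigA _ (fun a b : 'I_H => wt (a, b))) /=.
pose F (k : 'I_H) : R := ((maxn 1 k)%:R)^-1.
have F0 k : 0 <= F k by rewrite invr_ge0.
have wtE (a b k : 'I_H) : `|freq (a, b)|%N = k -> wt (a, b) = H%:R^-1 * F k.
  by rewrite /wt => ->; rewrite invfM.
have row (a : 'I_H) : \sum_b wt (a, b) <= H%:R^-1 * (2 * S.+1)%:R :> R.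
  rewrite (bigID (fun b : 'I_H => b <= a)%N) /= mul2n -addnn natrD mulrDr.
  have sub (k l : 'I_H) : (k - l < H)%N by apply: leq_ltn_trans (leq_subr _ _) _.
  apply: lerD.
    rewrite (eq_bigr (fun b => H%:R^-1 * F (Ordinal (sub a b)))); last first.
      by move=> b ba; apply: wtE; rewrite /freq /=; lia.
    rewrite -mulr_sumr ler_wpM2l ?invr_ge0 //.
    apply: le_trans (harmonic_le S); apply: (ler_sum_inj (F := F)) => // b b' hb hb' [].
    by move: hb hb'; rewrite !unfold_in => hb hb' e; apply: val_inj => /=; lia.
  rewrite (eq_bigr (fun b => H%:R^-1 * F (Ordinal (sub b a)))); last first.
    by move=> b ba; apply: wtE; rewrite /freq /=; lia.
  rewrite -mulr_sumr ler_wpM2l ?invr_ge0 //.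
  apply: le_trans (harmonic_le S); apply: (ler_sum_inj (F := F)) => // b b' hb hb' [].
  by move: hb hb'; rewrite !unfold_in => hb hb' e; apply: val_inj => /=; lia.
apply: le_trans (ler_sum _ (fun a _ => row a)) _.
by rewrite sumr_const card_ord -[leLHS]mulr_natl mulrA mulfV ?mul1r // gt_eqF.
Qed.

Context {m d : nat}.

Definition wide_koksma (T H : nat) (L : 'M[R]_(m, d)) : R :=
  \sum_(f : {ffun 'I_m -> 'I_H * 'I_H} | [exists i, freq (f i) != 0])
    (\prod_i wt (f i)) *
    \prod_j wide_layer T (\sum_i (freq (f i))%:~R * L i j).

Definition gridmx (p : nat) (A : {ffun 'I_d -> {ffun 'I_m -> 'F_p}}) : 'M[R]_(m, d) :=
  \matrix_(i, j) gridpt (A j i).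

(** The columns of a grid matrix vary independently, so the mean of the product over [j] is a
    product of means. A nonzero frequency remains nonzero modulo [p] because it is below
    [2 ^ S < p]. *)
Lemma wide_koksma_mean (p T S : nat) : prime p -> (2 ^ T <= p)%N ->
  (2 ^ S < p)%N ->
  \sum_(A : {ffun 'I_d -> {ffun 'I_m -> 'F_p}})
      wide_koksma T (2 ^ S) (gridmx A) <=
    (p ^ (m * d) * ((2 * S.+1) ^ m * (24 * T.+1) ^ d))%:R :> R.
Proof.
move=> pp Tp Sp; set H := (2 ^ S)%N.
rewrite exchange_big /=.
pose c : R := (p ^ (m * d) * (24 * T.+1) ^ d)%:R.
apply: le_trans (_ : \sum_(f : {ffun 'I_m -> 'I_H * 'I_H}) (\prod_i wt (f i)) * c <= _).
  rewrite [leRHS](bigID (fun f : {ffun 'I_m -> 'I_H * 'I_H} => [exists i, freq (f i) != 0])) /=.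
  rewrite -[leLHS]addr0; apply: lerD; last first.
    apply: sumr_ge0 => f _; rewrite mulr_ge0 ?ler0n //.
    by apply: prodr_ge0 => i _; exact: wt_ge0.
  apply: ler_sum => f /existsP[i0 fi0].
  rewrite -mulr_sumr; apply: ler_wpM2l; first by apply: prodr_ge0 => i _; exact: wt_ge0.
  pose G (a : {ffun 'I_m -> 'F_p}) := wide_layer T (\sum_i (freq (f i))%:~R * gridpt (a i)).
  have -> : \sum_(A : {ffun 'I_d -> {ffun 'I_m -> 'F_p}})
       \prod_j wide_layer T (\sum_i (freq (f i))%:~R * gridmx A i j) =
     \prod_(j < d) \sum_a G a.
    rewrite bigA_distr_bigA; apply: eq_bigr => A _; apply: eq_bigr => j _.
    by congr wide_layer; apply: eq_bigr => i _; rewrite mxE.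
  rewrite prodr_const card_ord /c expnM -expnMn natrX lerXn2r ?nnegrE //.
    by apply: sumr_ge0 => a _; exact: wide_layer_ge0.
  apply: (linear_mean (i0 := i0)) => //.
  by rewrite absz_gt0 fi0 /=; have := freq_lt (f i0); lia.
rewrite -mulr_suml -(bigA_distr_bigA (fun i ab => wt ab)) prodr_const card_ord.
rewrite /c !natrM [leLHS]mulrCA; apply: ler_wpM2l; first exact: ler0n.
rewrite ler_wpM2r // natrX lerXn2r ?nnegrE ?wt_sum_le //.
by apply: sumr_ge0 => ab _; exact: wt_ge0.
Qed.

(** Moving [L] within its cell changes each linear form, modulo 1, by at most [m * H / p <= 2 ^- T],
    the finest radius in [layer]. *)
Lemma koksma_cell (p T H : nat) (A : {ffun 'I_d -> {ffun 'I_m -> 'F_p}})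
    (Z : 'M[int]_(m, d)) (L : 'M[R]_(m, d)) : (m * H * 2 ^ T <= p)%N -> (0 < p)%N ->
  (forall i j, 0 <= L i j - (Z i j)%:~R - gridpt (A j i) <= p%:R^-1) ->
  koksma T H L <= wide_koksma T H (gridmx A).
Proof.
move=> pbig p0 LA; have pR : 0 < p%:R :> R by rewrite ltr0n.
apply: ler_sum => f _; apply: ler_wpM2l.
  by apply: prodr_ge0 => i _; exact: wt_ge0.
apply: ler_prod => j _; rewrite layer_ge0 /=.
apply: (layer_wide (z := \sum_i freq (f i) * Z i j)).
rewrite rmorph_sum -!sumrB /=.
apply: le_trans (ler_norm_sum _ _ _) _.
apply: le_trans (_ : \sum_(i < m) H%:R / p%:R <= _).
  apply: ler_sum => i _; rewrite mxE intrM -!mulrBr normrM.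
  have -> : L i j - gridpt (A j i) - (Z i j)%:~R =
    L i j - (Z i j)%:~R - gridpt (A j i) by ring.
  have /andP[l0 l1] := LA i j; rewrite (ger0_norm l0).
  apply: ler_pM => //; rewrite -intr_norm -[H%:R]/((H%:Z)%:~R) ler_int.
  exact: ltW (freq_lt _).
rewrite sumr_const card_ord -[leLHS]mulr_natl mulrA ler_pdivrMr //.
rewrite -natrM mulrC ler_pdivlMr ?exprn_gt0 // -natrX -natrM ler_nat //.
Qed.

End Averaging.

(** * Null sets of matrices *)

Section Covering.
Context {R : realType} {m d : nat}.
Implicit Types (A : set 'M[R]_(m, d)) (e : R).

Definition volume (a b : 'M[R]_(m, d)) : R := \prod_i \prod_j (b i j - a i j).

Definition mxbox (a b : 'M[R]_(m, d)) : set 'M[R]_(m, d) :=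
  [set M | forall i j, a i j <= M i j <= b i j].

(** Outer measure at most [e], expressed by real partial sums; extended real series appear only in
    the conversion to [lebesgue_null]. *)
Definition outer_le A e := exists a b : nat -> 'M[R]_(m, d),
  [/\ forall l i j, a l i j <= b l i j, A `<=` \bigcup_l mxbox (a l) (b l)
    & forall N, \sum_(l < N) volume (a l) (b l) <= e].

Lemma volume_ge0 (a b : 'M[R]_(m, d)) : (forall i j, a i j <= b i j) ->
  0 <= volume a b.
Proof.
by move=> ab; apply: prodr_ge0 => i _; apply: prodr_ge0 => j _; rewrite subr_ge0.
Qed.

Lemma lebesgue_null_outer A : (forall e, 0 < e -> outer_le A e) -> lebesgue_null A.
Proof.
move=> cov e /cov [a [b [ab Aab le_e]]]; exists a, b; split=> //.
apply: lime_le; first by apply: is_cvg_nneseries => n _ _; rewrite lee_fin volume_ge0.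
by apply: nearW => N; rewrite /= sumEFin lee_fin big_mkord.
Qed.

Lemma outer_le_sub A B e : A `<=` B -> outer_le B e -> outer_le A e.
Proof.
by move=> AB [a [b [? Bab ?]]]; exists a, b; split => //; apply: subset_trans Bab.
Qed.

Hypotheses (m0 : (0 < m)%N) (d0 : (0 < d)%N).

(** Positive dimensions matter here: an empty product would be 1. *)
Lemma volume_point (a : 'M[R]_(m, d)) : volume a a = 0.
Proof.
rewrite /volume (bigD1 (Ordinal m0)) //= (bigD1 (Ordinal d0)) //=.
by rewrite subrr !mul0r.
Qed.

(* The countType encoding indexes the family by [nat]; unused codes get a
   degenerate box. *)
Lemma outer_le_countable (I : countType) (a b : I -> 'M[R]_(m, d)) A e :
  (forall k i j, a k i j <= b k i j) ->
  A `<=` \bigcup_k mxbox (a k) (b k) ->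
  (forall s : seq I, uniq s -> \sum_(k <- s) volume (a k) (b k) <= e) ->
  outer_le A e.
Proof.
move=> ab Aab le_e.
exists (fun l => oapp a 0 (@pickle_inv I l)), (fun l => oapp b 0 (@pickle_inv I l)).
split.
- by move=> l i j; case: pickle_inv => //= k; exact: ab.
- by move=> M /Aab [k _ Mk]; exists (choice.pickle k) => //; rewrite pickleK_inv.
move=> N; apply: le_trans (le_e (pmap (@pickle_inv I) (iota 0 N)) _).
  rewrite -(big_mkord xpredT (fun l => volume (oapp a 0 (@pickle_inv I l))
     (oapp b 0 (@pickle_inv I l)))) /index_iota subn0.
  elim: (iota 0 N) => [|l s ih]; first by rewrite !big_nil.
  rewrite big_cons /=; case: pickle_inv => [k|] /=.
    by rewrite big_cons lerD2l.
  by rewrite volume_point add0r.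
by apply: (pmap_uniq (g := choice.pickle)); [exact: pickle_invK | exact: iota_uniq].
Qed.

Lemma outer_le_finite (I : finType) (P : pred I) (a b : I -> 'M[R]_(m, d)) A e :
  (forall k i j, a k i j <= b k i j) ->
  A `<=` \bigcup_(k in [set k | P k]) mxbox (a k) (b k) ->
  \sum_(k | P k) volume (a k) (b k) <= e ->
  outer_le A e.
Proof.
move=> ab Aab le_e.
(* Boxes not selected by [P] collapse to points and cost nothing. *)
pose b' k := if P k then b k else a k.
apply: (@outer_le_countable I a b').
- by move=> k i j; rewrite /b'; case: ifP.
- by move=> M /Aab [k /= Pk Mk]; exists k => //; rewrite /b' Pk.
move=> s us; apply: le_trans le_e.
have b'0 k : 0 <= volume (a k) (b' k).
  by apply: volume_ge0 => i j; rewrite /b'; case: ifP.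
rewrite [leRHS]big_mkcond big_uniq //= big_mkcond; apply: ler_sum => k _.
move: (b'0 k); rewrite /b'; case: (P k) => // vk; case: ifP => // _.
by rewrite volume_point.
Qed.

Lemma ler_sum_sub_uniq (I : eqType) (s s' : seq I) (F : I -> R) :
  uniq s -> uniq s' -> {subset s <= s'} -> (forall k, 0 <= F k) ->
  \sum_(k <- s) F k <= \sum_(k <- s') F k.
Proof.
move=> us us' ss' F0; rewrite [leRHS](bigID [in s]) /= -[leLHS]addr0.
apply: lerD; last exact: sumr_ge0.
rewrite -[leRHS]big_filter le_eqVlt; apply/orP; left; apply/eqP.
apply: perm_big; apply: uniq_perm; rewrite ?filter_uniq // => k.
by rewrite mem_filter; apply/idP/andP => [ks|[]//]; split=> //; exact: ss'.
Qed.

(** Finitely many pairs of indices lie in a square, over which the volumes are summed row by row. *)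
Lemma outer_le_bigcup (A : nat -> set 'M[R]_(m, d)) (e : nat -> R) E :
  (forall n, outer_le (A n) (e n)) -> (forall N, \sum_(n < N) e n <= E) ->
  outer_le (\bigcup_n A n) E.
Proof.
move=> cov sumE.
have ex n : exists c : (nat -> 'M[R]_(m, d)) * (nat -> 'M[R]_(m, d)),
    [/\ forall l i j, c.1 l i j <= c.2 l i j,
      A n `<=` \bigcup_l mxbox (c.1 l) (c.2 l)
    & forall N, \sum_(l < N) volume (c.1 l) (c.2 l) <= e n].
  by have [a [b ?]] := cov n; exists (a, b).
have [c cP] := choice ex.
apply: (@outer_le_countable (nat * nat)%type
  (fun k => (c k.1).1 k.2) (fun k => (c k.1).2 k.2)).
- by move=> [n l] i j /=; have [h _ _] := cP n; exact: h.
- move=> M [n _ AM]; have [_ /(_ M AM) [l _ Ml] _] := cP n.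
  by exists (n, l).
move=> s us.
have [M hM] : exists M : nat, forall k, k \in s -> (maxn k.1 k.2 < M)%N.
  exists (\max_(k <- s) maxn k.1 k.2).+1 => k ks.
  by rewrite ltnS (leq_bigmax_seq (F := fun k => maxn k.1 k.2) k).
have v0 (k : nat * nat) : 0 <= volume ((c k.1).1 k.2) ((c k.1).2 k.2).
  by apply: volume_ge0 => i j; have [h _ _] := cP k.1; exact: h.
apply: le_trans (sumE M).
apply: le_trans (_ : \sum_(k <- [seq (n, l) | n <- iota 0 M, l <- iota 0 M])
   volume ((c k.1).1 k.2) ((c k.1).2 k.2) <= _).
  apply: ler_sum_sub_uniq => //.
    by apply: allpairs_uniq; rewrite ?iota_uniq // => -[? ?] [? ?].
  move=> [n l] /hM; rewrite gtn_max => /andP[/= nM lM].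
  by apply/allpairsP; exists (n, l); rewrite !mem_iota /= nM lM.
have -> : iota 0 M = index_iota 0 M by rewrite /index_iota subn0.
rewrite big_allpairs_dep /= big_mkord.
apply: ler_sum => n _; rewrite big_mkord.
by have [_ _] := cP n; apply.
Qed.

Lemma geometric_tail (r e : R) : 0 < r < 1 -> 0 < e ->
  exists u0 : nat, forall N, \sum_(u < N) r ^+ (u0 + u) <= e.
Proof.
move=> /andP[r0 r1] e0.
have := @cvg_expr R r; rewrite gtr0_norm // => /(_ r1) /cvgrPdist_lt.
move=> /(_ (e * (1 - r))); rewrite mulr_gt0 ?subr_gt0 // => /(_ isT) [u0 _ hu].
have := hu u0 (leqnn _); rewrite sub0r normrN ger0_norm ?exprn_ge0 ?(ltW r0) // => ru0.
exists u0 => N; have r10 : 0 < 1 - r by rewrite subr_gt0.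
under eq_bigr do rewrite exprD.
rewrite -mulr_sumr -(ler_pM2r r10) -mulrA.
have -> : (\sum_(u < N) r ^+ u) * (1 - r) = 1 - r ^+ N.
  by rewrite -opprB mulrN mulrC -subrX1 opprB.
apply: le_trans (ltW ru0); rewrite ler_piMr ?exprn_ge0 ?(ltW r0) //.
by rewrite gerBl exprn_ge0 // ltW.
Qed.

Lemma null_bigcup (A : nat -> set 'M[R]_(m, d)) :
  (forall n e, 0 < e -> outer_le (A n) e) ->
  forall e, 0 < e -> outer_le (\bigcup_n A n) e.
Proof.
move=> A0 e e0; have h2 : 0 < (2^-1 : R) < 1 by lra.
have [u0 hu] := geometric_tail h2 e0.
apply: (@outer_le_bigcup A (fun u => 2^-1 ^+ (u0 + u)) e _ hu) => n; apply: A0.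
by rewrite exprn_gt0 //; case/andP: h2.
Qed.

(** The Borel-Cantelli lemma for geometric bounds: the limsup is contained in every tail union. *)
Lemma null_limsup (A : nat -> set 'M[R]_(m, d)) (r : R) : 0 < r < 1 ->
  (forall u, outer_le (A u) (r ^+ u)) ->
  forall e, 0 < e ->
  outer_le [set L | forall u0, exists2 u, (u0 <= u)%N & A u L] e.
Proof.
move=> r01 Ar e e0; have [u0 hu] := geometric_tail r01 e0.
apply: (@outer_le_sub _ (\bigcup_n A (u0 + n)%N)); last first.
  by apply: (@outer_le_bigcup _ (fun u => r ^+ (u0 + u)) e _ hu) => n; exact: Ar.
by move=> L /(_ u0) [u u0u AL]; exists (u - u0)%N; rewrite //= subnKC.
Qed.

End Covering.

(** * Almost every matrix is good *)

Section GoodMatrices.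
Context {R : realType} {m d : nat}.
Hypotheses (m0 : (0 < m)%N) (d0 : (0 < d)%N).

Definition mean_bound (T S : nat) : nat := ((2 * S.+1) ^ m * (24 * T.+1) ^ d)%N.

(** Markov's inequality on the grid: a matrix exceeding [lam] lies in a cell whose grid point
    exceeds [lam] for [wide_koksma], and every cell has volume [p ^- (m * d)]. *)
Lemma koksma_tail (Z : 'M[int]_(m, d)) (T S : nat) (lam : R) : 0 < lam ->
  outer_le [set L : 'M[R]_(m, d) | (forall i j, (Z i j)%:~R <= L i j < (Z i j)%:~R + 1) /\
                    lam < koksma T (2 ^ S) L]
    ((mean_bound T S)%:R / lam).
Proof.
move=> lam0.
(* The three terms serve [koksma_cell], the near counts behind the mean, and the survival of
   frequencies modulo [p]. *)
have [p pbig pp] := prime_above (m * 2 ^ S * 2 ^ T + 2 ^ T + 2 ^ S).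
have p0 : (0 < p)%N by exact: prime_gt0.
have pR : 0 < p%:R :> R by rewrite ltr0n.
pose G (A : {ffun 'I_d -> {ffun 'I_m -> 'F_p}}) : 'M[R]_(m, d) := gridmx A.
pose Zr : 'M[R]_(m, d) := \matrix_(i, j) (Z i j)%:~R.
pose bad (A : {ffun 'I_d -> {ffun 'I_m -> 'F_p}}) : bool :=
  lam < wide_koksma T (2 ^ S) (G A).
apply: (outer_le_finite m0 d0 (P := bad) (a := fun A => Zr + G A)
  (b := fun A => Zr + G A + const_mx p%:R^-1)).
- by move=> A i j; rewrite !mxE lerDl invr_ge0.
- move=> L [LZ Llam].
  pose n i j := Num.trunc (p%:R * (L i j - (Z i j)%:~R)).
  have nP i j : (n i j)%:R <= p%:R * (L i j - (Z i j)%:~R) < (n i j).+1%:R.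
    apply: trunc_itv; rewrite mulr_ge0 // ?(ltW pR) // subr_ge0.
    by case/andP: (LZ i j).
  pose A : {ffun 'I_d -> {ffun 'I_m -> 'F_p}} := [ffun j => [ffun i => (n i j)%:R]].
  have AE i j : gridpt (A j i) = (n i j)%:R / p%:R :> R.
    rewrite /gridpt !ffunE val_Fp_nat // modn_small // -(ltr_nat R).
    have /andP[h1 _] := nP i j; apply: le_lt_trans h1 _.
    by rewrite gtr_pMr // ltrBlDl; case/andP: (LZ i j).
  have cell i j : 0 <= L i j - (Z i j)%:~R - gridpt (A j i) <= p%:R^-1.
    rewrite AE; set x := L i j - _; have := nP i j; rewrite -/x -natr1 => nx.
    have pV : p%:R * p%:R^-1 = 1 :> R by rewrite mulfV // gt_eqF.
    rewrite -(ler_pM2l pR) -(ler_pM2l pR (x - _)) mulr0 mulrBr pV.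
    by rewrite mulrCA pV mulr1; lra.
  exists A => [/=|i j]; last by rewrite !mxE; have := cell i j; lra.
  by rewrite /bad; apply: lt_le_trans Llam (koksma_cell _ p0 cell); lia.
have volE A : volume (Zr + G A) (Zr + G A + const_mx p%:R^-1) =
    (p%:R^-1) ^+ (m * d) :> R.
  rewrite /volume; under eq_bigr do under eq_bigr do rewrite mxE addrAC subrr add0r mxE.
  under eq_bigr do rewrite prodr_const card_ord.
  by rewrite prodr_const card_ord -exprM mulnC.
under eq_bigr do rewrite volE.
rewrite ler_pdivlMr // mulr_suml.
apply: le_trans (_ : \sum_A (p%:R^-1) ^+ (m * d) * wide_koksma T (2 ^ S) (G A) <= _).
  rewrite [leRHS](bigID bad) /= -[leLHS]addr0; apply: lerD.
    by apply: ler_sum => A /ltW; apply: ler_wpM2l; rewrite exprn_ge0 ?invr_ge0.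
  apply: sumr_ge0 => A _; rewrite mulr_ge0 ?exprn_ge0 ?invr_ge0 //.
  apply: sumr_ge0 => f _; apply: mulr_ge0; apply: prodr_ge0 => i _.
    exact: wt_ge0.
  exact: wide_layer_ge0.
rewrite -mulr_sumr; have := @wide_koksma_mean R m d p T S pp; rewrite -/G => mean.
apply: le_trans (ler_wpM2l _ (mean _ _)) _; rewrite ?exprn_ge0 ?invr_ge0 //; try lia.
by rewrite natrM natrX mulrA -exprMn mulVf ?gt_eqF // expr1n mul1r.
Qed.

(* Along the scales [T = 2 ^ u] a threshold exceeding the mean by the factor
   [q ^ u] is violated with summable probability, while [log N] changes only by
   a factor 2 from one scale to the next. *)
Definition good_matrix (q : R) (L : 'M[R]_(m, d)) : Prop :=
  exists u0 : nat, forall u, (u0 <= u)%N ->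
    koksma (2 ^ u) (2 ^ (3 * (2 ^ u * d))) L <=
      q ^+ u * (mean_bound (2 ^ u) (3 * (2 ^ u * d)))%:R.

(** Inside a unit cube, scale [u] fails on a set of outer measure at most [q ^- u]; countably many
    cubes cover all matrices. *)
Lemma ae_good_matrix (q : R) : 1 < q ->
  lebesgue_null [set L : 'M[R]_(m, d) | ~ good_matrix q L].
Proof.
move=> q1; have q0 : 0 < q by apply: lt_trans q1.
apply: lebesgue_null_outer => e e0.
pose S u := (3 * (2 ^ u * d))%N.
pose lam u := q ^+ u * (mean_bound (2 ^ u) (S u))%:R.
have lam0 u : 0 < lam u.
  by rewrite mulr_gt0 ?exprn_gt0 // ltr0n /mean_bound muln_gt0 !expn_gt0 !muln_gt0.
pose bad (Z : 'M[int]_(m, d)) u : set 'M[R]_(m, d) :=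
  [set L : 'M[R]_(m, d) | (forall i j, (Z i j)%:~R <= L i j < (Z i j)%:~R + 1) /\
           lam u < koksma (2 ^ u) (2 ^ (S u)) L].
pose A n : set 'M[R]_(m, d) := if @pickle_inv 'M[int]_(m, d) n is Some Z then
  [set L : 'M[R]_(m, d) | forall u0, exists2 u, (u0 <= u)%N & bad Z u L] else set0.
apply: (@outer_le_sub _ _ _ _ (\bigcup_n A n)); last first.
  apply: null_bigcup => // n e' e'0; rewrite /A; case: pickle_inv => [Z|].
    apply: (@null_limsup _ _ _ m0 d0 (bad Z) q^-1) => //.
      by rewrite invr_gt0 q0 invf_lt1.
    move=> u; have := koksma_tail Z (2 ^ u) (S u) (lam0 u).
    suff -> : (mean_bound (2 ^ u) (S u))%:R / lam u = q^-1 ^+ u by [].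
    rewrite /lam invfM mulrCA mulfV ?mulr1 ?exprVn //.
    by have := lam0 u; rewrite /lam pmulr_rgt0 ?exprn_gt0 // => /gt_eqF ->.
  apply: (outer_le_finite m0 d0 (I := 'I_0) (P := xpredT)
     (a := fun=> 0) (b := fun=> 0)) => //.
  by rewrite big_ord0 ltW.
move=> L notgood; pose Z : 'M[int]_(m, d) := \matrix_(i, j) Num.floor (L i j).
exists (choice.pickle Z) => //; rewrite /A pickleK_inv => u0.
apply: contrapT => none; apply: notgood; exists u0 => u u0u.
rewrite leNgt; apply/negP => big; apply: none; exists u => //; split=> // i j.
by rewrite mxE; exact: floor_bounds.
Qed.

End GoodMatrices.

(** * Discrepancy *)

Section Discrepancy.
Context {R : realType} {m d : nat}.
Implicit Types (L : 'M[R]_(m, d)) (A : set R).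

(* The endpoints may or may not belong to [A]. *)
Definition interval_between A (a b : R) : Prop :=
  [/\ 0 <= a, a <= b, b <= 1, forall x, A x -> a <= x <= b
    & forall x, a < x < b -> A x].

(** Uniformity in [sg] makes the final rate uniform in [s] and [y]; uniformity in the boxes makes it
    uniform in [Omega] and [r]. *)
Definition discrepancy_le L (eps C : R) : Prop :=
  forall N (sg : 'I_m -> R) (A : 'I_m -> set R) (a b : 'I_m -> R), (0 < N)%N ->
    (forall i, interval_between (A i) (a i) (b i)) ->
    `|hits L sg N A - N.*2.+1%:R ^+ d * \prod_i (b i - a i)| <=
      C * log1 (N%:R : R) `^ ((d + m)%:R + eps).

Lemma prod_shift_le (n : nat) (x : 'I_n -> R) (t : R) :
  (forall i, 0 <= x i <= 1) -> 0 <= t <= 4 ->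
  \prod_i (x i + t) <= \prod_i x i + n%:R * 5 ^+ n * t.
Proof.
elim: n x => [|n ih] x x01 t04; first by rewrite !big_ord0 !mul0r addr0.
rewrite !big_ord_recl; set y := fun i => x (lift ord0 i).
have := ih y (fun i => x01 _) t04; set P := \prod_i y i; set P' := \prod_i (y i + t).
have P'5 : 0 <= P' <= 5 ^+ n.
  have y01 i : 0 <= y i <= 1 by exact: x01.
  rewrite prodr_ge0 => [|i _]; last by have := y01 i; lra.
  have -> : 5 ^+ n = \prod_(i < n) 5 :> R by rewrite prodr_const card_ord.
  by apply: ler_prod => i _; have := y01 i; lra.
move=> le; have := x01 ord0; set x0 := x ord0 => x001.
have n0 : 0 <= n%:R * 5 ^+ n :> R by rewrite mulr_ge0 ?exprn_ge0.
have p5 : 0 <= 5 ^+ n :> R by rewrite exprn_ge0.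
rewrite -[n.+1%:R]natr1 exprS; set c := n%:R * 5 ^+ n in le n0 *.
have -> : (n%:R + 1) * (5 * 5 ^+ n) = 5 * c + 5 * 5 ^+ n :> R by rewrite /c; ring.
have : x0 * P' <= x0 * (P + c * t) by apply: ler_wpM2l => //; lra.
have : x0 * (c * t) <= c * t by rewrite ler_piMl ?mulr_ge0 //; lra.
have : t * P' <= t * 5 ^+ n by apply: ler_wpM2l; lra.
have : 0 <= t * 5 ^+ n by rewrite mulr_ge0 //; lra.
have : 0 <= c * t by rewrite mulr_ge0 //; lra.
lra.
Qed.

Lemma forall_prodr (I : finType) (P : pred I) :
  [forall i, P i]%:R = \prod_i (P i)%:R :> R.
Proof.
case: forallP => [h|nall].
  by rewrite big1 // => i _; rewrite h.
have [i /negPf Pi] : exists i, ~~ P i.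
  by apply/existsP; rewrite -negb_forall; apply/forallP.
by rewrite (bigD1 i) //= Pi mul0r.
Qed.

(** Together with [A] these partition [[0, 1]] exactly: the condition [~ A x] settles the
    endpoints. *)
Definition below A (a : R) : set R := [set x | 0 <= x <= a /\ ~ A x].
Definition above A (a : R) : set R := [set x | a < x <= 1 /\ ~ A x].

Lemma frac_itv (x : R) : 0 <= frac x < 1.
Proof. by have := floor_bounds x; rewrite /frac; lra. Qed.

(* The complement of a box in the torus is a union of [3 ^ m - 1] boxes, so the
   one-sided bound for all boxes is two-sided. *)
Lemma hits_two_sided L (sg : 'I_m -> R) N (A : 'I_m -> set R) (a b : 'I_m -> R) (D : R) :
  (forall (A : 'I_m -> set R) (a b : 'I_m -> R),
    (forall i, interval_between (A i) (a i) (b i)) ->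
    hits L sg N A <= N.*2.+1%:R ^+ d * \prod_i (b i - a i) + D) ->
  (forall i, interval_between (A i) (a i) (b i)) -> 0 <= D ->
  `|hits L sg N A - N.*2.+1%:R ^+ d * \prod_i (b i - a i)| <= (3 ^ m)%:R * D.
Proof.
move=> upper ivlA D0.
pose B i (t : 'I_3) : set R := if t == 0 then A i else if t == 1 then below (A i) (a i)
  else above (A i) (a i).
pose lo i (t : 'I_3) : R := if t == 0 then a i else if t == 1 then 0 else b i.
pose hi i (t : 'I_3) : R := if t == 0 then b i else if t == 1 then a i else 1.
have ivlB i t : interval_between (B i t) (lo i t) (hi i t).
  have [a0 ab b1 Aab abA] := ivlA i; rewrite /B /lo /hi.
  case: ifP => _; first by [].
  case: ifP => _; split; rewrite ?lexx //; try lra.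
  - by move=> x [].
  - move=> x xa; split; first by lra.
    by move=> /Aab; lra.
  - move=> x [/andP[ax x1] nA]; rewrite x1 andbT leNgt; apply/negP => xb.
    by apply: nA; apply: abA; rewrite ax.
  - move=> x xb; split; first by lra.
    by move=> /Aab; lra.
have ord3 (F : 'I_3 -> R) : \sum_t F t = F 0 + F 1 + F (inord 2).
  rewrite !big_ord_recl big_ord0 addr0 addrA; congr (F _ + F _ + F _); apply: val_inj => //=.
  by rewrite inordK.
have B2 i : B i (inord 2) = above (A i) (a i).
  by rewrite /B -!val_eqE /= inordK.
pose type := {ffun 'I_m -> 'I_3}.
(* Hits of all boxes add up to the number of orbit points and volumes to 1, so upper bounds for the
   other boxes give a lower bound for [A]. *)
have total : \sum_(s : type) hits L sg N (fun i => B i (s i)) = N.*2.+1%:R ^+ d.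
  rewrite exchange_big /=.
  have one (p : {ffun 'I_d -> 'I_N.*2.+1}) :
      \sum_(s : type) [forall i, frac (orbit L sg p i) \in B i (s i)]%:R = 1 :> R.
    under eq_bigr do rewrite forall_prodr.
    rewrite -(bigA_distr_bigA (fun i t => (frac (orbit L sg p i) \in B i t)%:R)).
    apply: big1 => i _; rewrite ord3 B2.
    have := frac_itv (orbit L sg p i); set x := frac _ => /andP[x0 x1].
    rewrite /B eqxx /=; have [xA|xA] := pselect (A i x).
      by rewrite mem_set // !memNset ?addr0 // => -[].
    have [xa|ax] := leP x (a i).
      have xB : below (A i) (a i) x by split=> //; rewrite x0.
      have xN : ~ above (A i) (a i) x by move=> [/andP[]]; rewrite ltNge xa.
      by rewrite memNset // mem_set // memNset // addr0 add0r.
    have xB : above (A i) (a i) x by split=> //; rewrite ax ltW.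
    have xN : ~ below (A i) (a i) x by move=> [/andP[_]]; rewrite leNgt ax.
    by rewrite memNset // memNset // mem_set // !add0r.
  under eq_bigr do rewrite one.
  by rewrite sumr_const card_ffun !card_ord natrX.
have vol : \sum_(s : type) \prod_i (hi i (s i) - lo i (s i)) = 1.
  rewrite -(bigA_distr_bigA (fun i t => hi i t - lo i t)) big1 // => i _.
  rewrite ord3 /hi /lo -!val_eqE /= inordK //=; ring.
have cardT : #|{: type}| = (3 ^ m)%N by rewrite card_ffun !card_ord.
pose s0 : type := [ffun=> 0].
have s0E : hits L sg N (fun i => B i (s0 i)) = hits L sg N A.
  by congr hits; apply/funext => i; rewrite /B ffunE eqxx.
have v0E : \prod_i (hi i (s0 i) - lo i (s0 i)) = \prod_i (b i - a i).
  by apply: eq_bigr => i _; rewrite /hi /lo ffunE eqxx.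
have M1 : 1 <= (3 ^ m)%:R :> R by rewrite ler1n expn_gt0.
rewrite ler_norml; apply/andP; split; last first.
  by have := upper A a b ivlA; have := ler_wpM2r D0 M1; lra.
have up (s : type) := upper _ _ _ (fun i => ivlB i (s i)).
move: total vol; rewrite (bigD1 s0) // [in X in _ -> X -> _](bigD1 s0) //= s0E v0E.
set U := \sum_(_ | _) _ => total; set V := \sum_(_ | _) _ => vol.
have : U <= N.*2.+1%:R ^+ d * V + (3 ^ m)%:R * D.
  apply: le_trans (ler_sum _ (fun s _ => up s)) _.
  rewrite big_split -mulr_sumr lerD2l sumr_const -[leLHS]mulr_natl ler_wpM2r //.
  by rewrite ler_nat -cardT max_card.
have -> : V = 1 - \prod_i (b i - a i).
  by apply/eqP; rewrite eq_sym subr_eq addrC; apply/eqP; rewrite vol.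
by rewrite -total; lra.
Qed.

End Discrepancy.

Section GoodDiscrepancy.
Context {R : realType} {m d : nat}.
Hypotheses (m0 : (0 < m)%N) (d0 : (0 < d)%N).

Lemma koksma_ge0 (T H : nat) (L : 'M[R]_(m, d)) : 0 <= koksma T H L.
Proof.
apply: sumr_ge0 => f _; apply: mulr_ge0; apply: prodr_ge0 => i _.
  exact: wt_ge0.
exact: layer_ge0.
Qed.

Definition boundary_error : R := 3 ^+ d * (m%:R * 5 ^+ m * 4).

(** With [G = 2 ^ (T * d)] the smoothing loss, of order [N ^ d / G], is bounded, while [H = G ^ 3]
    still has logarithm proportional to [T]. *)
Lemma hits_scale (L : 'M[R]_(m, d)) (sg : 'I_m -> R) (N T : nat)
    (A : 'I_m -> set R) (a b : 'I_m -> R) :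
  (0 < N <= 2 ^ T)%N -> (forall i, interval_between (A i) (a i) (b i)) ->
  `|hits L sg N A - N.*2.+1%:R ^+ d * \prod_i (b i - a i)| <=
    (3 ^ m)%:R * (boundary_error + 5 ^+ m * koksma T (2 ^ (3 * (T * d))) L).
Proof.
move=> /andP[N0 NT] ivlA; pose G := (2 ^ (T * d))%N.
have G0 : (0 < G)%N by rewrite expn_gt0.
have GR : 0 < G%:R :> R by rewrite ltr0n.
have HG : (2 ^ (3 * (T * d)))%N = (G ^ 3)%N by rewrite /G -expnM mulnC.
apply: hits_two_sided ivlA _; last first.
  by rewrite addr_ge0 ?mulr_ge0 ?exprn_ge0 ?koksma_ge0.
move=> {A a b} A a b ivlA.
have N3 : (N.*2.+1 <= 3 * 2 ^ T)%N by lia.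
apply: le_trans (hits_upper L sg G0 N3 (a := a) (b := b) _ _) _.
- by move=> i; have [] := ivlA i.
- by move=> i; have [] := ivlA i.
rewrite HG addrA lerD2r.
have t4 : 0 <= (4 / G%:R : R) <= 4.
  by rewrite divr_ge0 //= ler_pdivrMr // ler_peMr // ler1n.
have x01 i : 0 <= b i - a i <= 1 by have [] := ivlA i; lra.
have NR : 0 <= N.*2.+1%:R ^+ d :> R by rewrite exprn_ge0.
apply: le_trans (ler_wpM2l NR (prod_shift_le x01 t4)) _.
rewrite mulrDr lerD2l.
have N3G : N.*2.+1%:R ^+ d <= 3 ^+ d * G%:R :> R.
  rewrite /G expnM natrX -exprMn lerXn2r ?nnegrE ?mulr_ge0 //.
  by rewrite -natrM ler_nat.
apply: le_trans (ler_wpM2r _ N3G) _.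
  by rewrite !mulr_ge0 ?exprn_ge0 // invr_ge0 ltW.
rewrite /boundary_error le_eqVlt; apply/orP; left; apply/eqP; field.
by rewrite gt_eqF.
Qed.

Lemma mean_bound_le (T : nat) : (0 < T)%N ->
  (mean_bound (m := m) (d := d) T (3 * (T * d)) <=
   (8 * d) ^ m * 48 ^ d * T ^ (d + m))%N.
Proof.
move=> T0; rewrite /mean_bound addnC expnD mulnACA -!expnMn.
by apply: leq_mul; rewrite leq_exp2r //; nia.
Qed.

(** Take the least admissible [u]. If [u > u0], minimality gives [2 ^ 2 ^ (u - 1) < N], hence
    [2 ^ u <= 2 ln N / ln 2]; the summand [2 ^ u0] covers [u = u0]. *)
Lemma scale_of (u0 : nat) (N : nat) : (0 < N)%N ->
  exists u, [/\ (u0 <= u)%N, (N <= 2 ^ 2 ^ u)%N &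
    (2 ^ u)%:R <= (2 ^+ u0 + 2 / ln 2) * log1 (N%:R : R)].
Proof.
move=> N0; have ln2 : 0 < ln 2 :> R by rewrite ln_gt0 // ltr1n.
have log1_1 : 1 <= log1 (N%:R : R) by rewrite /log1 le_max lexx.
have c0 : 0 <= 2 / ln 2 :> R by rewrite divr_ge0 // ltW.
have ex : exists u, (u0 <= u)%N && (N <= 2 ^ 2 ^ u)%N.
  exists (u0 + N)%N; rewrite leq_addr /=.
  have h k : (k <= 2 ^ k)%N by exact: ltnW (ltn_expl k (isT : 1 < 2)%N).
  apply: leq_trans (h N) _; rewrite leq_exp2l //.
  by apply: leq_trans (h N) _; rewrite leq_exp2l // leq_addl.
case: (ex_minnP ex) => u /andP[u0u Nu] umin; exists u; split=> //.
have [->|u0ltu] := eqVneq u u0.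
  rewrite natrX mulrDl; apply: le_trans (_ : 2 ^+ u0 * 1 <= _).
    by rewrite mulr1.
  apply: le_trans (ler_wpM2l _ log1_1) _; first exact: exprn_ge0.
  by rewrite lerDl mulr_ge0 // (le_trans ler01).
case: u u0u Nu umin u0ltu => [|u] u0u Nu umin u0ltu.
  by move: u0u u0ltu; rewrite leqn0 eq_sym => ->.
have big : (2 ^ 2 ^ u < N)%N.
  rewrite ltnNge; apply/negP => Nsmall.
  have u0u' : (u0 <= u)%N by rewrite -ltnS ltn_neqAle eq_sym u0ltu.
  by have := umin u; rewrite u0u' Nsmall ltnn => /(_ isT).
have lnN : (2 ^ u)%:R * ln 2 <= ln N%:R :> R.
  rewrite mulr_natl -lnXn // -natrX ler_ln ?posrE ?ltr0n ?expn_gt0 //.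
  by rewrite ler_nat ltnW.
have lnlog : ln N%:R <= log1 (N%:R : R) by rewrite /log1 le_max lexx orbT.
rewrite mulrDl; apply: le_trans (_ : 2 / ln 2 * log1 N%:R <= _); last first.
  by rewrite lerDr mulr_ge0 ?exprn_ge0 // (le_trans ler01).
rewrite mulrAC ler_pdivlMr // expnS natrM -mulrA ler_pM2l //.
exact: le_trans lnN lnlog.
Qed.

(** The ratio [2 powR eps] is chosen so that its power [u] equals [2 ^ u] to the power [eps], which
    is of order [(log N) ^ eps]. *)
Lemma good_discrepancy (L : 'M[R]_(m, d)) (eps : R) : 0 < eps ->
  good_matrix (2 `^ eps) L -> exists2 C : R, 0 < C & discrepancy_le L eps C.
Proof.
move=> eps0 [u0 good].
pose c1 : R := (3 ^ m)%:R * (boundary_error + 5 ^+ m * ((8 * d) ^ m * 48 ^ d)%:R).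
pose c2 : R := 2 ^+ u0 + 2 / ln 2.
have ex0 : 0 <= (d + m)%:R + eps by rewrite addr_ge0 // ltW.
have be0 : 0 <= boundary_error by rewrite !mulr_ge0 ?exprn_ge0.
have c10 : 0 < c1.
  rewrite mulr_gt0 ?ltr0n ?expn_gt0 // ltr_wpDl // mulr_gt0 ?exprn_gt0 //.
  by rewrite ltr0n !muln_gt0 !expn_gt0 muln_gt0 d0.
have ln2 : 0 < ln 2 :> R by rewrite ln_gt0 // ltr1n.
have c20 : 0 < c2 by rewrite addr_gt0 ?exprn_gt0 ?divr_gt0.
exists (c1 * c2 `^ ((d + m)%:R + eps)); first by rewrite mulr_gt0 ?powR_gt0.
move=> N sg A a b N0 ivlA; have [u [u0u Nu ulog]] := scale_of u0 N0.
have NT : (0 < N <= 2 ^ 2 ^ u)%N by rewrite N0.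
apply: le_trans (hits_scale L sg NT ivlA) _.
have log0 : 0 <= log1 (N%:R : R) by rewrite /log1 le_max ler01.
have T1 : 1 <= (2 ^ u)%:R :> R by rewrite ler1n expn_gt0.
rewrite -mulrA -powRM ?(ltW c20) //.
apply: le_trans (_ : c1 * (2 ^ u)%:R `^ ((d + m)%:R + eps) <= _); last first.
  apply: ler_wpM2l; first exact: ltW.
  by apply: ge0_ler_powR; rewrite ?nnegrE ?mulr_ge0 ?(ltW c20).
have -> : (2 ^ u)%:R `^ ((d + m)%:R + eps) = (2 `^ eps) ^+ u * (2 ^ u)%:R ^+ (d + m) :> R.
  rewrite powRD; last by apply/implyP => _; rewrite gt_eqF // (lt_le_trans ltr01).
  rewrite powR_mulrn // mulrC; congr (_ * _).
  have -> : (2 ^ u)%:R = 2 `^ u%:R :> R by rewrite natrX powR_mulrn.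
  by rewrite -powRrM mulrC powRrM powR_mulrn // powR_ge0.
rewrite /c1 -[leRHS]mulrA; apply: ler_wpM2l => //.
have q1 : 1 <= (2 `^ eps) ^+ u :> R.
  apply: exprn_ege1; have : 2 `^ 0 <= 2 `^ eps :> R.
    by apply: ler_powR; rewrite ?ler1n // ltW.
  by rewrite powRr0.
set X := _ ^+ u * _.
have X1 : 1 <= X by rewrite mulr_ege1 // exprn_ege1.
rewrite mulrDl; apply: lerD; first by rewrite ler_peMr.
rewrite -mulrA; apply: ler_wpM2l; first exact: exprn_ge0.
apply: le_trans (good u u0u) _.
rewrite /X mulrCA; apply: ler_wpM2l; first by rewrite exprn_ge0 // powR_ge0.
by rewrite -natrX -natrM ler_nat; apply: mean_bound_le; rewrite expn_gt0.
Qed.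

End GoodDiscrepancy.

(** * Geometry of the slice and of the projections *)

Lemma mx_norm_le (R : realType) (n1 n2 : nat) (x : 'M[R]_(n1, n2)) (c : R) :
  0 <= c -> (forall i j, `|x i j| <= c) -> `|x| <= c.
Proof.
move=> c0 xc; rewrite -[Num.norm _]/(mx_norm _) mx_normrE.
by apply: bigmax_le => // -[i j] _; exact: xc.
Qed.

Lemma coord_le_mx_norm (R : realType) (n1 n2 : nat) (x : 'M[R]_(n1, n2)) i j :
  `|x i j| <= `|x|.
Proof.
rewrite -[leRHS]/(mx_norm _) mx_normrE.
exact: (le_bigmax _ (fun ij => `|x ij.1 ij.2|) (i, j)).
Qed.

Section Spaces.
Context {R : realType} {d m : nat}.
Local Notation Rk := 'cV[R]_(d + m).
Implicit Types (L : 'M[R]_(m, d)) (F : {vspace Rk}) (v : Rk).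

Definition graph_map L (x : 'cV[R]_d) : Rk := col_mx x (L *m x).

Lemma graph_map_linear L : linear (graph_map L).
Proof.
move=> a x y; rewrite /graph_map mulmxDr -scalemxAr.
by rewrite scale_col_mx add_col_mx.
Qed.
HB.instance Definition _ L :=
  GRing.isLinear.Build R 'cV[R]_d Rk *:%R (graph_map L) (graph_map_linear L).

Definition fibre_map (z : 'cV[R]_m) : Rk := col_mx 0 z.

Lemma fibre_map_linear : linear fibre_map.
Proof. by move=> a x y; rewrite /fibre_map scale_col_mx add_col_mx scaler0 addr0. Qed.
HB.instance Definition _ :=
  GRing.isLinear.Build R 'cV[R]_m Rk *:%R fibre_map fibre_map_linear.

Lemma physical_spaceP L v :
  reflect (dsubmx v = L *m usubmx v) (v \in physical_space L).
Proof.
rewrite /physical_space -[linfun _]/(linfun (graph_map L)).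
apply: (iffP memv_imgP) => [[x _ ->]|h].
  by rewrite lfunE /= /graph_map col_mxKd col_mxKu.
by exists (usubmx v); rewrite ?memvf // lfunE /= /graph_map -h vsubmxK.
Qed.

Lemma graph_map_physical L x : graph_map L x \in physical_space L.
Proof. by apply/physical_spaceP; rewrite /graph_map col_mxKd col_mxKu. Qed.

Lemma reference_spaceP v : reflect (usubmx v = 0) (v \in @reference_space R d m).
Proof.
rewrite /reference_space -[linfun _]/(linfun fibre_map).
apply: (iffP memv_imgP) => [[x _ ->]|h].
  by rewrite lfunE /= /fibre_map col_mxKu.
by exists (dsubmx v); rewrite ?memvf // lfunE /= /fibre_map -h vsubmxK.
Qed.

(** The coordinates of [v] modulo [E], independent of the internal space. *)
Definition star L v : 'cV[R]_m := dsubmx v - L *m usubmx v.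

Lemma starD L v w : star L (v + w) = star L v + star L w.
Proof. by rewrite /star !linearD /= -addrACA. Qed.

Lemma star_fibre L z : star L (fibre_map z) = z.
Proof. by rewrite /star /fibre_map col_mxKd col_mxKu mulmx0 subr0. Qed.

Lemma star_physical L v : v \in physical_space L -> star L v = 0.
Proof. by move=> /physical_spaceP h; rewrite /star h subrr. Qed.

Lemma graph_fibre L v : v = graph_map L (usubmx v) + fibre_map (star L v).
Proof.
by rewrite /graph_map /fibre_map /star add_col_mx addr0 addrC subrK vsubmxK.
Qed.

Lemma rhoE L v : rho L v = graph_map L (usubmx v).
Proof.
have cap0 : (physical_space L :&: reference_space = 0)%VS.
  apply/eqP; rewrite -subv0; apply/subvP => w; rewrite memv_cap memv0.
  move=> /andP[/physical_spaceP h /reference_spaceP w0].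
  by rewrite -[w]vsubmxK h w0 mulmx0 col_mx0.
have ref_fibre z : fibre_map z \in @reference_space R d m.
  by apply/reference_spaceP; rewrite /fibre_map col_mxKu.
rewrite /rho [in LHS](graph_fibre L v) linearD /=.
rewrite daddv_pi_id ?graph_map_physical //.
have := daddv_pi_add cap0 (_ : fibre_map (star L v) \in _).
rewrite [daddv_pi reference_space _ _]daddv_pi_id 1?capvC //.
move=> /(_ (subvP (addvSr _ _) _ (ref_fibre _))) /(canRL (addrK _)).
by rewrite subrr => ->; rewrite addr0.
Qed.

Section Admissible.
Variables (L : 'M[R]_(m, d)) (F : {vspace Rk}).
Local Notation E := (physical_space L).
Hypothesis adm : admissible E F.

Lemma proj_piD v w : proj_pi L F (v + w) = proj_pi L F v + proj_pi L F w.
Proof. exact: linearD. Qed.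

Lemma proj_pi_mem v : proj_pi L F v \in E.
Proof. exact: memv_pi. Qed.

Lemma proj_pi_graph v :
  proj_pi L F v = graph_map L (usubmx v) + proj_pi L F (fibre_map (star L v)).
Proof.
rewrite {1}(graph_fibre L v) proj_piD; congr (_ + _).
by case: adm => cap0 _ _; apply: daddv_pi_id; rewrite ?graph_map_physical.
Qed.

Lemma proj_pi_star v : proj_pi L F v + proj_star L F v = v.
Proof. by case: adm => cap0 full _; apply: daddv_pi_add; rewrite ?full ?memvf. Qed.

(** The window and the unit cube of the reference space differ by vectors of [E], so the slice does
    not depend on [F]. *)
Lemma sliceP v : slice L F v <-> forall i, 0 <= star L v i 0 <= 1.
Proof.
split=> [[w [z z01 <-] [x /= xE <-]] i|v01].
  have -> : star L (proj_star L F (fibre_map z) + x) = z; last exact: z01.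
  rewrite starD (star_physical xE) addr0.
  have := congr1 (star L) (proj_pi_star (fibre_map z)).
  by rewrite starD (star_physical (proj_pi_mem _)) add0r star_fibre.
exists (proj_star L F (fibre_map (star L v))); first by exists (star L v).
exists (graph_map L (usubmx v) + proj_pi L F (fibre_map (star L v))) => /=.
  by rewrite memvD ?graph_map_physical ?proj_pi_mem.
by rewrite addrCA [X in _ + X]addrC proj_pi_star -graph_fibre.
Qed.

(** At a coordinate 0 or 1, arbitrarily small displacements along the reference space leave the
    slice, which makes [v] a boundary point. *)
Lemma regular_star s v : regular L F s -> lattice_translate s v -> slice L F v ->
  forall i, 0 < star L v i 0 < 1.
Proof.
move=> reg lat sl; have sv := (sliceP v).1 sl => i.
suff [n0 n1] : star L v i 0 != 0 /\ star L v i 0 != 1.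
  by rewrite !lt_neqAle eq_sym n0 n1 /=; exact: sv.
have push (c : R) : c != 0 -> (forall t, 0 < t -> ~~ (0 <= star L v i 0 + t * c <= 1)) ->
    False.
  move=> c0 out; suff : (boundary (slice L F) `&` lattice_translate s) v by rewrite reg.
  split=> //; split; first exact: subset_closure.
  move=> /nbhs_ballP[e /= e0 ball_slice].
  pose u := v + fibre_map ((e / 2 / `|c|) * c *: delta_mx i 0).
  have t0 : 0 < e / 2 / `|c| by rewrite !divr_gt0 ?normr_gt0.
  have : slice L F u.
    apply: ball_slice; rewrite mx_norm_ball /ball_ /= opprD addNKr normrN.
    apply: (@le_lt_trans _ _ (e / 2)); last lra.
    have tc : `|e / 2 / `|c| * c| = e / 2.
      by rewrite normrM gtr0_norm // mulfVK ?normr_eq0.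
    apply: mx_norm_le => [|j k]; first by lra.
    rewrite /fibre_map mxE; case: splitP => l _; rewrite !mxE ?normr0; first lra.
    by rewrite normrM tc; case: (_ && _); rewrite ?normr1 ?normr0; lra.
  have uE : star L u i 0 = star L v i 0 + e / 2 / `|c| * c.
    by rewrite starD star_fibre mxE; congr (_ + _); rewrite !mxE !eqxx mulr1.
  by move/sliceP/(_ i); rewrite uE; apply/negP; exact: out.
split; apply/negP => /eqP si.
  by apply: (push (-1)); rewrite ?oppr_eq0 ?oner_eq0 // => t t0; rewrite si; lra.
by apply: (push 1); rewrite ?oner_eq0 // => t t0; rewrite si; lra.
Qed.

End Admissible.
End Spaces.

(** * Patch classes and acceptance regions *)

Lemma card_fset_set_image (I : finType) (T : choiceType) (g : I -> T) (P : pred I) :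
  injective g -> #|` fset_set [set g i | i in [set i | P i]] | = #|[pred i | P i]|.
Proof.
move=> gI; pose s := [seq g i | i <- enum [pred i | P i]].
have -> : [set g i | i in [set i | P i]] = [set` [fset x in s]%fset].
  apply/seteqP; split=> [_ [i Pi <-]|x] /=.
    rewrite !inE; suff : g i \in s by [].
    by apply/mapP; exists i; rewrite // mem_enum inE.
  by rewrite !inE => /mapP[k]; rewrite mem_enum inE => Pk ->; exists k.
rewrite set_fsetK card_fseq undup_id ?map_inj_uniq ?enum_uniq //.
by rewrite size_map cardE.
Qed.

Section Lattice.
Context {R : realType} {d m : nat}.
Local Notation Rk := 'cV[R]_(d + m).

Definition nvec (p : 'cV[int]_d) (q : 'cV[int]_m) : Rk :=
  col_mx (map_mx intr p) (map_mx intr q).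

Lemma nvec_inj p q p' q' : nvec p q = nvec p' q' -> p = p' /\ q = q'.
Proof.
have inj n : injective (map_mx (intr : int -> R) : 'cV[int]_n -> 'cV[R]_n).
  move=> x y /matrixP e; apply/matrixP => i j; have := e i j.
  by rewrite !mxE => /intr_inj.
by move=> /eq_col_mx [/inj -> /inj ->].
Qed.

Lemma ZkP (v : Rk) : Zk v <-> exists p q, v = nvec p q.
Proof.
split=> [vZ|[p [q ->]] i]; last first.
  by rewrite /nvec mxE; case: splitP => j _; rewrite mxE intr_int.
exists (\col_j Num.floor (usubmx v j 0)), (\col_i Num.floor (dsubmx v i 0)).
rewrite -[LHS]vsubmxK /nvec; congr col_mx; apply/colP => i; rewrite !mxE floorK //;
  exact: vZ.
Qed.

Lemma nvecB p q p' q' : nvec p q - nvec p' q' = nvec (p - p') (q - q').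
Proof.
rewrite /nvec opp_col_mx add_col_mx; congr col_mx;
  by apply/colP => i; rewrite !mxE intrD mulrNz.
Qed.

Lemma ZkB (v w : Rk) : Zk v -> Zk w -> Zk (v - w).
Proof.
move=> /ZkP [p [q ->]] /ZkP [p' [q' ->]]; rewrite nvecB.
by apply/ZkP; exists (p - p'), (q - q').
Qed.

Section Cells.
Variables (L : 'M[R]_(m, d)).
Implicit Types (w : 'cV[R]_m) (p : 'cV[int]_d) (q : 'cV[int]_m).

(** Seen from a point with coordinates [w] modulo [E], the unique [q] for which the displacement
    [(p, q)] ends in the half-open slice. *)
Definition cell (w : 'cV[R]_m) (p : 'cV[int]_d) : 'cV[int]_m :=
  \col_i (- Num.floor (w i 0 - (L *m map_mx intr p) i 0)).

Lemma star_nvec p q i :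
  star L (nvec p q) i 0 = (q i 0)%:~R - (L *m map_mx intr p) i 0.
Proof.
by rewrite /star /nvec col_mxKd col_mxKu mxE; congr (_ + _); rewrite [LHS]mxE.
Qed.

Lemma cellP w p q :
  (forall i, 0 <= w i 0 + star L (nvec p q) i 0 < 1) <-> q = cell w p.
Proof.
split=> [h|-> i].
  apply/colP => i; rewrite mxE; apply/eqP; rewrite -eqr_oppLR; apply/eqP.
  apply/esym/floor_def; have := h i.
  by rewrite star_nvec intrD mulrNz; lra.
rewrite star_nvec mxE mulrNz.
by have := floor_bounds (w i 0 - (L *m map_mx intr p) i 0); lra.
Qed.

Lemma star_cell w p i :
  w i 0 + star L (nvec p (cell w p)) i 0 = frac (w i 0 - (L *m map_mx intr p) i 0).
Proof. by rewrite star_nvec mxE mulrNz /frac; ring. Qed.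

End Cells.

Section Classes.
Variables (L : 'M[R]_(m, d)) (F : {vspace Rk}).
Hypothesis adm : admissible (physical_space L) F.
Implicit Types (s y v : Rk) (Om : set Rk) (t : patch_type).

Definition inside t Om (p : 'cV[int]_d) (q : 'cV[int]_m) : Prop :=
  match t with
  | type_I => Om (proj_pi L F (nvec p q))
  | type_II => Om (rho L (nvec p q))
  end.

(** Over each [p] a patch has at most one point, so equality of classes decouples over [p]; only
    those [p] count for which one of the two points is inside. *)
Definition same_class t Om (w w' : 'cV[R]_m) : Prop := forall p,
  inside t Om p (cell L w p) \/ inside t Om p (cell L w' p) ->
  cell L w p = cell L w' p.

Lemma lattice_translateB s v v' :
  lattice_translate s v -> lattice_translate s v' -> Zk (v - v').
Proof.
move=> [z zZ <-] [z' zZ' <-]; rewrite opprD addrACA subrr addr0.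
exact: ZkB.
Qed.

Lemma lattice_translateD s v z :
  lattice_translate s v -> Zk z -> lattice_translate s (z + v).
Proof.
move=> [z' zZ' <-] zZ; exists (z + z'); last by rewrite addrA.
by rewrite -[z']opprK; apply: ZkB => // i; rewrite mxE rpredN; exact: zZ'.
Qed.

Lemma proj_pi_inj s v v' : lattice_translate s v -> lattice_translate s v' ->
  proj_pi L F v = proj_pi L F v' -> v = v'.
Proof.
case: adm => _ _ inj [z zZ <-] [z' zZ' <-]; rewrite !(proj_piD L F) => /addIr e.
by congr (_ + _); apply: inj; rewrite ?inE.
Qed.

Lemma lift_ptE s v : lattice_translate s v -> lift_pt L F s (proj_pi L F v) = v.
Proof.
move=> sv; rewrite /lift_pt; case: xgetP => [w _ [sw e]|/(_ v)[]//].
exact: proj_pi_inj sw sv e.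
Qed.

Lemma lift_ptP s y : cut_and_project L F s y ->
  [/\ lattice_translate s (lift_pt L F s y), slice L F (lift_pt L F s y)
    & proj_pi L F (lift_pt L F s y) = y].
Proof. by move=> [v [slv sv] <-]; rewrite lift_ptE. Qed.

Lemma slice_cell v p : slice L F (nvec p (cell L (star L v) p) + v).
Proof.
apply/(sliceP adm) => i; rewrite starD mxE addrC.
by have := (cellP L (star L v) p _).2 erefl i; lra.
Qed.

(** Regularity excludes the coordinate 1, so closed and half-open slice agree on the lattice and the
    point over [p] is given by [cell]. *)
Lemma neighbourP s v v' : regular L F s -> lattice_translate s v ->
  lattice_translate s v' -> slice L F v' ->
  exists p, v' = nvec p (cell L (star L v) p) + v.
Proof.
move=> reg sv sv' slv'; have /ZkP[p [q e]] := lattice_translateB sv' sv.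
have e' : v' = nvec p q + v by rewrite -e subrK.
exists p; rewrite {1}e'; congr (nvec _ _ + _); apply/(cellP L) => i.
have := regular_star adm reg sv' slv' i.
by rewrite e' starD mxE addrC; lra.
Qed.

(** Removes [s] and [y]: the class is a function of [w] alone. *)
Lemma patch_classE t s y Om : regular L F s -> cut_and_project L F s y ->
  let w := star L (lift_pt L F s y) in
  patch_class L F t s y Om =
  [set proj_pi L F (nvec p (cell L w p)) | p in [set p | inside t Om p (cell L w p)]].
Proof.
move=> reg Yy w; have [sv slv vy] := lift_ptP Yy.
set v := lift_pt L F s y in w sv slv vy *.
have sn p : lattice_translate s (nvec p (cell L w p) + v).
  by apply: lattice_translateD => //; apply/ZkP; exists p, (cell L w p).
have diff p : proj_pi L F (nvec p (cell L w p) + v) - y =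
    proj_pi L F (nvec p (cell L w p)).
  by rewrite proj_piD vy addrK.
have memP y' : Defs.patch L F t s y Om y' <-> exists2 p,
    inside t Om p (cell L w p) & y' = proj_pi L F (nvec p (cell L w p) + v).
  have inE p : inside t Om p (cell L w p) <-> match t with
      | type_I => Om (proj_pi L F (nvec p (cell L w p) + v) - y)
      | type_II => Om (rho L (lift_pt L F s (proj_pi L F (nvec p (cell L w p) + v)) - v))
      end.
    by rewrite /inside diff lift_ptE // addrK; case: t.
  split=> [py'|[p /inE ip ->]].
    have [Yy' iny'] : cut_and_project L F s y' /\ match t with
      | type_I => Om (y' - y)
      | type_II => Om (rho L (lift_pt L F s y' - v)) end by case: t py' {inE} => -[].
    have [v' [slv' sv'] v'y] := Yy'.
    have [p e] := neighbourP reg sv sv' slv'.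
    by exists p; rewrite -?v'y ?e //; apply/inE; rewrite -e v'y.
  have Yp : cut_and_project L F s (proj_pi L F (nvec p (cell L w p) + v)).
    by exists (nvec p (cell L w p) + v) => //; split=> //; exact: slice_cell.
  by case: t ip {inE} => ip; split.
apply/seteqP; split=> [_ [y' /memP [p ip ->] <-]|_ [p ip <-]].
  by exists p => //; rewrite diff.
by exists (proj_pi L F (nvec p (cell L w p) + v)); [apply/memP; exists p|].
Qed.

(** Injectivity of the projection on the lattice recovers [(p, q)] from a patch point. *)
Lemma class_same t Om (w w' : 'cV[R]_m) :
  [set proj_pi L F (nvec p (cell L w p)) | p in [set p | inside t Om p (cell L w p)]] =
  [set proj_pi L F (nvec p (cell L w' p)) | p in [set p | inside t Om p (cell L w' p)]]
  <-> same_class t Om w w'.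
Proof.
have inj p q p' q' : proj_pi L F (nvec p q) = proj_pi L F (nvec p' q') ->
    p = p' /\ q = q'.
  case: adm => _ _ inj e; apply: nvec_inj; apply: inj e; rewrite inE; apply/ZkP.
    by exists p, q.
  by exists p', q'.
split=> [e p|e].
  case=> ip.
    have : [set proj_pi L F (nvec p (cell L w' p)) | p in
        [set p | inside t Om p (cell L w' p)]] (proj_pi L F (nvec p (cell L w p))).
      by rewrite -e; exists p.
    by move=> [p' _ /inj[-> <-]].
  have : [set proj_pi L F (nvec p (cell L w p)) | p in
      [set p | inside t Om p (cell L w p)]] (proj_pi L F (nvec p (cell L w' p))).
    by rewrite e; exists p.
  by move=> [p' _ /inj[-> <-]].
by apply/seteqP; split=> _ [p /= ip <-]; exists p;
  rewrite ?(e p (or_introl ip)) -?(e p (or_intror ip)) //=;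
  rewrite -?(e p (or_introl ip)) ?(e p (or_intror ip)).
Qed.

Definition cvec N (p : {ffun 'I_d -> 'I_N.*2.+1}) : 'cV[int]_d :=
  \col_j centred (p j).

Lemma cvec_inj N : injective (@cvec N).
Proof.
move=> p p' /colP e; apply/ffunP => j; have := e j.
by rewrite !mxE /centred => /addIr [] /val_inj.
Qed.

Lemma cvecP N (p : 'cV[int]_d) : (forall j, `|p j 0| <= N%:Z) ->
  exists p', p = @cvec N p'.
Proof.
move=> pN; exists [ffun j => inord (absz (p j 0 + N%:Z)%R)]; apply/colP => j.
by rewrite mxE ffunE /centred inordK; have := pN j; lia.
Qed.

Lemma cvec_le N (p : {ffun 'I_d -> 'I_N.*2.+1}) j : `|cvec p j 0| <= N%:Z.
Proof. by rewrite mxE /centred; have := ltn_ord (p j); lia. Qed.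

Definition shifted (w : 'cV[R]_m) N (p : {ffun 'I_d -> 'I_N.*2.+1}) : 'cV[R]_m :=
  \col_i frac (orbit L (fun i => w i 0) p i).

(** Every [p] in the box carries exactly one point of [Y], so the denominator is exactly
    [(2 N + 1) ^ d] and the numerator counts orbit points in the acceptance region. *)
Lemma patch_freqE t s y Om (w0 : 'cV[R]_m) (rad : R) :
  regular L F s -> cut_and_project L F s y -> 0 <= rad ->
  let N := Num.trunc rad in
  patch_freq L F t s Om
    [set proj_pi L F (nvec p (cell L w0 p)) | p in [set p | inside t Om p (cell L w0 p)]]
    y rad =
  (\sum_(p : {ffun 'I_d -> 'I_N.*2.+1})
     `[< same_class t Om (shifted (star L (lift_pt L F s y)) p) w0 >]%:R)
  / N.*2.+1%:R ^+ d.
Proof.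
move=> reg Yy rad0 N; have [sv slv vy] := lift_ptP Yy.
set v := lift_pt L F s y in sv slv vy *; set w := star L v.
set P0 := [set _ | _ in _].
pose nb (p : {ffun 'I_d -> 'I_N.*2.+1}) := nvec (cvec p) (cell L w (cvec p)) + v.
pose g p := proj_pi L F (nb p).
have snb p : lattice_translate s (nb p).
  by apply: lattice_translateD => //; apply/ZkP; eexists; eexists.
have gI : injective g.
  move=> p p' /(proj_pi_inj (snb p) (snb p')) /addIr /nvec_inj [+ _].
  exact: cvec_inj.
have starE p : star L (nb p) = shifted w p.
  apply/colP => i; rewrite starD [LHS]mxE addrC star_cell [RHS]mxE /orbit.
  congr (frac (_ - _)); rewrite mxE; apply: eq_bigr => j _.
  by rewrite [map_mx _ _ _ _]mxE [cvec _ _ _]mxE.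
have Yg p : cut_and_project L F s (g p).
  by exists (nb p) => //; split=> //; exact: slice_cell.
have boxP y' : cut_and_project L F s y' ->
    lattice_box rad (lift_pt L F s y' - v) <-> exists p, y' = g p.
  move=> [v' [slv' sv'] <-]; rewrite lift_ptE //.
  have [p e] := neighbourP reg sv sv' slv'.
  have coord j : (v' - v) (lshift m j) 0 = (p j 0)%:~R.
    by rewrite e addrK /nvec col_mxEu mxE.
  have /andP[N1 N2] : N%:R <= rad < N.+1%:R by exact: trunc_itv.
  split=> [[_ /= h]|[p' e']].
    have pN j : `|p j 0| <= N%:Z.
      rewrite -ltzD1 -(ltr_int R) intr_norm intrD -[N%:~R + _]/(N%:R + 1) natr1.
      apply: le_lt_trans N2.
      by rewrite ler_norml -coord; exact: h.
    by have [p' pE] := cvecP pN; exists p'; rewrite e /g /nb -pE.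
  split; first exact: lattice_translateB sv' sv.
  move=> j /=; rewrite -ler_norml; apply: le_trans N1.
  have -> : v' = nb p' by exact: proj_pi_inj sv' (snb p') e'.
  rewrite /nb addrK /nvec col_mxEu mxE -intr_norm -[N%:R]/((N%:Z)%:~R) ler_int.
  exact: cvec_le.
have classP p : patch_class L F t s (g p) Om = P0 <-> same_class t Om (shifted w p) w0.
  by rewrite patch_classE // lift_ptE // starE; exact: class_same.
rewrite /patch_freq -/v.
have -> : [set y' | [/\ cut_and_project L F s y', patch_class L F t s y' Om = P0
    & lattice_box rad (lift_pt L F s y' - v)]] =
  [set g p | p in [set p | `[< same_class t Om (shifted w p) w0 >] ]].
  apply/seteqP; split=> [y' [Yy' cl /(boxP _ Yy') [p e]]|_ [p /= /asboolP sp <-]].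
    by exists p => //=; apply/asboolP/classP; rewrite -e.
  by split=> //; [apply/classP | apply/(boxP _ (Yg p)); exists p].
have -> : [set y' | cut_and_project L F s y' /\ lattice_box rad (lift_pt L F s y' - v)] =
    [set g p | p in [set p | xpredT p]].
  apply/seteqP; split=> [y' [Yy' /(boxP _ Yy') [p e]]|_ [p _ <-]].
    by exists p.
  by split=> //; apply/(boxP _ (Yg p)); exists p.
rewrite !card_fset_set_image //; congr (_ / _).
  rewrite -sum1_card natr_sum big_mkcond /=.
  by apply: eq_bigr => p _; rewrite inE; case: asbool.
by rewrite -natrX (eq_card (B := predT)) // card_ffun !card_ord.
Qed.

End Classes.
End Lattice.

(** * From box decompositions to convergence rates *)

Section Rates.
Context {R : realType}.

Lemma log1_ge1 (x : R) : 1 <= log1 x.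
Proof. by rewrite /log1 le_max lexx. Qed.

Lemma log1_ge0 (x : R) : 0 <= log1 x.
Proof. exact: le_trans ler01 (log1_ge1 x). Qed.

Lemma log1_le (x y : R) : 0 < x -> x <= y -> log1 x <= log1 y.
Proof.
move=> x0 xy; have lxy : ln x <= ln y.
  by rewrite ler_ln ?posrE // (lt_le_trans x0).
by rewrite /log1 ge_max !le_max lexx lxy orbT.
Qed.

Lemma log1_powR_le (x y e : R) : 0 <= e -> 0 < x -> x <= y ->
  log1 x `^ e <= log1 y `^ e.
Proof.
by move=> e0 x0 xy; apply: ge0_ler_powR; rewrite ?nnegrE ?log1_ge0 ?log1_le.
Qed.

Lemma log1_powR_small (e eta : R) : 0 <= e -> 0 < eta ->
  \forall x \near +oo, log1 x `^ e <= eta * x.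
Proof.
(* [dl * e <= 1 / 2], so bounding the logarithm by [x powR dl] bounds its power [e] by a multiple of
   the square root of [x]. *)
move=> e0 eta0; pose dl : R := (2 * (e + 1))^-1.
have e1 : 0 < e + 1 by lra.
have dl0 : 0 < dl by rewrite invr_gt0 mulr_gt0.
have dle : dl * e <= 1 / 2.
  by rewrite /dl mulrC ler_pdivrMr ?mulr_gt0 //; lra.
pose c : R := 1 + dl^-1; have c0 : 0 <= c by rewrite addr_ge0 // invr_ge0 ltW.
pose A := c `^ e; have A0 : 0 <= A by exact: powR_ge0.
exists (Num.max 1 ((A / eta) ^+ 2)); split; first exact: num_real.
move=> x; rewrite gt_max => /andP[x1 xA].
have x0 : 0 < x by apply: lt_trans x1.
have xd1 : 1 <= x `^ dl.
  have := ler_powR (ltW x1) (ltW dl0).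
  by rewrite powRr0.
have lnx : ln x <= dl^-1 * x `^ dl.
  rewrite mulrC ler_pdivlMr // mulrC -ln_powR; apply: ltW.
  by apply: ln_sublinear; rewrite powR_gt0.
have logx : log1 x <= c * x `^ dl.
  rewrite /log1 ge_max /c mulrDl mul1r; apply/andP; split.
    rewrite -[leLHS]addr0; apply: lerD => //.
    by rewrite mulr_ge0 ?powR_ge0 // invr_ge0 ltW.
  by rewrite -[leLHS]add0r lerD // powR_ge0.
have : log1 x `^ e <= A * x `^ (1 / 2).
  apply: le_trans (_ : (c * x `^ dl) `^ e <= _).
    by apply: ge0_ler_powR; rewrite ?nnegrE ?log1_ge0 ?mulr_ge0 ?powR_ge0.
  rewrite powRM ?powR_ge0 // -powRrM; apply: ler_wpM2l => //.
  by apply: ler_powR => //; exact: ltW.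
set y := x `^ (1 / 2); have yy : y ^+ 2 = x.
  rewrite expr2 -powRD; last by rewrite (gt_eqF x0) implybT.
  by rewrite -splitr powRr1 // ltW.
have y0 : 0 <= y by exact: powR_ge0.
move=> le; apply: le_trans le _; rewrite -[in leRHS]yy expr2 mulrA ler_wpM2r //.
rewrite mulrC -ler_pdivrMr // leNgt; apply/negP => ylt.
by move: xA; rewrite -yy ltNge lerXn2r // ?nnegrE ?divr_ge0 // ltW.
Qed.

Context {d m : nat}.
Local Notation Rk := 'cV[R]_(d + m).

(** Writing the indicator as a sum of indicators encodes covering and disjointness together and can
    be summed directly along the orbit. *)
Definition box_decomposition (Phi : 'cV[R]_m -> Prop) (K : nat) : Prop :=
  exists (J : finType) (B : J -> 'I_m -> set R) (a b : J -> 'I_m -> R),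
  [/\ (#|J| <= K)%N, forall j i, interval_between (B j i) (a j i) (b j i)
    & forall x : 'cV[R]_m, (forall i, 0 <= x i 0 < 1) ->
      `[< Phi x >]%:R = \sum_j [forall i, x i 0 \in B j i]%:R :> R].

(** The frequency is the total volume of the boxes; its being the limit follows from the rate
    itself, which tends to 0. *)
Lemma rate_of_boxes (L : 'M[R]_(m, d)) (F : {vspace Rk}) (eps C : R)
    (t : patch_type) (s y' : Rk) (Om : set Rk) (K : nat) :
  (0 < d)%N -> 0 < eps -> 0 < C -> discrepancy_le L eps C ->
  admissible (physical_space L) F -> regular L F s -> cut_and_project L F s y' ->
  box_decomposition
    (fun w => same_class L F t Om w (star L (lift_pt L F s y'))) K ->
  frequency_rate L F t s Om (patch_class L F t s y' Om)
    (fun rad => K%:R * C * (log1 rad `^ ((d + m)%:R + eps) / rad ^+ d)).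
Proof.
move=> d0 eps0 C0 disc adm reg Yy' [J [B [a [b [JK ivlB decomp]]]]].
have ex0 : 0 <= (d + m)%:R + eps by rewrite addr_ge0 // ltW.
rewrite (patch_classE adm _ _ reg Yy') /=.
set w0 := star L _ in decomp *; set P := [set _ | _ in _].
pose xi : R := \sum_j \prod_i (b j i - a j i).
have key s1 y1 rad : regular L F s1 -> cut_and_project L F s1 y1 -> 1 <= rad ->
    `|patch_freq L F t s1 Om P y1 rad - xi| <=
      K%:R * C * (log1 rad `^ ((d + m)%:R + eps) / rad ^+ d).
  move=> reg1 Yy1 rad1; have rad0 : 0 <= rad by apply: le_trans rad1.
  rewrite patch_freqE //; set N := Num.trunc rad; set w := star L _.
  have /andP[N1 N2] : N%:R <= rad < N.+1%:R by exact: trunc_itv.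
  have N0 : (0 < N)%N.
    by rewrite -ltnS -(ltr_nat R); apply: le_lt_trans N2.
  have M0 : 0 < N.*2.+1%:R ^+ d :> R by rewrite exprn_gt0 // ltr0n.
  pose sg i := w i 0.
  have -> : \sum_(p : {ffun 'I_d -> 'I_N.*2.+1})
      `[< same_class L F t Om (shifted L w p) w0 >]%:R = \sum_j hits L sg N (B j) :> R.
    rewrite exchange_big; apply: eq_bigr => p _; rewrite decomp => [|i].
      by apply: eq_bigr => j _; congr ((nat_of_bool _)%:R); apply: eq_forallb => i; rewrite mxE.
    by rewrite mxE frac_itv.
  have -> : (\sum_j hits L sg N (B j)) / N.*2.+1%:R ^+ d - xi =
      (\sum_j (hits L sg N (B j) - N.*2.+1%:R ^+ d * \prod_i (b j i - a j i))) /
        N.*2.+1%:R ^+ d.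
    by rewrite sumrB -mulr_sumr mulrBl [_ ^+ d * _]mulrC mulfK ?gt_eqF.
  rewrite normrM normfV (gtr0_norm M0) ler_pdivrMr //.
  apply: le_trans (ler_norm_sum _ _ _) _.
  apply: le_trans (_ : K%:R * (C * log1 (N%:R : R) `^ ((d + m)%:R + eps)) <= _).
    apply: le_trans (ler_sum _ (fun j _ => disc N sg (B j) (a j) (b j) N0 (ivlB j))) _.
    rewrite sumr_const -[leLHS]mulr_natl ler_wpM2r ?ler_nat //.
    by rewrite mulr_ge0 ?powR_ge0 // ltW.
  rewrite -!mulrA; apply: ler_wpM2l => //; apply: ler_wpM2l; first exact: ltW.
  have logN : log1 (N%:R : R) `^ ((d + m)%:R + eps) <= log1 rad `^ ((d + m)%:R + eps).
    by apply: log1_powR_le; rewrite // ltr0n.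
  apply: le_trans logN _; rewrite ler_peMr ?powR_ge0 //.
  have radN : rad <= N.*2.+1%:R.
    by apply: le_trans (ltW N2) _; rewrite ler_nat; lia.
  rewrite mulrC ler_pdivlMr ?exprn_gt0 ?(lt_le_trans ltr01) // mul1r.
  by rewrite lerXn2r ?nnegrE.
exists xi => [s1 y1 reg1 Yy1|y rad Yy rad1]; last exact: key.
apply/cvgrPdist_le => e e0.
pose A := K%:R * C + 1; have KC0 : 0 <= K%:R * C by rewrite mulr_ge0 // ltW.
have A0 : 0 < A by rewrite ltr_wpDl.
have small := log1_powR_small ex0 (divr_gt0 e0 A0).
near=> rad; have rad1 : 1 <= rad by near: rad; exact: nbhs_pinfty_ge.
have rad0 : 0 < rad by apply: lt_le_trans rad1.
rewrite distrC; apply: le_trans (key s1 y1 rad reg1 Yy1 rad1) _.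
have le1 : log1 rad `^ ((d + m)%:R + eps) <= e / A * rad by near: rad.
have radd : rad <= rad ^+ d by rewrite ler_eXnr.
have q0 : 0 <= log1 rad `^ ((d + m)%:R + eps) / rad ^+ d.
  by rewrite divr_ge0 ?powR_ge0 ?exprn_ge0 // ltW.
apply: le_trans (_ : A * (log1 rad `^ ((d + m)%:R + eps) / rad ^+ d) <= _).
  by rewrite ler_wpM2r // lerDl.
rewrite -ler_pdivlMl // [leRHS]mulrC ler_pdivrMr ?exprn_gt0 //.
apply: le_trans le1 _; rewrite ler_wpM2l ?divr_ge0 ?(ltW e0) ?(ltW A0) //.
Unshelve. all: by end_near.
Qed.

End Rates.

(** * Decomposition of acceptance regions into boxes *)

Section Boxes.
Context {R : realType} {d m : nat}.
Local Notation Rk := 'cV[R]_(d + m).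

Definition convex_unit (A : set R) : Prop :=
  (forall x, A x -> 0 <= x <= 1) /\
  (forall x y z, A x -> A z -> x <= y <= z -> A y).

Lemma convex_unit_between (A : set R) : convex_unit A ->
  interval_between A (inf A) (sup A).
Proof.
(* For the empty set [inf] and [sup] default to 0, a valid degenerate interval. *)
move=> [A01 Acvx]; have [->|/set0P[x0 Ax0]] := eqVneq A set0.
  by rewrite inf0 sup0; split=> // x; lra.
have hs : has_sup A.
  by split; [exists x0|exists 1 => x /A01/andP[]].
have hi : has_inf A.
  by split; [exists x0|exists 0 => x /A01/andP[]].
have ub x : A x -> x <= sup A by move=> Ax; apply: ub_le_sup => //; case: hs.
have lb x : A x -> inf A <= x by move=> Ax; apply: ge_inf => //; case: hi.
split.
- by apply: lb_le_inf; [exists x0|move=> x /A01/andP[]].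
- exact: le_trans (lb _ Ax0) (ub _ Ax0).
- by apply: ge_sup; [exists x0|move=> x /A01/andP[]].
- by move=> x Ax; rewrite lb ?ub.
move=> x /andP[ax xb].
have [y Ay yx] := inf_lt (ex_intro _ x0 Ax0) ax; have [z Az xz] := sup_gt (ex_intro _ x0 Ax0) xb.
by apply: Acvx Ay Az _; rewrite !ltW.
Qed.

Variables (L : 'M[R]_(m, d)) (F : {vspace Rk}).

(** Up to sign, a coordinate of [cell]; it depends on one coordinate of [w] only and is a
    nondecreasing step function. *)
Definition fl (p : 'cV[int]_d) (i : 'I_m) (x : R) : int :=
  Num.floor (x - (L *m map_mx intr p) i 0).

Lemma fl_le p i (x y : R) : x <= y -> fl p i x <= fl p i y.
Proof. by move=> xy; apply: le_floor; rewrite lerD2r. Qed.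

Lemma fl_lt p i (x y : R) : y < x + 1 -> fl p i y <= fl p i x + 1.
Proof.
move=> yx; rewrite /fl -ltzD1 -(ltr_int R) !intrD.
have := floor_bounds (x - (L *m map_mx intr p) i 0).
by have := floor_bounds (y - (L *m map_mx intr p) i 0); lra.
Qed.

Lemma cellE (w : 'cV[R]_m) p i : cell L w p i 0 = - fl p i (w i 0).
Proof. by rewrite mxE. Qed.

Lemma cell_eq (w w' : 'cV[R]_m) p :
  cell L w p = cell L w' p <-> forall i, fl p i (w i 0) = fl p i (w' i 0).
Proof.
split=> [/colP e i|e]; first by have := e i; rewrite !cellE => /oppr_inj.
by apply/colP => i; rewrite !cellE e.
Qed.

Lemma fl_between p i (x y z : R) : x <= y <= z -> fl p i x = fl p i z -> fl p i y = fl p i x.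
Proof.
move=> /andP[xy yz] e; apply/le_anti/andP; split; last by rewrite fl_le.
by rewrite e fl_le.
Qed.

(** [rho] depends on [p] alone, so the relevant [p] are known beforehand and the condition splits
    into one interval condition per coordinate. *)
Lemma type_II_boxes (Om : set Rk) (w0 : 'cV[R]_m) :
  box_decomposition (fun w => same_class L F type_II Om w w0) 1.
Proof.
pose B (i : 'I_m) : set R := [set x | 0 <= x < 1 /\
  forall p q, inside L F type_II Om p q -> fl p i x = fl p i (w0 i 0)].
have in_indep p q q' : inside L F type_II Om p q -> inside L F type_II Om p q'.
  by rewrite /= !rhoE /nvec !col_mxKu.
exists 'I_1, (fun=> B), (fun _ i => inf (B i)), (fun _ i => sup (B i)); split.
- by rewrite card_ord.
- move=> _ i; apply: convex_unit_between; split=> [x [] /andP[-> /ltW]//|x y z].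
  move=> [x01 hx] [z01 hz] xyz; split; first lra.
  move=> p q pq; rewrite -(hx p q pq); apply: fl_between xyz _.
  by rewrite (hx p q pq) (hz p q pq).
move=> x x01; rewrite big_ord1; congr ((nat_of_bool _)%:R).
apply/asboolP/forallP => [sx i|xB p ip].
  rewrite in_setE; split=> // p q pq.
  by have /cell_eq := sx p (or_introl (in_indep _ _ _ pq)); apply.
apply/cell_eq => i; have := xB i; rewrite in_setE => -[_ h].
by case: ip => /h.
Qed.

Lemma codim1_boxes (t : patch_type) (Om : set Rk) (w0 : 'cV[R]_m) : m = 1 ->
  box_decomposition (fun w => same_class L F t Om w w0) 1.
Proof.
move=> m1; have [i0 i0P] : exists i0 : 'I_m, forall i, i = i0.
  have m0 : (0 < m)%N by rewrite m1.
  exists (Ordinal m0) => i; apply: val_inj => /=.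
  by have := ltn_ord i; rewrite [X in (_ < X)%N]m1; case: (i : nat).
have cst (x : 'cV[R]_m) : const_mx (x i0 0) = x.
  by apply/colP => i; rewrite mxE (i0P i).
pose B : set R := [set x | 0 <= x < 1 /\ same_class L F t Om (const_mx x) w0].
exists 'I_1, (fun _ _ => B), (fun _ _ => inf B), (fun _ _ => sup B); split.
- by rewrite card_ord.
- move=> _ _; apply: convex_unit_between; split=> [x [] /andP[-> /ltW]//|x y z].
  move=> [x01 hx] [z01 hz] xyz; split; first lra.
  have cell_xyz p (u v : R) : fl p i0 u = fl p i0 v ->
      cell L (const_mx u) p = cell L (const_mx v) p.
    by move=> e; apply/cell_eq => i; rewrite !mxE (i0P i).
  have cell_fl p (u : R) (v : 'cV[R]_m) : cell L (const_mx u) p = cell L v p ->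
      fl p i0 u = fl p i0 (v i0 0).
    by move=> /cell_eq /(_ i0); rewrite mxE.
  (* As [z - x < 1], the value at [y] is the value at [x] or at [z]. *)
  have yxz p : fl p i0 y = fl p i0 x \/ fl p i0 y = fl p i0 z.
    have /andP[xy yz] := xyz; have := fl_le p i0 xy; have := fl_le p i0 yz.
    have : fl p i0 z <= fl p i0 x + 1 by apply: fl_lt; lra.
    lia.
  move=> p [ip|ip].
    case: (yxz p) => /cell_xyz e; rewrite e in ip *; [apply: hx|apply: hz]; by left.
  have ex := hx p (or_intror ip); have ez := hz p (or_intror ip).
  rewrite -ex; apply: cell_xyz; apply: fl_between xyz _.
  by rewrite (cell_fl _ _ _ ex) (cell_fl _ _ _ ez).
move=> x x01; rewrite big_ord1; congr ((nat_of_bool _)%:R).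
apply/asboolP/forallP => [sx i|/(_ i0)].
  by rewrite in_setE (i0P i); split=> //; rewrite cst.
by rewrite in_setE => -[_]; rewrite cst.
Qed.

Section Cells.
Variables (t : patch_type) (Om : set Rk) (w0 : 'cV[R]_m).

(** Satisfied by every displacement given by [cell], whatever the starting point in the half-open
    cube. *)
Definition near_plane (p : 'cV[int]_d) (q : 'cV[int]_m) : Prop :=
  forall i, `|(q i 0)%:~R - (L *m map_mx intr p) i 0| < 1.

(** Membership in the region may depend on [q], hence on [w], only for ambiguous [p]; these lie
    close to the boundary of the region. *)
Definition sure p := forall q, near_plane p q -> inside L F t Om p q.
Definition ruled_out p := forall q, near_plane p q -> ~ inside L F t Om p q.
Definition ambiguous p := ~ sure p /\ ~ ruled_out p.

Definition core (i : 'I_m) : set R :=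
  [set x | 0 <= x < 1 /\ forall p, sure p -> fl p i x = fl p i (w0 i 0)].

Lemma cell_near (w : 'cV[R]_m) p : (forall i, 0 <= w i 0 < 1) ->
  near_plane p (cell L w p).
Proof.
move=> w01 i; have := w01 i; rewrite mxE mulrNz.
have := floor_bounds (w i 0 - (L *m map_mx intr p) i 0).
by rewrite ltr_norml; lra.
Qed.

Variables (M K : nat).
Local Notation points := {ffun 'I_d -> 'I_M.*2.+1}.

Definition cuts (i : 'I_m) (x' x : R) : {set points} :=
  [set p | `[< ambiguous (cvec p) >] && (fl (cvec p) i x != fl (cvec p) i x')].

(* All summands are nondecreasing in [x], so equality of levels within the core
   forces equality of all summands. *)
Definition level (i : 'I_m) (x : R) : int :=
  \sum_(p : points | `[< ambiguous (cvec p) >]) fl (cvec p) i x.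

(** Each summand rises by 0 or 1, so the level counts the jumps. *)
Lemma level_cuts i (x' x : R) : x' <= x -> x < x' + 1 ->
  level i x = level i x' + #|cuts i x' x|%:Z.
Proof.
move=> le_x lt_x; apply/eqP; rewrite addrC -subr_eq -sumrB; apply/eqP.
rewrite -sum1_card -natz natr_sum.
rewrite [RHS](eq_bigl (fun p : points => `[< ambiguous (cvec p) >] &&
   (fl (cvec p) i x != fl (cvec p) i x'))); last by move=> p; rewrite inE.
rewrite [RHS]big_mkcondr; apply: eq_bigr => p _.
have := fl_le (cvec p) i le_x; have := fl_lt (cvec p) i lt_x.
by case: eqP => [->|ne] h1 h2; rewrite /= ?subrr // mulr1n; lia.
Qed.

Hypothesis m0 : (0 < m)%N.
Hypothesis K0 : (0 < K)%N.
Hypothesis ambiguous_le : forall p, ambiguous p -> forall j, `|p j 0| <= M%:Z.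
Hypothesis few_cuts : forall i x' x, core i x' -> core i x -> x' <= x ->
  (#|cuts i x' x| < K)%N.

Lemma same_level i (x' x : R) p : core i x' -> core i x -> x' <= x ->
  (level i x = level i x' %[mod K%:Z])%Z -> ambiguous p -> fl p i x = fl p i x'.
Proof.
move=> cx' cx le_x lev amb; have [p' pE] := cvecP (ambiguous_le amb).
have cuts0 : #|cuts i x' x| = 0%N.
  have lt_x : x < x' + 1 by case: cx => ? _; case: cx' => ? _; lra.
  have := few_cuts cx' cx le_x; move/eqP: lev; rewrite (level_cuts i le_x lt_x).
  rewrite eqz_mod_dvd addrC addKr dvdzE /= => dv ltK.
  by apply/eqP; apply: contraLR ltK; rewrite -lt0n -leqNgt => c0; exact: dvdn_leq.
apply/eqP; apply: contraT => ne.
move/eqP: cuts0; rewrite cards_eq0 => /eqP/setP/(_ p'); rewrite !inE -pE ne andbT.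
by move=> /asboolP.
Qed.

(** Reduction modulo [K] gives a finite index set and loses nothing, because levels within the core
    differ by less than [K]. *)
Definition level_cell (i : 'I_m) (k : 'I_K) : set R :=
  [set x | core i x /\ (level i x %% K%:Z)%Z = k].

Lemma level_cell_convex i k : convex_unit (level_cell i k).
Proof.
split=> [x [[/andP[-> /ltW ->]]]//|x y z [cx lx] [cz lz] xyz].
have xz : x <= z by lra.
have fl_y p : fl p i x = fl p i z -> fl p i y = fl p i x by exact: fl_between.
split.
  case: (cx) => x01 hx; case: (cz) => z01 hz; split; first lra.
  by move=> p sp; rewrite fl_y ?hx ?hz.
rewrite -lx; congr (_ %% _)%Z; apply: eq_bigr => p /asboolP amb.
by apply: fl_y; rewrite (same_level cx cz xz _ amb) // lx lz.
Qed.

(** On a product of level cells, [cell] is constant at every sure or ambiguous [p], so acceptance is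
    decided by one point. Products without an accepted point are replaced by empty boxes. *)
Lemma level_cell_boxes :
  box_decomposition (fun w => same_class L F t Om w w0) (K ^ m).
Proof.
pose Phi w := same_class L F t Om w w0.
have Phi_core (x : 'cV[R]_m) : (forall i, 0 <= x i 0 < 1) -> Phi x -> forall i, core i (x i 0).
  move=> x01 Px i; split=> // p sp; have := cell_near p x01.
  by move=> /sp ip; have /cell_eq := Px p (or_introl ip); apply.
have same_cell i k x x' p : level_cell i k x -> level_cell i k x' -> ambiguous p ->
    fl p i x = fl p i x'.
  move=> [cx lx] [cx' lx'] amb; have [le_x|/ltW le_x] := leP x' x.
    by apply: same_level amb; rewrite // lx lx'.
  by apply/esym; apply: same_level amb; rewrite // lx lx'.
have Phi_cells (j : 'I_m -> 'I_K) (x x' : 'cV[R]_m) :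
    (forall i, level_cell i (j i) (x i 0)) ->
    (forall i, level_cell i (j i) (x' i 0)) -> Phi x' -> Phi x.
  move=> xj x'j Px' p.
  have c01 (u : 'cV[R]_m) : (forall i, level_cell i (j i) (u i 0)) -> forall i, 0 <= u i 0 < 1.
    by move=> uj i; have [[]] := uj i.
  have nx := cell_near p (c01 x xj); have nx' := cell_near p (c01 x' x'j).
  have [sp|nsp] := pselect (sure p).
    move=> _; apply/cell_eq => i; have [[_ h] _] := xj i; exact: h.
  have [op|nop] := pselect (ruled_out p).
    case=> ip; first by case: (op _ nx ip).
    have e : cell L x' p = cell L w0 p by apply: Px'; right.
    by case: (op _ nx'); rewrite e.
  have e : cell L x p = cell L x' p.
    by apply/cell_eq => i; apply: same_cell (xj i) (x'j i) _.
  by rewrite e; exact: Px'.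
pose ok (j : {ffun 'I_m -> 'I_K}) : Prop :=
  exists x : 'cV[R]_m, (forall i, level_cell i (j i) (x i 0)) /\ Phi x.
pose B (j : {ffun 'I_m -> 'I_K}) i : set R :=
  if `[< ok j >] then level_cell i (j i) else set0.
exists {ffun 'I_m -> 'I_K}, B, (fun j i => inf (B j i)), (fun j i => sup (B j i)).
split.
- by rewrite card_ffun !card_ord.
- move=> j i; apply: convex_unit_between; rewrite /B; case: ifP => _ //.
  exact: level_cell_convex.
move=> x x01; have memB j : [forall i, x i 0 \in B j i] ->
    ok j /\ forall i, level_cell i (j i) (x i 0).
  move=> /forallP xB; have := xB (Ordinal m0); rewrite /B.
  case: asboolP => [okj _|_]; last by rewrite in_setE.
  by split=> // i; have := xB i; rewrite /B asboolT // in_setE.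
case: asboolP => [Px|nPx].
  have c := Phi_core x x01 Px.
  have res i : exists k : 'I_K, (level i (x i 0)%R %% K%:Z)%Z = k.
    have : (0 <= (level i (x i 0)%R %% K%:Z)%Z) by rewrite modz_ge0 // -lt0n.
    have : ((level i (x i 0)%R %% K%:Z)%Z < K%:Z) by rewrite ltz_pmod.
    case: (_ %% _)%Z => // n; rewrite ltz_nat => nK _; by exists (Ordinal nK).
  have [k kP] := choice res.
  have xk i : level_cell i ([ffun i => k i] i) (x i 0) by split; rewrite ?ffunE.
  rewrite (bigD1 [ffun i => k i]) //= big1 ?addr0.
    rewrite (_ : [forall i, _] = true) //; apply/forallP => i.
    rewrite in_setE /B asboolT //; by exists x.
  move=> j jk; case: (boolP [forall i, _]) => // /memB[_ xj].
  case/eqP: jk; apply/ffunP => i; apply: val_inj; rewrite ffunE.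
  by have [_] := xj i; rewrite kP => -[].
rewrite big1 // => j _; case: (boolP [forall i, _]) => // /memB[[x' [x'j Px']] xj].
by case: nPx; exact: Phi_cells xj x'j Px'.
Qed.

End Cells.
End Boxes.

(** * Type I patches *)

Section Regions.
Context {R : realType} {d m : nat}.
Local Notation Rk := 'cV[R]_(d + m).
Variables (L : 'M[R]_(m, d)).
Local Notation E := (physical_space L).
Implicit Types (Om : set Rk).

Lemma region_ball Om : patch_region E Om ->
  exists2 dl : R, 0 < dl & forall v, v \in E -> (forall l, `|v l 0| < dl) -> Om v.
Proof.
move=> [_ _ _ /nbhs_ballP[e /= e0 be]]; exists (e / 2); first lra.
move=> v vE vl; apply: be => //; rewrite mx_norm_ball /ball_ /= sub0r normrN.
apply: (@le_lt_trans _ _ (e / 2)); last lra.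
by apply: mx_norm_le => [|i j]; [lra | rewrite ord1 ltW].
Qed.

Lemma region_bounded Om : patch_region E Om ->
  exists2 bt : R, 0 < bt & forall v, Om v -> forall l, `|v l 0| <= bt.
Proof.
move=> [_ /ex_strict_bound_gt0[bt bt0 h] _ _]; exists bt => // v Ov l.
by apply: le_trans (coord_le_mx_norm v l 0) _; apply: ltW; exact: h.
Qed.

Lemma region_star Om v (t : R) : patch_region E Om -> Om v -> 0 <= t <= 1 ->
  Om (t *: v).
Proof.
move=> reg Ov t01; have [dl dl0 ball] := region_ball reg.
have O0 : Om 0.
  by apply: ball => [|l]; rewrite ?mem0v // mxE normr0.
case: reg => _ _ cvx _; case/andP: t01 => t0 t1.
have := cvx (v : convex_lmodType Rk) (0 : convex_lmodType Rk) (Itv01 t0 t1).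
rewrite !in_setE => /(_ Ov O0).
suff -> : conv (Itv01 t0 t1) (v : convex_lmodType Rk) (0 : convex_lmodType Rk) = t *: v.
  by [].
by rewrite -[LHS]/(t *: v + _ *: 0) scaler0 addr0.
Qed.

Lemma dilateE Om (r : R) v : 0 < r -> dilate r Om v <-> Om (r^-1 *: v).
Proof.
move=> r0; have rn : r != 0 by rewrite gt_eqF.
split=> [[w Ow <-]|Ov]; first by rewrite scalerA mulVf ?scale1r.
by exists (r^-1 *: v); rewrite // scalerA mulfV ?scale1r.
Qed.

Variable F : {vspace Rk}.
Hypothesis adm : admissible E F.

(** Bounds how far [proj_pi] moves a near-plane lattice vector away from the graph point over the
    same [p]. *)
Definition fibre_bound : R :=
  1 + \sum_i \sum_l `|proj_pi L F (fibre_map (delta_mx i 0)) l 0|.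

Lemma fibre_bound_gt0 : 0 < fibre_bound.
Proof. by rewrite ltr_pwDl // sumr_ge0 // => i _; rewrite sumr_ge0. Qed.

Lemma proj_fibre_le (z : 'cV[R]_m) : (forall i, `|z i 0| <= 1) ->
  forall l, `|proj_pi L F (fibre_map z) l 0| <= fibre_bound.
Proof.
move=> z1 l; have -> : z = \sum_i z i 0 *: delta_mx i 0.
  by rewrite {1}[z]matrix_sum_delta; apply: eq_bigr => i _; rewrite big_ord1.
rewrite /proj_pi !linear_sum summxE.
apply: le_trans (ler_norm_sum _ _ _) _; rewrite /fibre_bound -[leLHS]add0r.
apply: lerD => //; apply: ler_sum => i _.
rewrite (bigD1 l) //= !linearZ mxE normrM -[leLHS]addr0; apply: lerD.
  by rewrite -[leRHS]mul1r ler_wpM2r.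
by apply: sumr_ge0.
Qed.

Lemma near_plane_first p q (j : 'I_d) : near_plane L p q ->
  `|proj_pi L F (nvec p q) (lshift m j) 0 - (p j 0)%:~R| <= fibre_bound.
Proof.
move=> near; rewrite (proj_pi_graph adm) mxE /graph_map col_mxEu.
rewrite {1}/nvec col_mxKu mxE addrAC subrr add0r.
apply: proj_fibre_le => i; rewrite star_nvec.
exact: ltW (near i).
Qed.

Definition graph_bound : R := 1 + \sum_i \sum_j `|L i j|.

Lemma graph_bound_ge1 : 1 <= graph_bound.
Proof. by rewrite lerDl sumr_ge0 // => i _; rewrite sumr_ge0. Qed.

Lemma near_plane_le p q (B : R) l : near_plane L p q -> 0 <= B ->
  (forall j, `|p j 0|%:~R <= B) ->
  `|proj_pi L F (nvec p q) l 0| <= graph_bound * B + fibre_bound.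
Proof.
move=> near B0 pB; rewrite (proj_pi_graph adm) mxE.
apply: le_trans (ler_normD _ _) _; apply: lerD; last first.
  by apply: proj_fibre_le => i; rewrite star_nvec; exact: ltW (near i).
rewrite /graph_map /nvec col_mxKu mxE; case: splitP => [j _|i _].
  rewrite mxE -intr_norm; apply: le_trans (pB j) _.
  by rewrite ler_peMl // graph_bound_ge1.
rewrite mxE; apply: le_trans (ler_norm_sum _ _ _) _.
rewrite /graph_bound mulrDl mul1r -[leLHS]add0r; apply: lerD => //.
rewrite mulr_suml (bigD1 i) //= -[leLHS]addr0; apply: lerD; last first.
  by apply: sumr_ge0 => i' _; rewrite mulr_ge0 // sumr_ge0.
rewrite mulr_suml; apply: ler_sum => j _; rewrite normrM mxE -intr_norm.
exact: ler_wpM2l.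
Qed.

Lemma ambiguous_bounded Om : patch_region E Om ->
  exists2 bt : R, 0 < bt & forall r p, 0 < r ->
    ambiguous L F type_I (dilate r Om) p -> forall j, `|p j 0|%:~R <= r * bt + fibre_bound.
Proof.
move=> reg; have [bt bt0 Obt] := region_bounded reg.
exists bt => // r p r0 [_ nout] j.
have [q near] : exists2 q, near_plane L p q & inside L F type_I (dilate r Om) p q.
  by apply: contrapT => none; apply: nout => q near ip; apply: none; exists q.
move=> /(dilateE _ _ r0) /Obt /(_ (lshift m j)).
rewrite mxE normrM normfV (gtr0_norm r0) ler_pdivrMl // => pv.
have := near_plane_first j near; rewrite intr_norm.
set v := proj_pi _ _ _ _ _ in pv *; set x := _%:~R => xv.
have -> : x = v - (v - x) by ring.
by apply: le_trans (ler_normB _ _) _; rewrite lerD.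
Qed.

End Regions.

(** * Type I patches in physical dimension 1 *)

Section Dimension1.
Context {R : realType} {d m : nat}.
Local Notation Rk := 'cV[R]_(d + m).
Variables (L : 'M[R]_(m, d)) (F : {vspace Rk}).
Local Notation E := (physical_space L).
Hypothesis adm : admissible E F.
Variable j0 : 'I_d.
Hypothesis d1 : forall j, j = j0.

Lemma physical_line (u v : Rk) (a : R) : u \in E -> v \in E ->
  u (lshift m j0) 0 = a * v (lshift m j0) 0 -> u = a *: v.
Proof.
move=> /physical_spaceP uE /physical_spaceP vE uv.
have uu : usubmx u = a *: usubmx v by apply/colP => j; rewrite !mxE (d1 j).
by rewrite -[u]vsubmxK -[v in RHS]vsubmxK scale_col_mx uE vE uu -scalemxAr.
Qed.

(* Between a point of the dilated region and the origin everything belongs to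
   the region, so on each side of the origin ambiguous points are clustered. *)
Lemma ambiguous_cluster Om (r : R) (sg : int) (c : nat) p p' :
  patch_region E Om -> 0 < r -> (sg == 1) || (sg == -1) ->
  fibre_bound L F <= c%:R ->
  ambiguous L F type_I (dilate r Om) p -> ambiguous L F type_I (dilate r Om) p' ->
  c%:Z < sg * p j0 0 -> sg * p' j0 0 <= sg * p j0 0 + (2 * c)%:Z.
Proof.
move=> reg r0 sg1 cb [nsure _] [_ nout] cp; rewrite leNgt; apply/negP => far.
have [q' near' ip'] : exists2 q, near_plane L p' q & inside L F type_I (dilate r Om) p' q.
  by apply: contrapT => none; apply: nout => q near ip; apply: none; exists q.
apply: nsure => q near.
have e := le_trans (near_plane_first adm j0 near) cb.
have e' := le_trans (near_plane_first adm j0 near') cb.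
set u := proj_pi L F (nvec p q) in e *; set v := proj_pi L F (nvec p' q') in e' ip' *.
set x := u (lshift m j0) 0 in e *; set y := v (lshift m j0) 0 in e' *.
have [s sE] : exists s : R, s = sg%:~R by exists sg%:~R.
have s1 : s = 1 \/ s = -1 by rewrite sE; case/orP: sg1 => /eqP ->; [left|right; rewrite mulrNz].
have cpR : c%:R + 1 <= s * (p j0 0)%:~R.
  by rewrite sE -intrM -[c%:R]/((c%:Z)%:~R) -(intrD _ _ 1) ler_int lezD1.
have farR : s * (p j0 0)%:~R + 2 * c%:R <= s * (p' j0 0)%:~R.
  rewrite sE -!intrM -natrM -[(2 * c)%:R]/((2 * c)%:Z%:~R) -intrD ler_int.
  exact: ltW.
(* Both first coordinates are within [c] of their integers, so the margins [c] and [2 * c] fix sign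
   and order. *)
have [x0 xy] : 0 < s * x /\ s * x <= s * y.
  by move: e e'; rewrite !ler_norml; case: s1 cpR farR => -> ? ?; split; lra.
have y0 : 0 < s * y by apply: lt_le_trans xy.
have yn : y != 0 by apply: contraTneq y0 => ->; rewrite mulr0 ltxx.
have sn : s != 0 by case: s1 => ->; rewrite ?oppr_eq0 oner_eq0.
have t01 : 0 <= (s * x) / (s * y) <= 1.
  by rewrite divr_ge0 ?(ltW x0) ?(ltW y0) //= ler_pdivrMr // mul1r.
have uv : u = ((s * x) / (s * y)) *: v.
  apply: physical_line; rewrite ?proj_pi_mem // -/x -/y.
  by field; rewrite yn.
apply/(dilateE _ _ r0); rewrite -/u uv scalerA mulrC -scalerA.
by apply: (region_star reg) t01; apply/(dilateE _ _ r0).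
Qed.

(** Right of [c], left of [- c] and in between, ambiguous integers differ by at most [2 * c], so
    residues modulo [2 * c + 1] separate them; two booleans encode the zone. *)
Lemma few_ambiguous Om (r : R) (c M : nat) : patch_region E Om -> 0 < r ->
  fibre_bound L F <= c%:R ->
  (#|[set p : {ffun 'I_d -> 'I_M.*2.+1} |
      `[< ambiguous L F type_I (dilate r Om) (cvec p) >] ]| <= 4 * (2 * c).+1)%N.
Proof.
move=> reg r0 cb; set A := [set p | _].
pose x (p : {ffun 'I_d -> 'I_M.*2.+1}) : int := cvec p j0 0.
pose zone p : bool * bool := (c%:Z < x p, c%:Z < - x p).
pose res p : 'I_(2 * c).+1 := inord (absz (x p %% (2 * c).+1%:Z)%Z).
have fI : {in A &, injective (fun p => (zone p, res p))}.
  move=> p p'; rewrite !inE => /asboolP ap /asboolP ap' [z1 z2 rr].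
  have close : `|x p - x p'| <= (2 * c)%:Z.
    have c1 := ambiguous_cluster (sg := 1) reg r0 isT cb.
    have cN := ambiguous_cluster (sg := -1) reg r0 isT cb.
    have h1 := c1 _ _ ap ap'; have h1' := c1 _ _ ap' ap.
    have h2 := cN _ _ ap ap'; have h2' := cN _ _ ap' ap.
    rewrite !mul1r -/(x p) -/(x p') in h1 h1'.
    rewrite !mulN1r -/(x p) -/(x p') in h2 h2'.
    have [u1|u1] := boolP (c%:Z < x p).
      have u1' : c%:Z < x p' by rewrite -z1.
      by have := h1 u1; have := h1' u1'; clear; lia.
    have [u2|u2] := boolP (c%:Z < - x p).
      have u2' : c%:Z < - x p' by rewrite -z2.
      by have := h2 u2; have := h2' u2'; clear; lia.
    by move: u1 u2 (u1) (u2); rewrite {1}z1 {1}z2; clear; lia.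
  have xx : x p = x p'.
    have bnd u : (0 <= (x u %% (2 * c).+1%:Z)%Z < (2 * c).+1%:Z).
      by rewrite modz_ge0 //= ltz_pmod.
    have {}rr : (x p %% (2 * c).+1%:Z)%Z = (x p' %% (2 * c).+1%:Z)%Z.
      by have := congr1 val rr; have := bnd p; have := bnd p'; rewrite /= !inordK; lia.
    move/eqP: rr; rewrite eqz_mod_dvd => /dvdzP[k kE].
    have : k = 0 by move: close; rewrite kE; nia.
    by move=> k0; apply/eqP; rewrite -subr_eq0 kE k0 mul0r.
  apply: cvec_inj; apply/colP => j; rewrite (d1 j); exact: xx.
rewrite -(card_in_imset fI); apply: leq_trans (max_card _) _.
by rewrite !card_prod !card_bool card_ord.
Qed.

End Dimension1.

(** * Type I patches in general: few cuts in the gaps left by sure points *)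

Section Assembly.
Context {R : realType} {d m : nat}.
Local Notation Rk := 'cV[R]_(d + m).
Variables (L : 'M[R]_(m, d)) (F : {vspace Rk}).
Local Notation E := (physical_space L).

(* A gap left by the sure points has length at most [Disc(N) / N ^ d], hence it
   contains few of the values belonging to a comparable box. *)
Lemma cuts_le (eps C : R) (t : patch_type) (Om : set Rk) (w0 : 'cV[R]_m)
    (N B : nat) (i0 : 'I_m) (x' x : R) :
  0 < eps -> 0 < C -> (0 < N)%N -> (0 < B)%N -> discrepancy_le L eps C ->
  (forall p : 'cV[int]_d, (forall j, `|p j 0| <= N%:Z) -> sure L F t Om p) ->
  core L F t Om w0 i0 x' -> core L F t Om w0 i0 x -> x' <= x ->
  #|cuts L F t Om (B * N) i0 x' x|%:R <=
    (B%:R ^+ d + 1) * C * log1 ((B * N)%:R : R) `^ ((d + m)%:R + eps).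
Proof.
move=> eps0 C0 N0 B0 disc sureN [x'01 hx'] [x01 hx] le_x.
have ex0 : 0 <= (d + m)%:R + eps by rewrite addr_ge0 // ltW.
(* With this shift, the fractional part of [x - L p] is below [x - x'] exactly when the floor jumps
   between [x'] and [x]. *)
pose sg (i : 'I_m) : R := x.
pose A (i : 'I_m) : set R :=
  if i == i0 then [set y | 0 <= y < x - x'] else [set y | 0 <= y < 1].
pose b (i : 'I_m) : R := if i == i0 then x - x' else 1.
have ivlA i : interval_between (A i) 0 (b i).
  rewrite /A /b; case: ifP => _; split=> //; try lra;
    by move=> y /=; lra.
have vol : \prod_i (b i - 0) = x - x'.
  rewrite (bigD1 i0) //= {1}/b eqxx subr0 big1 ?mulr1 // => i /negPf ii.
  by rewrite /b ii subr0.
pose D n : R := C * log1 (n%:R : R) `^ ((d + m)%:R + eps).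
have hitP n (p : {ffun 'I_d -> 'I_n.*2.+1}) :
    [forall i, frac (orbit L sg p i) \in A i] =
    (fl L (cvec p) i0 x != fl L (cvec p) i0 x').
  have orbE i : orbit L sg p i = x - (L *m map_mx intr (cvec p)) i 0.
    rewrite /orbit; congr (_ - _); rewrite mxE; apply: eq_bigr => j _.
    by rewrite [map_mx _ _ _ _]mxE [cvec _ _ _]mxE.
  have key : (frac (orbit L sg p i0) < x - x') = (fl L (cvec p) i0 x != fl L (cvec p) i0 x').
    pose c : R := (L *m map_mx intr (cvec p)) i0 0; pose f := fl L (cvec p) i0 x.
    rewrite orbE /frac -/c -/f.
    have fb := floor_bounds (x - c); rewrite -/(fl L (cvec p) i0 x) -/f in fb.
    apply/idP/idP => [lt|ne].
      apply/eqP => e; have := floor_bounds (x' - c).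
      by rewrite -/(fl L (cvec p) i0 x') -e; lra.
    rewrite ltNge; apply/negP => ge; case/eqP: ne.
    by apply/esym/floor_def; rewrite intrD -/c; lra.
  rewrite -key; apply/forallP/idP => [/(_ i0)|lt i].
    by rewrite /A eqxx in_setE /= => /andP[].
  rewrite in_setE /A; case: eqP => [->|_] /=; last exact: frac_itv.
  by rewrite lt andbT; have /andP[] := frac_itv (orbit L sg p i0).
(* No hit up to [N] forces [(2 N + 1) ^ d * (x - x')] below the discrepancy. *)
have emptyN : hits L sg N A = 0.
  apply: big1 => p _; rewrite hitP; case: eqP => // ne; case: ne.
  have sp := sureN (cvec p) (cvec_le p).
  by rewrite (hx _ sp) (hx' _ sp).
have := disc N sg A (fun=> 0) b N0 ivlA; rewrite emptyN vol sub0r normrN -/(D N).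
have := disc (B * N)%N sg A (fun=> 0) b _ ivlA; rewrite muln_gt0 B0 N0 vol -/(D _).
move=> /(_ isT) hBN hN.
have cuts_hits : #|cuts L F t Om (B * N) i0 x' x|%:R <= hits L sg (B * N) A.
  rewrite /hits; under [leRHS]eq_bigr do rewrite hitP.
  rewrite -sum1_card natr_sum big_mkcond /=; apply: ler_sum => p _.
  by rewrite inE; case: asbool; case: (_ != _).
have BR : 1 <= B%:R :> R by rewrite ler1n.
have scale : (B * N).*2.+1%:R ^+ d <= B%:R ^+ d * N.*2.+1%:R ^+ d :> R.
  rewrite -exprMn -natrM lerXn2r ?nnegrE // ler_nat.
  by rewrite mulnS -doubleMr -add1n leq_add2r.
have xx0 : 0 <= x - x' by rewrite subr_ge0.
have DN : D N <= D (B * N)%N.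
  apply: ler_wpM2l; first exact: ltW.
  by apply: log1_powR_le; rewrite ?ltr0n // ler_nat leq_pmull.
have hN' : N.*2.+1%:R ^+ d * (x - x') <= D N by apply: le_trans (ler_norm _) hN.
have hBN' := le_trans (ler_norm _) hBN.
have step : (B * N).*2.+1%:R ^+ d * (x - x') <= B%:R ^+ d * D (B * N)%N.
  apply: le_trans (ler_wpM2r xx0 scale) _; rewrite -mulrA.
  by apply: ler_wpM2l; [rewrite exprn_ge0|apply: le_trans DN].
rewrite -[leRHS]mulrA mulrDl mul1r -/(D _).
by apply: le_trans cuts_hits _; lra.
Qed.

Lemma frequency_rate_le t s (rOm P : set Rk) (f g : R -> R) :
  (forall rad, 1 <= rad -> f rad <= g rad) ->
  frequency_rate L F t s rOm P f -> frequency_rate L F t s rOm P g.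
Proof.
move=> fg [xi lim rate]; exists xi => // y rad Yy rad1.
exact: le_trans (rate y rad Yy rad1) (fg rad rad1).
Qed.

Hypothesis adm : admissible E F.

Lemma sure_points Om : patch_region E Om ->
  exists2 kap : R, 0 < kap & \forall r \near +oo, forall p : 'cV[int]_d,
    (forall j, `|p j 0|%:~R <= kap * r) -> sure L F type_I (dilate r Om) p.
Proof.
move=> reg; have [dl dl0 ball] := region_ball reg.
have g0 : 0 < graph_bound L by apply: lt_le_trans (graph_bound_ge1 L).
(* The factor 2 leaves half of the radius [r * dl] for [fibre_bound]. *)
exists (dl / (2 * graph_bound L)); first by rewrite divr_gt0 ?mulr_gt0.
exists (Num.max 0 (2 * fibre_bound L F / dl)); split; first exact: num_real.
move=> r; rewrite gt_max => /andP[r0 rbig] p pN q near.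
apply/(dilateE _ _ r0); apply: ball => [|l].
  by rewrite memvZ // proj_pi_mem.
rewrite mxE normrM normfV (gtr0_norm r0) ltr_pdivrMl //.
have kr0 : 0 <= dl / (2 * graph_bound L) * r.
  by rewrite mulr_ge0 ?divr_ge0 ?mulr_ge0 // ltW.
apply: le_lt_trans (near_plane_le adm l near kr0 pN) _.
have -> : graph_bound L * (dl / (2 * graph_bound L) * r) = dl * r / 2.
  by field; rewrite gt_eqF.
by move: rbig; rewrite ltr_pdivrMr // mulrC [r * dl]mulrC; lra.
Qed.

Lemma few_cells Om (eps C : R) : 0 < eps -> 0 < C -> discrepancy_le L eps C ->
  patch_region E Om -> \forall r \near +oo, exists M K : nat,
  [/\ (0 < K)%N, K%:R ^+ m <= r,
     forall p, ambiguous L F type_I (dilate r Om) p -> forall j, `|p j 0| <= M%:Z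
   & forall w0 i x' x, core L F type_I (dilate r Om) w0 i x' ->
       core L F type_I (dilate r Om) w0 i x -> x' <= x ->
       (#|cuts L F type_I (dilate r Om) M i x' x| < K)%N].
Proof.
move=> eps0 C0 disc reg; have [kap kap0 nearsure] := sure_points reg.
have ex0 : 0 <= (d + m)%:R + eps by rewrite addr_ge0 // ltW.
set e := (d + m)%:R + eps in ex0.
have fb0 := fibre_bound_gt0 L F.
have [bt bt0 ambb] := ambiguous_bounded adm reg.
(* The ratio of outer to inner radius: it makes [B * N] exceed the bound on ambiguous points, even
   after [kap * r] has lost up to half in rounding to [N]. *)
pose B := (Num.trunc (2 * (bt + 1) / kap)).+1.
have BP : 2 * (bt + 1) <= kap * B%:R.
  rewrite [leRHS]mulrC -ler_pdivrMr //; apply: ltW.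
  have /andP[_ ?] : (Num.trunc (2 * (bt + 1) / kap))%:R <= 2 * (bt + 1) / kap < B%:R.
    by apply: trunc_itv; rewrite divr_ge0 ?mulr_ge0 ?addr_ge0 // ltW.
  by [].
pose A : R := (B%:R ^+ d + 1) * C + 2.
have A0 : 0 < A by rewrite ltr_wpDl // mulr_ge0 ?addr_ge0 ?exprn_ge0 // ltW.
have BR : 0 < B%:R :> R by rewrite ltr0n.
pose q := B%:R * kap; have q0 : 0 < q by rewrite mulr_gt0.
have em0 : 0 <= e * m%:R by rewrite mulr_ge0.
(* Chosen so that [A ^ m] times this constant times [q * r] is exactly [r]. *)
have eta0 : 0 < (A ^+ m * q)^-1 by rewrite invr_gt0 mulr_gt0 ?exprn_gt0.
have [M1 [_ small]] := log1_powR_small em0 eta0.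
near=> r.
have r0 : 0 < r by near: r; apply: nbhs_pinfty_gt; exact: num_real.
have sureP (p : 'cV[int]_d) : (forall j, `|p j 0|%:~R <= kap * r) ->
    sure L F type_I (dilate r Om) p.
  by move: p; near: r.
have rkap : 2 / kap <= r by near: r; apply: nbhs_pinfty_ge; exact: num_real.
have rfb : fibre_bound L F <= r by near: r; apply: nbhs_pinfty_ge; exact: num_real.
have rM1 : M1 / q < r by near: r; apply: nbhs_pinfty_gt; exact: num_real.
pose N := Num.trunc (kap * r).
have /andP[N1 N2] : N%:R <= kap * r < N.+1%:R by apply: trunc_itv; rewrite mulr_ge0 // ltW.
have kr2 : 2 <= kap * r by rewrite [leRHS]mulrC -ler_pdivrMr.
have N0 : (0 < N)%N by rewrite -ltnS -(ltr_nat R); apply: le_lt_trans N2; lra.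
have Nhalf : kap * r / 2 <= N%:R by move: N2; rewrite -natr1; lra.
pose M := (B * N)%N.
have MR : M%:R <= q * r by rewrite natrM /q -mulrA ler_pM2l.
have M0 : (0 < M)%N by rewrite muln_gt0.
pose X : R := log1 (M%:R : R) `^ e.
have X1 : 1 <= X.
  by have := ler_powR (log1_ge1 (M%:R : R)) ex0; rewrite powRr0.
pose K := (Num.trunc ((B%:R ^+ d + 1) * C * X)).+1.
have BC0 : 0 <= (B%:R ^+ d + 1) * C by rewrite mulr_ge0 ?addr_ge0 ?exprn_ge0 // ltW.
have /andP[K1 K2] : (Num.trunc ((B%:R ^+ d + 1) * C * X))%:R <=
    (B%:R ^+ d + 1) * C * X < K%:R.
  by apply: trunc_itv; rewrite mulr_ge0 // powR_ge0.
have KA : K%:R <= A * X by rewrite /K -natr1 /A [leRHS]mulrDl; lra.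
exists M, K; split=> //.
- apply: le_trans (_ : (A * X) ^+ m <= _).
    by rewrite lerXn2r ?nnegrE // mulr_ge0 ?(ltW A0) // (le_trans ler01).
  have qrM1 : M1 < q * r by rewrite [ltRHS]mulrC -ltr_pdivrMr.
  have sm := small _ qrM1.
  have Xm : X ^+ m <= log1 (q * r) `^ (e * m%:R).
    rewrite /X -powR_mulrn ?powR_ge0 // -powRrM.
    by apply: log1_powR_le => //; rewrite ltr0n.
  rewrite exprMn -ler_pdivlMl ?exprn_gt0 //; apply: le_trans Xm _.
  apply: le_trans sm _; rewrite le_eqVlt; apply/orP; left; apply/eqP.
  by field; rewrite ?expf_neq0 ?gt_eqF.
- move=> p /(ambb r p r0) pj j; rewrite -(ler_int R); apply: le_trans (pj j) _.
  rewrite -[_%:~R]/(M%:R) natrM.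
  have : B%:R * (kap * r / 2) <= B%:R * N%:R by rewrite ler_pM2l.
  have : r * (2 * (bt + 1)) <= r * (kap * B%:R) by rewrite ler_pM2l.
  by nra.
move=> w0 i x' x cx' cx le_x; rewrite -(ltr_nat R); apply: le_lt_trans K2.
apply: (cuts_le (t := type_I) (w0 := w0) eps0 C0 N0 _ disc _ cx' cx le_x) => // p pN.
apply: sureP => j; apply: le_trans N1.
by rewrite -[N%:R]/((N%:Z)%:~R) ler_int.
Unshelve. all: by end_near.
Qed.

End Assembly.

Lemma lebesgue_null_sub (R : realType) (m n : nat) (A B : set 'M[R]_(m, n)) :
  A `<=` B -> lebesgue_null B -> lebesgue_null A.
Proof.
move=> AB nB e /nB [a [b [ab Bab le_e]]]; exists a, b; split=> //.
exact: subset_trans Bab.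
Qed.

Section TypeI.
Context {R : realType} {d m : nat}.
Local Notation Rk := 'cV[R]_(d + m).
Variables (L : 'M[R]_(m, d)) (F : {vspace Rk}).
Local Notation E := (physical_space L).
Hypothesis adm : admissible E F.
Hypotheses (d0 : (0 < d)%N) (m0 : (0 < m)%N).

(** Cuts are ambiguous points, whose number is bounded independently of [r]; the final successor in
    [K] makes the bound strict. *)
Lemma dim1_boxes : d = 1 -> exists2 K : nat, (0 < K)%N &
  forall Om (r : R) (w0 : 'cV[R]_m), patch_region E Om -> 0 < r ->
    box_decomposition (fun w => same_class L F type_I (dilate r Om) w w0) K.
Proof.
move=> d1; pose c := (Num.trunc (fibre_bound L F)).+1.
have cb : fibre_bound L F <= c%:R.
  apply: ltW; rewrite /c.
  by have /andP[] := trunc_itv (ltW (fibre_bound_gt0 L F)).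
pose K := (4 * (2 * c).+1).+1; exists (K ^ m)%N; first by rewrite expn_gt0.
move=> Om r w0 reg r0; have [bt bt0 bnd] := ambiguous_bounded adm reg.
have rb0 : 0 <= r * bt + fibre_bound L F.
  by rewrite addr_ge0 ?mulr_ge0 ?(ltW r0) ?(ltW bt0) // ltW ?fibre_bound_gt0.
pose M := (Num.trunc (r * bt + fibre_bound L F)).+1.
apply: (level_cell_boxes (M := M)) => //.
  move=> p amb j; rewrite -(ler_int R); apply: le_trans (bnd _ _ r0 amb j) _.
  by apply: ltW; have /andP[] := trunc_itv rb0.
have allj (j : 'I_d) : j = Ordinal d0.
  apply: val_inj => /=; have := ltn_ord j; rewrite [X in (_ < X)%N]d1.
  by case: (j : nat).
move=> i x' x _ _ _; rewrite ltnS.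
apply: leq_trans (few_ambiguous adm allj M reg r0 cb); apply: subset_leq_card.
by apply/fintype.subsetP => p; rewrite !inE => /andP[].
Qed.

(* The exponent [(d - 1)(m - 1)] vanishes exactly when [d = 1] or [m = 1]; in
   all other cases it is at least 1 and absorbs polylogarithmic factors. *)
Lemma type_I_boxes (eps C : R) : 0 < eps -> 0 < C -> discrepancy_le L eps C ->
  exists2 K0 : R, 0 < K0 & forall Om, patch_region E Om ->
  \forall r \near +oo, forall w0 : 'cV[R]_m, exists2 K : nat,
    K%:R <= K0 * r ^+ ((d - 1) * (m - 1)) &
    box_decomposition (fun w => same_class L F type_I (dilate r Om) w w0) K.
Proof.
move=> eps0 C0 disc.
have [d1|dn1] := eqVneq d 1%N.
  have [K K0 boxes] := dim1_boxes d1; exists K%:R; first by rewrite ltr0n.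
  move=> Om reg; near=> r => w0; exists K; first by rewrite d1 mul0n mulr1.
  by apply: boxes => //; near: r; apply: nbhs_pinfty_gt; exact: num_real.
exists 1 => // Om reg; have [m1|mn1] := eqVneq m 1%N.
  near=> r => w0; exists 1%N; first by rewrite m1 subnn muln0 mulr1.
  exact: codim1_boxes.
have cells := few_cells adm eps0 C0 disc reg.
near=> r => w0.
have r1 : 1 <= r by near: r; apply: nbhs_pinfty_ge; exact: num_real.
have [M [K [K0 Kr ambM few]]] : exists M K : nat,
  [/\ (0 < K)%N, K%:R ^+ m <= r,
     forall p, ambiguous L F type_I (dilate r Om) p -> forall j, `|p j 0| <= M%:Z
   & forall w0 i x' x, core L F type_I (dilate r Om) w0 i x' ->
       core L F type_I (dilate r Om) w0 i x -> x' <= x ->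
       (#|cuts L F type_I (dilate r Om) M i x' x| < K)%N] by near: r.
exists (K ^ m)%N; last by exact: (level_cell_boxes m0 K0 ambM (few w0)).
rewrite natrX mul1r; apply: le_trans Kr _; rewrite ler_eXnr // muln_gt0 !subn_gt0.
by apply/andP; split; lia.
Unshelve. all: by end_near.
Qed.

End TypeI.

Theorem theorem5p1 (R : realType) (d k : nat) (eps : R) :
  (0 < d)%N -> (d < k)%N -> 0 < eps ->
  lebesgue_ae (fun L : 'M[R]_(k - d, d) =>
    totally_irrational (physical_space L) ->
    forall F : {vspace 'cV[R]_(d + (k - d))},
    admissible (physical_space L) F ->
    exists2 C : R, 0 < C &
    forall s : 'cV[R]_(d + (k - d)), regular L F s ->
    forall Omega : set 'cV[R]_(d + (k - d)),
    patch_region (physical_space L) Omega ->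
    (forall (r : R) y', 0 < r -> cut_and_project L F s y' ->
       let rOmega := dilate r Omega in
       frequency_rate L F type_II s rOmega
         (patch_class L F type_II s y' rOmega)
         (fun rad => C * (log1 rad `^ (k%:R + eps) / rad ^+ d)))
    /\
    (\forall r \near +oo, forall y', cut_and_project L F s y' ->
       let rOmega := dilate r Omega in
       frequency_rate L F type_I s rOmega
         (patch_class L F type_I s y' rOmega)
         (fun rad => C * (log1 rad `^ (k%:R + eps)
                          * r ^+ ((d - 1) * (k - d - 1)) / rad ^+ d)))).
Proof.
move=> d0 dk eps0; have m0 : (0 < k - d)%N by rewrite subn_gt0.
have q1 : 1 < 2 `^ eps :> R.
  by rewrite /powR pnatr_eq0 /= expR_gt1 mulr_gt0 // ln_gt0 // ltr1n.
apply: lebesgue_null_sub (ae_good_matrix m0 d0 q1) => L /= nP good; apply: nP.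
move=> _ F adm; have [C C0 disc] := good_discrepancy m0 d0 eps0 good.
have [K0 K00 boxesI] := type_I_boxes adm d0 m0 eps0 C0 disc.
have kE : (d + (k - d))%N = k by rewrite subnKC // ltnW.
(* [C] serves type II, where one box suffices, and [K0 * C] serves type I. *)
exists (C + K0 * C); first by rewrite addr_gt0 // mulr_gt0.
have q_ge0 rad : 1 <= rad -> 0 <= log1 rad `^ (k%:R + eps) / rad ^+ d :> R.
  by move=> rad1; rewrite divr_ge0 ?powR_ge0 // exprn_ge0 // (le_trans ler01).
move=> s reg Om regO; split.
  move=> r y' r0 Yy' /=.
  apply: frequency_rate_le (rate_of_boxes d0 eps0 C0 disc adm reg Yy'
    (type_II_boxes _ _ _ _)) => rad rad1.
  rewrite kE mul1r; apply: ler_wpM2r; first exact: q_ge0.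
  by rewrite lerDl mulr_ge0 // ltW.
have boxes := boxesI Om regO.
near=> r => y' Yy' /=.
have r0 : 0 < r by near: r; apply: nbhs_pinfty_gt; exact: num_real.
have [K Kr box] : exists2 K : nat, K%:R <= K0 * r ^+ ((d - 1) * (k - d - 1)) &
    box_decomposition (fun w => same_class L F type_I (dilate r Om) w
      (star L (lift_pt L F s y'))) K.
  (* The threshold on [r] is uniform in the reference point, hence in [y']. *)
  by move: (star L _); near: r.
apply: frequency_rate_le (rate_of_boxes d0 eps0 C0 disc adm reg Yy' box) => rad rad1.
rewrite kE; set X := log1 rad `^ _; set e := (_ * _)%N in Kr *.
have -> : X * r ^+ e / rad ^+ d = r ^+ e * (X / rad ^+ d) by rewrite mulrAC mulrC.
rewrite [leRHS]mulrA; apply: ler_wpM2r; first exact: q_ge0.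
apply: le_trans (ler_wpM2r (ltW C0) Kr) _.
by rewrite mulrDl mulrAC lerDr mulr_ge0 ?exprn_ge0 // ltW.
Unshelve. all: by end_near.
Qed.
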